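(* Let $\Lambda_0,\Lambda_1$ be the fundamental weights and $\alpha_0,\alpha_1$ the simple roots of the affine Kac--Moody algebra $A_1^{(1)}$, and let $\delta=\alpha_0+\alpha_1$ be the null root. Then $$e^{-(\Lambda_0+\Lambda_1)}\operatorname{ch} L(\Lambda_0+\Lambda_1) = (-e^{-\alpha_0},-e^{-\alpha_1},-e^{-\delta};e^{-\delta})_\infty,$$ $$e^{-2\Lambda_0}\operatorname{ch} L(2\Lambda_0) = \frac{1}{2}\left[(-e^{-\frac{\delta}{2}+\alpha_1},-e^{-\frac{\delta}{2}-\alpha_1},-e^{-\frac{\delta}{2}};e^{-\delta})_\infty+(e^{-\frac{\delta}{2}+\alpha_1},e^{-\frac{\delta}{2}-\alpha_1},e^{-\frac{\delta}{2}};e^{-\delta})_\infty\right],$$ $$e^{-2\Lambda_1}\operatorname{ch} L(2\Lambda_1) = \frac{1}{2}\left[(-e^{-\frac{3\delta}{2}+\alpha_1},-e^{\frac{\delta}{2}-\alpha_1},-e^{-\frac{\delta}{2}};e^{-\delta})_\infty+(e^{-\frac{3\delta}{2}+\alpha_1},e^{\frac{\delta}{2}-\alpha_1},e^{-\frac{\delta}{2}};e^{-\delta})_\infty\right].$$ Moreover, the right-hand sides of the second and third identities are of the form $\frac12\big(G(x_1,x_2,x_3,y)+G(-x_1,-x_2,-x_3,y)\big)$, where $G(x_1,x_2,x_3,y)=(-x_1,-x_2,-x_3;y)_\infty$ is a power series with non-negative coefficients, $y=e^{-\delta}$, and $(x_1,x_2,x_3)=(e^{-\frac{\delta}{2}+\alpha_1},e^{-\frac{\delta}{2}-\alpha_1},e^{-\frac{\delta}{2}})$,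 respectively $(e^{-\frac{3\delta}{2}+\alpha_1},e^{\frac{\delta}{2}-\alpha_1},e^{-\frac{\delta}{2}})$; therefore they have non-negative coefficients.
   Context: For a dominant integral weight $\lambda$ of $A_1^{(1)}$, $L(\lambda)$ is the irreducible highest weight module of highest weight $\lambda$, and $\operatorname{ch} L(\lambda)=\sum_{\mu\in P}\dim L(\lambda)_\mu\, e^{\mu}$, where $P$ is the integral weight lattice (of the full affine algebra, including the $\delta$-direction), $e$ is a formal exponential ($e^{\mu}e^{\nu}=e^{\mu+\nu}$) and $L(\lambda)_\mu$ is the weight space of weight $\mu$. Notation: $(a;q)_\infty:=\prod_{k\ge0}(1-aq^k)$ and $(a_1,\dots,a_j;q)_\infty:=(a_1;q)_\infty\cdots(a_j;q)_\infty$. Products are expanded as formal series in powers of $e^{-\delta/2}$ with coefficients Laurent polynomials in $e^{\alpha_1}$ (with $e^{-\alpha_0}=e^{-\delta}e^{\alpha_1}$). If $G(x_1,\dots,x_k,x_{k+1},\dots,x_n)$ is a power series, then $\frac12\big(G(x_1,\dots,x_k,x_{k+1},\dots,x_n)+G(-x_1,\dots,-x_k,x_{k+1},\dots,x_n)\big)$ is the sub-series of $G$ consisting of the terms of even total degree in $x_1,\dots,x_k$. *)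

(* Defs.v *)
(* Conventions.
   - Formal sums of exponentials are functions [M -> rat], the value at m being
     the coefficient of e^m.  Taking M to be the dual of the Cartan subalgebra
     gives sums of e^mu (half-integral multiples of delta included); taking M to
     be the multi-exponents {ffun 'I_n -> nat} gives power series.
   - "The" affine Lie algebra and "the" module L(lambda) are given by structures
     and predicates which determine them up to isomorphism.                    *)
From HB Require Import structures.
From mathcomp Require Import all_boot all_order all_algebra.
From mathcomp Require Import classical_sets functions fsbigop.

Set Implicit Arguments.
Unset Strict Implicit.
Unset Printing Implicit Defensive.

Import Order.TTheory GRing.Theory Num.Theory.
Local Open Scope classical_set_scope.
Local Open Scope ring_scope.

Definition fser (M : Type) : Type := M -> rat.

Section FormalSeries.
Variable M : nmodType.
Implicit Types (F G a q : fser M) (m : M) (N n k : nat).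

Definition fexp m : fser M := fun m' => (m' == m)%:R.

Definition fone : fser M := fexp 0.

Definition fopp F : fser M := fun m => - F m.

Definition fadd F G : fser M := fun m => F m + G m.

Definition fscale (c : rat) F : fser M := fun m => c * F m.

(* Convolution.  [\sum_(p \in A)] is the sum of a finitely supported family; it
   is 0 by convention on a family with infinite support, which never occurs for
   the series considered here. *)
Definition fmul F G : fser M := fun m =>
  \sum_(p \in [set p : M * M | p.1 + p.2 = m]) F p.1 * G p.2.

Definition fpow a n : fser M := iter n (fmul a) fone.

(* (1 - a) (1 - a q) ... (1 - a q^(N-1)) *)
Definition qpoch_partial a q N : fser M :=
  \big[fmul/fone]_(0 <= k < N) fadd fone (fopp (fmul a (fpow q k))).

(* (a; q)_oo: each coefficient is the value at which the corresponding
   coefficients of the partial products stabilise. *)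
Definition qpoch1 a q : fser M := fun m =>
  xget 0 [set c : rat | exists N0, forall N, (N0 <= N)%N ->
                          qpoch_partial a q N m = c].

(* (a_1, ..., a_j; q)_oo *)
Definition qpoch (s : seq (fser M)) q : fser M :=
  \big[fmul/fone]_(a <- s) qpoch1 a q.

Definition fnonneg F : Prop := forall m, 0 <= F m.

End FormalSeries.

Arguments fone {M}.

Declare Scope fser_scope.
Delimit Scope fser_scope with fser.
Bind Scope fser_scope with fser.
Notation "'e^' m" := (fexp m%R) (at level 8, m at level 2, format "'e^' m") :
  fser_scope.
Notation "- F" := (fopp F) : fser_scope.
Notation "F + G" := (fadd F G) : fser_scope.
Notation "F * G" := (fmul F G) : fser_scope.
Notation "c *: F" := (fscale c%R F) : fser_scope.

Section PowerSeries.
Variable n : nat.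

Definition pser : Type := fser {ffun 'I_n -> nat}.

Definition pvar (i : 'I_n) : pser := fexp [ffun j => (j == i : nat)].

Definition fmonom (M : nmodType) (x : 'I_n -> fser M) (m : {ffun 'I_n -> nat}) :
    fser M :=
  \big[@fmul M/fone]_(i < n) fpow (x i) (m i).

(* G(x_0, ..., x_(n-1)): in the coefficient of e^mu only finitely many terms are
   nonzero in the substitutions considered here. *)
Definition psubst (M : nmodType) (G : pser) (x : 'I_n -> fser M) : fser M :=
  fun mu => \sum_(m \in [set: {ffun 'I_n -> nat}]) G m * fmonom x m mu.

End PowerSeries.

Definition args4 (M : nmodType) (x1 x2 x3 y : fser M) : 'I_4 -> fser M :=
  tnth [tuple x1; x2; x3; y].

Section Lie.
Variable K : fieldType.

Record lieAlgebra := LieAlgebra {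
  lie_car :> lmodType K;
  bracket : lie_car -> lie_car -> lie_car;
  bracketDl : forall a x y z,
    bracket (a *: x + y) z = a *: bracket x z + bracket y z;
  bracketDr : forall a x y z,
    bracket z (a *: x + y) = a *: bracket z x + bracket z y;
  bracketxx : forall x, bracket x x = 0;
  bracketJ : forall x y z,
    bracket x (bracket y z) + bracket y (bracket z x)
      + bracket z (bracket x y) = 0 }.

Record lieModule (g : lieAlgebra) := LieModule {
  mod_car :> lmodType K;
  act : g -> mod_car -> mod_car;
  actDl : forall a x y v, act (a *: x + y) v = a *: act x v + act y v;
  actDr : forall a x u v, act x (a *: u + v) = a *: act x u + act x v;
  act_bracket : forall x y v,
    act (bracket x y) v = act x (act y v) - act y (act x v) }.

Definition subspace (V : lmodType K) (W : set V) : Prop :=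
  W 0 /\ forall a u v, W u -> W v -> W (a *: u + v).

Definition subalgebra (g : lieAlgebra) (S : set g) : Prop :=
  subspace S /\ forall x y, S x -> S y -> S (bracket x y).

Definition ideal (g : lieAlgebra) (I : set g) : Prop :=
  subspace I /\ forall x y, I y -> I (bracket x y).

Definition submodule (g : lieAlgebra) (V : lieModule g) (W : set V) : Prop :=
  subspace W /\ forall x v, W v -> W (act x v).

Definition has_dim (V : lmodType K) (W : set V) (d : nat) : Prop :=
  exists b : 'I_d -> V,
    (forall c : 'I_d -> K, \sum_(i < d) c i *: b i = 0 -> forall i, c i = 0) /\
    (forall v, W v <-> exists c : 'I_d -> K, v = \sum_(i < d) c i *: b i).

End Lie.

(* The Cartan subalgebra is K^3 (columns) with basis alpha_0^vee, alpha_1^vee, d,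
   and its dual is K^3 (rows) in the dual basis. *)
Definition cartanA11 : 'M[int]_2 := \matrix_(i, j) (if i == j then 2 else -2).

Section AffineA11.
Variable K : fieldType.

Definition pairing (mu : 'rV[K]_3) (h : 'cV[K]_3) : K := (mu *m h) 0 0.

Definition coroot (i : 'I_2) : 'cV[K]_3 := \col_j (j == i :> nat)%:R.

Definition Lambda (i : 'I_2) : 'rV[K]_3 := \row_j (j == i :> nat)%:R.

(* <alpha_i, alpha_j^vee> = a_ji and <alpha_i, d> = 1 if i = 0, 0 otherwise *)
Definition alpha (i : 'I_2) : 'rV[K]_3 :=
  \row_(j < 3) (if (j < 2)%N then (cartanA11 (inord j) i)%:~R else (i == 0)%:R).

Definition delta : 'rV[K]_3 := alpha 0 + alpha 1.

(* P = Z Lambda_0 + Z Lambda_1 + Z delta *)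
Definition weight_lattice : set 'rV[K]_3 :=
  [set mu | exists z : 'rV[int]_3, mu = map_mx intr z].

(* Kac's definition: generators e_i, f_i and a Cartan subalgebra, subject to the
   relations below, with no nonzero ideal meeting the Cartan subalgebra
   trivially. *)
Record affineA11 := AffineA11 {
  aff_lie :> lieAlgebra K;
  gen_e : 'I_2 -> aff_lie;
  gen_f : 'I_2 -> aff_lie;
  gen_h : 'cV[K]_3 -> aff_lie;
  gen_h_linear : forall a h h', gen_h (a *: h + h') = a *: gen_h h + gen_h h';
  gen_h_inj : injective gen_h;
  gen_hh : forall h h', bracket (gen_h h) (gen_h h') = 0;
  gen_ef : forall i j,
    bracket (gen_e i) (gen_f j) = (if i == j then gen_h (coroot i) else 0);
  gen_he : forall h i,
    bracket (gen_h h) (gen_e i) = pairing (alpha i) h *: gen_e i;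
  gen_hf : forall h i,
    bracket (gen_h h) (gen_f i) = - (pairing (alpha i) h *: gen_f i);
  gen_generate : forall S : set aff_lie, subalgebra S ->
    (forall i, S (gen_e i)) -> (forall i, S (gen_f i)) ->
    (forall h, S (gen_h h)) -> S = setT;
  gen_radical : forall I : set aff_lie, ideal I ->
    (forall h, I (gen_h h) -> h = 0) -> I = [set 0] }.

Variables (g : affineA11) (V : lieModule g).

Definition weight_space (mu : 'rV[K]_3) : set V :=
  [set v | forall h, act (gen_h g h) v = pairing mu h *: v].

Definition irreducible_module : Prop :=
  (exists v : V, v <> 0) /\
  forall W : set V, submodule W -> W = [set 0] \/ W = setT.

(* The positive part of g is generated by e_0 and e_1, and the module generated
   by v is all of V by irreducibility. *)
Definition is_L (lam : 'rV[K]_3) : Prop :=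
  irreducible_module /\
  exists v : V, [/\ v <> 0, weight_space lam v & forall i, act (gen_e g i) v = 0].

(* c = ch V, the sum of (dim V_mu) e^mu over mu in P; in particular these weight
   spaces are finite-dimensional. *)
Definition is_ch (c : fser 'rV[K]_3) : Prop :=
  (forall mu, weight_lattice mu ->
     exists2 d : nat, has_dim (weight_space mu) d & c mu = d%:R) /\
  (forall mu, ~ weight_lattice mu -> c mu = 0).

End AffineA11.

Arguments Lambda {K} i.
Arguments alpha {K} i.
Arguments delta {K}.

(* Main.v *)
(** At level two, the affine algebra of type A_1^(1) acts on the Fock space of two
    charged fermions psi^+, psi^- and one neutral fermion phi by the currents
    e = psi^+ phi and f = phi psi^-. The vacuum is a highest weight vector, of weight
    Lambda_0 + Lambda_1, 2 Lambda_0 or 2 Lambda_1 depending on the moding; in the last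
    two cases one restricts to the states with an even number of particles. An
    invariant subspace is stable under the current J = psi^+ psi^- that e and f
    generate. The quadratic expression \sum_(k > 0) J_(-k) J_k is, up to a function of
    the charge, a sum of occupation numbers weighted by their mode, so its commutators
    with e and f separate their terms, and the subspace is stable under all products
    psi^+_i phi_j and phi_i psi^-_j. These connect any state to the vacuum, so the
    sector is irreducible. An irreducible highest weight module is determined by
    its weight, the isomorphism being the graph of equal words in the f_i on the
    highest weight vectors. Thus the character counts the states by weight: a state
    is a triple of finite sets of modes, whose generating function is a product of
    three q-Pochhammer symbols, and the even triples give the half sums. *)
From HB Require Import structures.
From mathcomp Require Import all_boot all_order all_algebra finmap monalg.
Require Import Defs.
From mathcomp Require Import boolp classical_sets functions cardinality fsbigop reals complex.
From mathcomp Require Import zify ring.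

Set Implicit Arguments.
Unset Strict Implicit.
Unset Printing Implicit Defensive.

Import Order.TTheory GRing.Theory Num.Theory.
Local Open Scope ring_scope.

(** Three fermions carry so(3) at level 1, which is sl(2) at level 2. One Fock space and one family
    of currents serve all three weights: the integer [A] is a spectral flow, which decides that e_1,
    f_1, e_0, f_0 are [Ecur A], [Fcur B], [Fcur (B + 1)], [Ecur (A - 1)] with [B = r - 2 - A], and
    shifts the weights of the slots accordingly. Two divergent sums shape the argument. The current
    J_0 would require normal ordering, so [e_i, f_i] is identified with a Cartan operator by
    induction from the vacuum. The total occupation number is infinite on the filled modes of the
    vacuum, so the quadratic identity is proved in windows of [N + N] consecutive modes, with [N]
    large depending on the vector. The Fock space is compared with [V] through the generators alone:
    [e_i, f_j], [h, f_i], the vacuum relations and the irreducibility of the sector make the graph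
    of words the graph of a bijection onto the sector. *)

(* One slot for each creation operator of the two charged fermions and of the
   neutral one. *)
Definition slot : Type := (nat + nat + nat)%type.

(** Fixes a linear order on the slots, from which the signs [chi] are read off. Since [code] is at
    least the index of the slot, it also bounds the modes in [ex_bounded]. *)
Definition code (t : slot) : nat :=
  match t with
  | inl (inl k) => (3 * k)%N
  | inl (inr k) => (3 * k + 1)%N
  | inr k => (3 * k + 2)%N
  end.

Lemma code_inj : injective code.
Proof.
have E (i j : nat) (f : nat -> slot) : i = j -> f i = f j by move=> ->.
move=> [[i|i]|i] [[j|j]|j] /= h; try lia.
- by apply: (E _ _ (inl \o inl)); lia.
- by apply: (E _ _ (inl \o inr)); lia.
- by apply: (E _ _ inr); lia.
Qed.

Definition state := {fset slot}.

(** Toggling gives commuting involutions, so that creation and annihilation are the same map on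
    states and differ only by an indicator. *)
Definition tog (t : slot) (S : state) : state :=
  if t \in S then (S `\ t)%fset else (t |` S)%fset.

Lemma in_tog s t S : (s \in tog t S) = (s \in S) (+) (s == t).
Proof.
rewrite /tog; case: ifP => h; rewrite !inE; case: eqVneq => [->|_];
  by rewrite ?h ?addbF ?addbT.
Qed.

Lemma togK t : involutive (tog t).
Proof. by move=> S; apply/fsetP => s; rewrite !in_tog -addbA addbb addbF. Qed.

Lemma togC s t S : tog s (tog t S) = tog t (tog s S).
Proof. by apply/fsetP => u; rewrite !in_tog addbAC. Qed.

Lemma sum_tog (R : zmodType) (F : slot -> R) t (S : state) :
  \sum_(s <- tog t S) F s = \sum_(s <- S) F s + (if t \in S then - F t else F t).
Proof.
rewrite /tog; case: ifPn => h; last by rewrite big_fsetU1 //= addrC.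
by rewrite [in RHS](big_fsetD1 t h) /= addrAC subrr add0r.
Qed.

(** * Fermionic Fock space *)

Section Fock.
Variable K : numFieldType.

(** The Jordan-Wigner sign, which makes ladder operators of distinct slots anticommute. *)
Definition chi (t : slot) (S : state) : K :=
  \prod_(s <- S) (-1) ^+ (code s < code t)%N.

Definition parity (S : state) : K := \prod_(s <- S) (-1).

Lemma prod_sign_tog (b : slot -> bool) t (S : state) :
  \prod_(s <- tog t S) (-1 : K) ^+ b s = (-1) ^+ b t * \prod_(s <- S) (-1) ^+ b s.
Proof.
rewrite /tog; case: ifPn => h; last by rewrite big_fsetU1.
by rewrite [in RHS](big_fsetD1 t h) /= mulrA -expr2 sqrr_sign mul1r.
Qed.

Lemma chi_tog s t S : chi s (tog t S) = (-1) ^+ (code t < code s)%N * chi s S.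
Proof. exact: prod_sign_tog. Qed.

Lemma parity_tog t S : parity (tog t S) = - parity S.
Proof.
have -> S' : parity S' = \prod_(s <- S') (-1) ^+ (predT s : bool).
  by apply: eq_bigr => s _; rewrite expr1.
by rewrite prod_sign_tog expr1 mulN1r; congr (- _); apply: eq_bigr => s _; rewrite expr1.
Qed.

Lemma prod_sign_sqr (b : slot -> bool) (S : state) :
  (\prod_(s <- S) (-1 : K) ^+ b s) * (\prod_(s <- S) (-1) ^+ b s) = 1.
Proof. by rewrite -big_split /= big1 // => s _; rewrite -expr2 sqrr_sign. Qed.

Lemma chi_sqr t S : chi t S * chi t S = 1.
Proof. exact: prod_sign_sqr. Qed.

Lemma chi_neq0 t S : chi t S != 0.
Proof. by apply/eqP => h; have := chi_sqr t S; rewrite h mul0r => /eqP; rewrite eq_sym oner_eq0. Qed.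

Lemma parity_sqr S : parity S * parity S = 1.
Proof. by rewrite -big_split /= big1 // => s _; rewrite mulrNN mulr1. Qed.

Definition fock := {malg K[state]}.
HB.instance Definition _ := GRing.Lmodule.on fock.

Definition basis (S : state) : fock := << S >>.
Definition vac : fock := basis fset0.

Lemma coef_basis S S' : (basis S)@_S' = (S == S')%:R.
Proof. by rewrite mcoeffU. Qed.

Lemma fock_basis (f : fock) : f = \sum_(S <- msupp f) f@_S *: basis S.
Proof.
rewrite [LHS]monalgE; apply: eq_bigr => S _.
by apply/malgP => S'; rewrite mcoeffZ !mcoeffU mulr_natr.
Qed.

(** The factor [a] is evaluated at the target state [S], and the source is [tog t S]. Hence
    [(t \in S) == b] in [ladder] tests the slot after the operator has acted. *)
Definition tog_op (t : slot) (a : state -> K) (f : fock) : fock :=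
  [malg S in [fset tog t S' | S' in msupp f]%fset => a S * f@_(tog t S)].

Definition diag_op (a : state -> K) (f : fock) : fock :=
  [malg S in msupp f => a S * f@_S].

Lemma tog_opE t a f S : (tog_op t a f)@_S = a S * f@_(tog t S).
Proof.
rewrite /tog_op mcoeffE; case: ifPn => // /imfsetP h.
rewrite (mcoeff_outdom (k := tog t S)) ?mulr0 //; apply/negP => Sf.
by apply: h; exists (tog t S); rewrite ?togK.
Qed.

Lemma diag_opE a f S : (diag_op a f)@_S = a S * f@_S.
Proof. by rewrite /diag_op mcoeffE; case: msuppP; rewrite ?mulr0. Qed.

Fact tog_op_linear t a : linear (tog_op t a).
Proof.
move=> c f g; apply/malgP => S.
by rewrite tog_opE !mcoeffD !mcoeffZ !tog_opE; ring.
Qed.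
HB.instance Definition _ t a :=
  GRing.isLinear.Build K fock fock _ (tog_op t a) (@tog_op_linear t a).

Fact diag_op_linear a : linear (diag_op a).
Proof.
move=> c f g; apply/malgP => S.
by rewrite diag_opE !mcoeffD !mcoeffZ !diag_opE; ring.
Qed.
HB.instance Definition _ a :=
  GRing.isLinear.Build K fock fock _ (diag_op a) (@diag_op_linear a).

(* [b = true]: creation in slot [t]; [b = false]: annihilation. *)
Definition ladder (b : bool) (t : slot) : fock -> fock :=
  tog_op t (fun S => ((t \in S) == b)%:R * chi t S).
HB.instance Definition _ b t := GRing.Linear.on (ladder b t).

Definition par : fock -> fock := diag_op parity.
HB.instance Definition _ := GRing.Linear.on par.

Lemma ladder_anti b b' s t v : s != t ->
  ladder b s (ladder b' t v) = - ladder b' t (ladder b s v).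
Proof.
move=> st; apply/malgP => S; rewrite mcoeffN !tog_opE !in_tog [t == s]eq_sym (negPf st).
rewrite !addbF !chi_tog togC.
have : (-1 : K) ^+ (code s < code t)%N = - (-1) ^+ (code t < code s)%N.
  case: (ltngtP (code s) (code t)) => [||/code_inj E]; rewrite ?expr0 ?expr1 ?opprK //.
  by rewrite E eqxx in st.
by move=> ->; ring.
Qed.

Lemma ladder_sqr b t v : ladder b t (ladder b t v) = 0.
Proof.
apply/malgP => S; rewrite mcoeff0 !tog_opE !in_tog eqxx addbT togK.
by case: (t \in S); case: b => /=; rewrite ?mul0r ?mulr0.
Qed.

Lemma ladder_conj b t v :
  ladder b t (ladder (~~ b) t v) = v - ladder (~~ b) t (ladder b t v).
Proof.
apply/malgP => S; rewrite mcoeffB !tog_opE !in_tog eqxx addbT togK !chi_tog ltnn expr0 mul1r.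
have := chi_sqr t S; set c := chi _ _ => c2.
have -> x y (w : K) : x * c * (y * c * w) = x * y * w by rewrite -[RHS]mul1r -c2; ring.
have -> x y (w : K) : x * c * (y * c * w) = x * y * w by rewrite -[RHS]mul1r -c2; ring.
by case: (t \in S); case: b => /=; ring.
Qed.

Lemma par_ladder b t v : par (ladder b t v) = - ladder b t (par v).
Proof.
apply/malgP => S; rewrite mcoeffN diag_opE !tog_opE diag_opE parity_tog; ring.
Qed.

Lemma par_sqr v : par (par v) = v.
Proof. by apply/malgP => S; rewrite !diag_opE mulrA parity_sqr mul1r. Qed.

(** A nonnegative mode annihilates the particle of opposite charge. As [Negz n] is -n-1, mode [i] of
    one species is conjugate to mode [-1 - i] of the other. *)
Definition pmode (j : int) : fock -> fock :=
  match j with Negz n => ladder true (inl (inl n)) | Posz n => ladder false (inl (inr n)) end.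
Definition mmode (j : int) : fock -> fock :=
  match j with Negz n => ladder true (inl (inr n)) | Posz n => ladder false (inl (inl n)) end.
(* [rho] selects the Ramond sector, whose zero mode is the parity operator. Creation
   operators carry a factor 2 where a factor sqrt 2 on both sides is customary. *)
Definition zmode (rho : bool) (j : int) : fock -> fock :=
  match j with
  | Negz n => fun v => 2 *: ladder true (inr n) v
  | Posz n => if rho then (if n is n'.+1 then ladder false (inr n') else par)
              else ladder false (inr n)
  end.

Fact pmode_linear j : linear (pmode j).
Proof. by case: j => n; exact: linearP. Qed.
Fact mmode_linear j : linear (mmode j).
Proof. by case: j => n; exact: linearP. Qed.
Fact zmode_linear rho j : linear (zmode rho j).
Proof.
case: j => n; last by move=> a u v; rewrite /= linearP scalerDr !scalerA mulrC.
by case: rho; case: n => *; exact: linearP.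
Qed.
HB.instance Definition _ j :=
  GRing.isLinear.Build K fock fock _ (pmode j) (@pmode_linear j).
HB.instance Definition _ j :=
  GRing.isLinear.Build K fock fock _ (mmode j) (@mmode_linear j).
HB.instance Definition _ rho j :=
  GRing.isLinear.Build K fock fock _ (zmode rho j) (@zmode_linear rho j).

Lemma pp i j v : pmode i (pmode j v) = - pmode j (pmode i v).
Proof.
case: i j => i [] j /=; try by rewrite ladder_anti.
all: have [->|ij] := eqVneq i j; first by rewrite ladder_sqr oppr0.
all: by rewrite ladder_anti // !(inj_eq inl_inj) (inj_eq inr_inj, inj_eq inl_inj).
Qed.

Lemma mm i j v : mmode i (mmode j v) = - mmode j (mmode i v).
Proof.
case: i j => i [] j /=; try by rewrite ladder_anti.
all: have [->|ij] := eqVneq i j; first by rewrite ladder_sqr oppr0.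
all: by rewrite ladder_anti // !(inj_eq inl_inj) (inj_eq inr_inj, inj_eq inl_inj).
Qed.

Lemma pm i j v : pmode i (mmode j v) = (i + j == -1)%:R *: v - mmode j (pmode i v).
Proof.
have [E|E] := eqVneq (i + j) (-1); rewrite ?scale1r ?scale0r ?sub0r.
  case: i j E => i [] j E; try (exfalso; lia); have -> : i = j by lia.
  - exact: (ladder_conj false).
  - exact: (ladder_conj true).
case: i j E => i [] j E /=; rewrite ladder_anti //; apply/eqP => -[ij]; lia.
Qed.

Variable rho : bool.
Local Notation zop := (zmode rho).

Lemma zp i j v : zop i (pmode j v) = - pmode j (zop i v).
Proof.
case: i j => i [] j /=.
1,2: case: {+}rho; [case: i => [|i]|]; by rewrite ?par_ladder ?[ladder _ (inr _) _]ladder_anti.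
all: by rewrite ladder_anti // linearZ scalerN.
Qed.

Lemma zm i j v : zop i (mmode j v) = - mmode j (zop i v).
Proof.
case: i j => i [] j /=.
1,2: case: {+}rho; [case: i => [|i]|]; by rewrite ?par_ladder ?[ladder _ (inr _) _]ladder_anti.
all: by rewrite ladder_anti // linearZ scalerN.
Qed.

(** Mode [i] contracts with mode [r - 1 - i], and the 2 is the factor carried by the creation
    operators. At [i = j = 0] in the Ramond sector it is matched by [par] squaring to 1, counted
    twice. *)
Lemma zz i j v :
  zop i (zop j v) = (2 * (i + j == rho%:Z - 1)%:R) *: v - zop j (zop i v).
Proof.
have anti b b' k l (w : fock) : k != l ->
    ladder b (inr k) (ladder b' (inr l) w) = - ladder b' (inr l) (ladder b (inr k) w).
  by move=> kl; rewrite ladder_anti // (inj_eq inr_inj).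
have conj b k (w : fock) : ladder b (inr k) (2 *: ladder (~~ b) (inr k) w) =
    2 *: w - 2 *: ladder (~~ b) (inr k) (ladder b (inr k) w).
  by rewrite linearZ /= ladder_conj scalerBr.
have [E|E] := eqVneq (i + j) (rho%:Z - 1); rewrite ?mulr1 ?mulr0 ?scale0r ?sub0r.
  case: i j E => i [] j; case: {+}rho => /= E; try (exfalso; lia).
  - have [-> ->] : i = 0%N /\ j = 0%N by lia.
    by rewrite par_sqr scaler_nat mulr2n addrK.
  - by case: i E => [|i] E; [lia|have -> : i = j by lia; exact: (conj false)].
  - by have -> : i = j by lia; exact: (conj false).
  - case: j E => [|j] E; [lia|have -> : i = j by lia].
    by rewrite (conj false) opprB addrC subrK.
  - have -> : i = j by lia.
    by rewrite (conj false) opprB addrC subrK.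
case: i j E => i [] j; case: {+}rho => /= E.
- case: i j E => [|i] [|j] E; rewrite ?par_ladder ?opprK //.
  have [->|ij] := eqVneq i j; first by rewrite ladder_sqr oppr0.
  by rewrite anti.
- have [->|ij] := eqVneq i j; first by rewrite ladder_sqr oppr0.
  by rewrite anti.
- case: i E => [|i] E; rewrite linearZ /= ?par_ladder ?scalerN //.
  by rewrite anti ?scalerN //; lia.
- by rewrite linearZ /= anti ?scalerN //; lia.
- case: j E => [|j] E; rewrite linearZ /= ?par_ladder ?scalerN ?opprK //.
  by rewrite anti ?scalerN //; lia.
- by rewrite linearZ /= anti ?scalerN //; lia.
all: rewrite !linearZ /=; have [->|ij] := eqVneq i j; last by rewrite anti.
all: by rewrite ladder_sqr oppr0.
Qed.

End Fock.

(** * Currents *)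

Section LocallyFiniteSums.
Variables (K : numFieldType) (V : lmodType K).
Implicit Types (x y : int -> V) (N : nat).

Definition lsum x : V := \sum_(i \in [set: int]) x i.

(** The window is half-open so that it is enumerated by ['I_(N + N)] and stable under [j] to
    [-1 - j], the conjugation of charged modes. *)
Definition vanish_outside N x := forall i : int, ~~ (- N%:Z <= i < N%:Z) -> x i = 0.

Definition lfin x := exists N, vanish_outside N x.

Lemma vanish_outside_le N N' x :
  (N <= N')%N -> vanish_outside N x -> vanish_outside N' x.
Proof. by move=> h vx i hi; apply: vx; lia. Qed.

Lemma lsumE N x : vanish_outside N x -> lsum x = \sum_(i < N + N) x (i%:Z - N%:Z).
Proof.
move=> vx; rewrite -(big_mkord xpredT (fun i : nat => x (i%:Z - N%:Z))) /lsum.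
rewrite (fsbigTE [fset (i%:Z - N%:Z) | i in iota 0 (N + N)]%fset).
  rewrite big_imfset /=; last by move=> i j _ _ h; lia.
  by rewrite undup_id ?iota_uniq // /index_iota subn0.
move=> i /imfsetP hi; apply: vx; apply/negP => h; apply: hi.
by exists (absz (i + N%:Z)); [rewrite /= mem_iota; lia|lia].
Qed.

Lemma lsum0 : lsum (fun=> 0) = 0.
Proof. by rewrite (@lsumE 0) ?big_ord0. Qed.

Lemma eq_lsum x y : x =1 y -> lsum x = lsum y.
Proof. by move=> /funext ->. Qed.

Lemma lfin_common x y : lfin x -> lfin y ->
  exists N, vanish_outside N x /\ vanish_outside N y.
Proof.
move=> [N hN] [N' hN']; exists (maxn N N').
by split; [apply: vanish_outside_le hN|apply: vanish_outside_le hN'];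
  rewrite ?leq_maxl ?leq_maxr.
Qed.

Lemma lfinD x y : lfin x -> lfin y -> lfin (fun i => x i + y i).
Proof.
move=> hx /(lfin_common hx)[N [h1 h2]]; exists N => i hi.
by rewrite h1 // h2 // addr0.
Qed.

Lemma lfinZ a x : lfin x -> lfin (fun i => a *: x i).
Proof. by move=> [N h]; exists N => i hi; rewrite h // scaler0. Qed.

Lemma lsumD x y : lfin x -> lfin y -> lsum (fun i => x i + y i) = lsum x + lsum y.
Proof.
move=> hx /(lfin_common hx)[N [h1 h2]].
rewrite (lsumE h1) (lsumE h2) (@lsumE N) ?big_split // => i hi.
by rewrite h1 // h2 // addr0.
Qed.

Lemma lsumZ a x : lfin x -> lsum (fun i => a *: x i) = a *: lsum x.
Proof.
move=> [N h]; rewrite (lsumE h) (@lsumE N) ?scaler_sumr // => i hi.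
by rewrite h // scaler0.
Qed.

Lemma lsum_single k x : (forall i, i != k -> x i = 0) -> lsum x = x k.
Proof.
move=> h; rewrite /lsum (fsbigTE [fset k]%fset) ?big_seq_fset1 // => i.
by rewrite inE => /h.
Qed.

Lemma lsum_shift k x : lsum (fun i => x (i + k)) = lsum x.
Proof.
rewrite /lsum [RHS](reindex_fsbigT (fun i => i + k)) //.
by exists (fun i => i - k) => i; lia.
Qed.

Lemma lsum_rev k x : lsum (fun i => x (k - i)) = lsum x.
Proof.
rewrite /lsum [RHS](reindex_fsbigT (fun i => k - i)) //.
by exists (fun i => k - i) => i; lia.
Qed.

Lemma lsum_antisym k x : lfin x -> (forall i, x (k - i) = - x i) -> lsum x = 0.
Proof.
move=> fx h; have := lsum_rev k x; rewrite (eq_lsum h).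
have -> : (fun i => - x i) = (fun i => -1 *: x i) by apply/funext => i; rewrite scaleN1r.
rewrite lsumZ // scaleN1r => /eqP; rewrite eq_sym -subr_eq0 opprK -mulr2n -scaler_nat scaler_eq0.
by rewrite pnatr_eq0 /= => /eqP.
Qed.

Lemma lfin_sub (x y : int -> V) : lfin x -> (forall i, x i = 0 -> y i = 0) -> lfin y.
Proof. by move=> [N h] xy; exists N => i /h /xy. Qed.

Lemma lfin_shift k x : lfin x -> lfin (fun i => x (i + k)).
Proof. by move=> [N h]; exists (N + absz k)%N => i hi; apply: h; lia. Qed.

Lemma lfin_rev k x : lfin x -> lfin (fun i => x (k - i)).
Proof. by move=> [N h]; exists (N + absz k + 1)%N => i hi; apply: h; lia. Qed.

End LocallyFiniteSums.

Lemma raddf_lsum (K : numFieldType) (V W : lmodType K) (D : {linear V -> W})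
    (x : int -> V) : lfin x -> D (lsum x) = lsum (fun i => D (x i)).
Proof.
move=> [N h]; rewrite (lsumE h) (@lsumE _ _ N) ?raddf_sum // => i hi.
by rewrite h // raddf0.
Qed.

Section Bounds.
Variables (K : numFieldType) (rho : bool).
Notation F := (fock K).
Notation p := (@pmode K).
Notation m := (@mmode K).
Notation z := (@zmode K rho).
Implicit Types (v : F) (i j k a b : int).

Lemma mp i j v : m i (p j v) = (i + j == -1)%:R *: v - p j (m i v).
Proof. by rewrite pm [j + i]addrC subKr. Qed.

Lemma pz i j v : p i (z j v) = - z j (p i v).
Proof. by rewrite zp opprK. Qed.

Lemma mz i j v : m i (z j v) = - z j (m i v).
Proof. by rewrite zm opprK. Qed.

Definition bounded (B : nat) v :=
  forall j, B%:Z <= j -> [/\ p j v = 0, m j v = 0 & z j v = 0].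

Lemma annihilate t v : (forall S, S \in msupp v -> t \notin S) -> ladder false t v = 0.
Proof.
move=> h; apply/malgP => S; rewrite mcoeff0 tog_opE.
case: (boolP (t \in S)) => tS /=; rewrite ?mul0r //.
rewrite (mcoeff_outdom (k := tog t S)) ?mulr0 //; apply/negP => /h.
by rewrite in_tog eqxx addbT tS.
Qed.

(** A vector involves finitely many states, hence finitely many occupied slots, and the annihilator
    of an unoccupied slot kills it. The final successor absorbs the index shift of the Ramond
    modes. *)
Lemma ex_bounded v : exists B, bounded B v.
Proof.
pose B := (\max_(S <- msupp v) \max_(t <- S) (code t)).+2.
have hB t : (B <= (code t).+1)%N -> ladder false t v = 0.
  move=> ht; apply: annihilate => S Sv; apply/negP => tS.
  have h1 : (code t <= \max_(s <- S) (code s))%N by apply: leq_bigmax_seq.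
  have h2 : (\max_(s <- S) (code s) <= \max_(S <- msupp v) \max_(t <- S) (code t))%N.
    exact: (leq_bigmax_seq (F := fun S : state => \max_(s <- S) (code s))).
  by move: ht; rewrite /B ltnS ltnNge (leq_trans h1 h2).
clearbody B; exists B.+1 => -[] j hj; last by lia.
split; [apply: hB => /=; lia|apply: hB => /=; lia|].
by rewrite /=; case: {+}rho; [case: j hj => [|j] hj; [lia|]|]; apply: hB => /=; lia.
Qed.

End Bounds.

Section Currents.
Variables (K : numFieldType) (rho : bool).
Notation F := (fock K).
Notation p := (@pmode K).
Notation m := (@mmode K).
Notation z := (@zmode K rho).
Notation r := (nat_of_bool rho)%:Z.
Implicit Types (v : F) (i j k a b : int).

Lemma bounded_lfin (f : int -> F) (k : int) :
  (exists B : nat, forall i, (B%:Z <= i) || (B%:Z <= k - i) -> f i = 0) -> lfin f.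
Proof. by move=> [B h]; exists (B + absz k + 1)%N => i hi; apply: h; lia. Qed.

(** For large [i], [f i] moves past [g] and kills [v]; for very negative [i], the index [k - i] is
    large and [g] kills [v]. A contraction would spoil the first move, whence the excluded values of
    [k] in [lfin_pm] and [lfin_zz]. *)
Lemma lfin_bil (f g : int -> F -> F) k v :
  (forall i, f i 0 = 0) -> (forall i, g i 0 = 0) ->
  (forall i w, f i (g (k - i) w) = - g (k - i) (f i w)) ->
  (exists B : nat, forall i, B%:Z <= i -> f i v = 0 /\ g i v = 0) ->
  lfin (fun i => f i (g (k - i) v)).
Proof.
move=> f0 g0 fg [B h]; apply: (bounded_lfin (k := k)); exists B => i /orP[/h[fi _]|/h[_ gi]].
  by rewrite fg fi g0 oppr0.
by rewrite gi f0.
Qed.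

Lemma lfin_pz k v : lfin (fun i => p i (z (k - i) v)).
Proof.
have [B h] := ex_bounded rho v; apply: lfin_bil => *; rewrite ?linear0 ?pz //.
by exists B => i /h[].
Qed.

Lemma lfin_zm k v : lfin (fun i => z (k - i) (m i v)).
Proof.
have [B h] := ex_bounded rho v.
have : lfin (fun i => m i (z (k - i) v)).
  by apply: lfin_bil => *; rewrite ?linear0 ?mz //; exists B => i /h[].
by move=> /lfin_sub; apply=> i; rewrite mz => /eqP; rewrite oppr_eq0 => /eqP.
Qed.

Lemma lfin_pp k v : lfin (fun i => p i (p (k - i) v)).
Proof.
have [B h] := ex_bounded false v; apply: lfin_bil => *; rewrite ?linear0 1?pp //.
by exists B => i /h[].
Qed.

Lemma lfin_mm k v : lfin (fun i => m i (m (k - i) v)).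
Proof.
have [B h] := ex_bounded false v; apply: lfin_bil => *; rewrite ?linear0 1?mm //.
by exists B => i /h[].
Qed.

Lemma lfin_pm k v : k != -1 -> lfin (fun i => p i (m (k - i) v)).
Proof.
move=> k0; have [B h] := ex_bounded false v; apply: lfin_bil => *; rewrite ?linear0 ?pm //.
  rewrite [X in (nat_of_bool X)%:R](_ : _ = false) ?scale0r ?sub0r //; lia.
by exists B => i /h[].
Qed.

Lemma lfin_zz k v : k != r - 1 -> lfin (fun i => z i (z (k - i) v)).
Proof.
move=> k0; have [B h] := ex_bounded rho v; apply: lfin_bil => [||i w|].
- by move=> i; rewrite linear0.
- by move=> i; rewrite linear0.
- by rewrite zz [X in (nat_of_bool X)%:R](_ : _ = false) ?mulr0 ?scale0r ?sub0r //; lia.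
by exists B => i /h[].
Qed.

Definition Ecur a v := lsum (fun i => p i (z (a - i) v)).
Definition Fcur b v := lsum (fun i => z (b - i) (m i v)).
(* Junk for [k = 0], where the sum is infinite and needs normal ordering. *)
Definition Jcur k v := if k == 0 then 0 else lsum (fun i => p i (m (k - 1 - i) v)).

Lemma JcurE k v : k != 0 -> Jcur k v = lsum (fun i => p i (m (k - 1 - i) v)).
Proof. by rewrite /Jcur => /negPf ->. Qed.

Lemma lfin_J k v : k != 0 -> lfin (fun i => p i (m (k - 1 - i) v)).
Proof. by move=> k0; apply: lfin_pm; lia. Qed.

Fact Ecur_linear a : linear (Ecur a).
Proof.
move=> c u v; rewrite /Ecur -lsumZ -?lsumD; try exact: lfin_pz; last exact/lfinZ/lfin_pz.
by apply: eq_lsum => i; rewrite !linearP.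
Qed.
HB.instance Definition _ a := GRing.isLinear.Build K F F _ (Ecur a) (@Ecur_linear a).

Fact Fcur_linear a : linear (Fcur a).
Proof.
move=> c u v; rewrite /Fcur -lsumZ -?lsumD; try exact: lfin_zm; last exact/lfinZ/lfin_zm.
by apply: eq_lsum => i; rewrite !linearP.
Qed.
HB.instance Definition _ a := GRing.isLinear.Build K F F _ (Fcur a) (@Fcur_linear a).

Fact Jcur_linear k : linear (Jcur k).
Proof.
move=> c u v; rewrite /Jcur; case: eqP => [|/eqP k0]; first by rewrite scaler0 addr0.
rewrite -lsumZ -?lsumD; try exact: lfin_J; last exact/lfinZ/lfin_J.
by apply: eq_lsum => i; rewrite !linearP.
Qed.
HB.instance Definition _ k := GRing.isLinear.Build K F F _ (Jcur k) (@Jcur_linear k).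

Lemma lsum_commute (D : {linear F -> F}) (x : int -> F -> F) (y : int -> F) v :
  lfin (x^~ v) -> lfin y ->
  (forall i, x i (D v) = D (x i v) + y i) ->
  lsum (x^~ (D v)) = D (lsum (x^~ v)) + lsum y.
Proof.
move=> fx fy h; rewrite raddf_lsum // -lsumD //; first exact: eq_lsum.
by apply: lfin_sub fx _ => i ->; rewrite raddf0.
Qed.

Lemma lfin_single k (y : int -> F) : (forall i, i != k -> y i = 0) -> lfin y.
Proof. by move=> h; exists (absz k).+1 => i hi; apply: h; lia. Qed.

(** A single mode contracts with just one term of a current, at index [k]; [c] is the Kronecker
    symbol of that contraction. *)
Lemma lsum_commute1 (D : {linear F -> F}) (x : int -> F -> F) k (w : int -> F) (c : int -> K) v :
  lfin (x^~ v) -> (forall i, i != k -> c i = 0) ->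
  (forall i, x i (D v) = D (x i v) + c i *: w i) ->
  lsum (x^~ (D v)) = D (lsum (x^~ v)) + c k *: w k.
Proof.
move=> fx ck h.
have hk i : i != k -> c i *: w i = 0 by move=> /ck ->; rewrite scale0r.
by rewrite -(lsum_single hk); apply: lsum_commute => //; apply: lfin_single hk.
Qed.

Lemma lsum_commute0 (D : {linear F -> F}) (x : int -> F -> F) v :
  lfin (x^~ v) -> (forall i, x i (D v) = D (x i v)) ->
  lsum (x^~ (D v)) = D (lsum (x^~ v)).
Proof. by move=> fx h; rewrite raddf_lsum //; exact: eq_lsum. Qed.

(** * Commutators of the currents with the modes *)

Lemma E_p a j v : Ecur a (p j v) = p j (Ecur a v).
Proof.
apply: (lsum_commute0 (D := p j) (x := fun i w => p i (z (a - i) w))) => [|i].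
  exact: lfin_pz.
by rewrite zp linearN /= pp opprK.
Qed.

Lemma E_m a j v : Ecur a (m j v) = m j (Ecur a v) - z (a + 1 + j) v.
Proof.
rewrite /Ecur (lsum_commute1 (k := -1 - j) (c := fun i => - (i + j == -1)%:R)
  (w := fun i => z (a - i) v) (D := m j) (x := fun i w => p i (z (a - i) w))) => [|||i].
- rewrite [X in (nat_of_bool X)%:R](_ : _ = true); last by lia.
  by rewrite scaleN1r; congr (_ - z _ _); lia.
- exact: lfin_pz.
- by move=> i hi; rewrite [X in (nat_of_bool X)%:R](_ : _ = false) ?oppr0 //; lia.
by rewrite zm linearN /= pm opprB addrC scaleNr addrC.
Qed.

Lemma E_z a j v : Ecur a (z j v) = z j (Ecur a v) + 2 *: p (a - r + 1 + j) v.
Proof.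
rewrite /Ecur (lsum_commute1 (k := a - r + 1 + j) (c := fun i => 2 * (a - i + j == r - 1)%:R)
  (w := fun i => p i v) (D := z j) (x := fun i w => p i (z (a - i) w))) => [|||i].
- rewrite [X in (nat_of_bool X)%:R](_ : _ = true); last by lia.
  by rewrite mulr1.
- exact: lfin_pz.
- by move=> i hi; rewrite [X in (nat_of_bool X)%:R](_ : _ = false) ?mulr0 //; lia.
by rewrite zz linearB linearZ /= pz opprK addrC.
Qed.

Lemma F_m b j v : Fcur b (m j v) = m j (Fcur b v).
Proof.
apply: (lsum_commute0 (D := m j) (x := fun i w => z (b - i) (m i w))) => [|i].
  exact: lfin_zm.
by rewrite mm linearN /= zm opprK.
Qed.

Lemma F_p b j v : Fcur b (p j v) = p j (Fcur b v) + z (b + 1 + j) v.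
Proof.
rewrite /Fcur (lsum_commute1 (k := -1 - j) (c := fun i => (i + j == -1)%:R)
  (w := fun i => z (b - i) v) (D := p j) (x := fun i w => z (b - i) (m i w))) => [|||i].
- rewrite [X in (nat_of_bool X)%:R](_ : _ = true); last by lia.
  by rewrite scale1r; congr (_ + z _ _); lia.
- exact: lfin_zm.
- by move=> i hi; rewrite [X in (nat_of_bool X)%:R](_ : _ = false) //; lia.
by rewrite mp linearB linearZ /= zp opprK addrC.
Qed.

Lemma F_z b j v : Fcur b (z j v) = z j (Fcur b v) - 2 *: m (b - r + 1 + j) v.
Proof.
rewrite /Fcur (lsum_commute1 (k := b - r + 1 + j) (c := fun i => - (2 * (b - i + j == r - 1)%:R))
  (w := fun i => m i v) (D := z j) (x := fun i w => z (b - i) (m i w))) => [|||i].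
- rewrite [X in (nat_of_bool X)%:R](_ : _ = true); last by lia.
  by rewrite mulr1 scaleNr.
- exact: lfin_zm.
- by move=> i hi; rewrite [X in (nat_of_bool X)%:R](_ : _ = false) ?mulr0 ?oppr0 //; lia.
by rewrite mz linearN /= zz opprB addrC scaleNr addrC.
Qed.

Lemma J_p k j v : k != 0 -> Jcur k (p j v) = p j (Jcur k v) + p (k + j) v.
Proof.
move=> k0; rewrite !JcurE // (lsum_commute1 (k := k + j) (c := fun i => (k - 1 - i + j == -1)%:R)
  (w := fun i => p i v) (D := p j) (x := fun i w => p i (m (k - 1 - i) w))) => [|||i].
- rewrite [X in (nat_of_bool X)%:R](_ : _ = true); last by lia.
  by rewrite scale1r.
- exact: lfin_J.
- by move=> i hi; rewrite [X in (nat_of_bool X)%:R](_ : _ = false) //; lia.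
by rewrite mp linearB linearZ /= pp opprK addrC.
Qed.

Lemma J_m k j v : k != 0 -> Jcur k (m j v) = m j (Jcur k v) - m (k + j) v.
Proof.
move=> k0; rewrite !JcurE // (lsum_commute1 (k := -1 - j) (c := fun i => - (i + j == -1)%:R)
  (w := fun i => m (k - 1 - i) v) (D := m j) (x := fun i w => p i (m (k - 1 - i) w))) => [|||i].
- rewrite [X in (nat_of_bool X)%:R](_ : _ = true); last by lia.
  by rewrite scaleN1r; congr (_ - m _ _); lia.
- exact: lfin_J.
- by move=> i hi; rewrite [X in (nat_of_bool X)%:R](_ : _ = false) ?oppr0 //; lia.
by rewrite mm linearN /= pm opprB addrC scaleNr addrC.
Qed.

Lemma J_z k j v : k != 0 -> Jcur k (z j v) = z j (Jcur k v).
Proof.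
move=> k0; rewrite !JcurE //.
apply: (lsum_commute0 (D := z j) (x := fun i w => p i (m (k - 1 - i) w))) => [|i].
  exact: lfin_J.
by rewrite mz linearN /= pz opprK.
Qed.

(** * Commutators among the currents *)

Lemma J_E k a v : k != 0 -> Jcur k (Ecur a v) = Ecur a (Jcur k v) + Ecur (a + k) v.
Proof.
move=> k0.
have -> : Ecur (a + k) v = lsum (fun i => p (i + k) (z (a - i) v)).
  rewrite /Ecur -(lsum_shift k); apply: eq_lsum => i; congr (p _ (z _ _)); lia.
have fy : lfin (fun i => p (i + k) (z (a - i) v)).
  apply: lfin_sub (lfin_shift k (lfin_pz (a + k) v)) _ => i.
  by rewrite (_ : a + k - (i + k) = a - i) //; lia.
have := lsum_commute (D := Jcur k) (x := fun i w => p i (z (a - i) w))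
  (y := fun i => -1 *: p (i + k) (z (a - i) v)) (v := v) (lfin_pz a v) (lfinZ _ fy).
rewrite lsumZ // /Ecur => -> => [|i]; first by rewrite scaleN1r subrK.
by rewrite /= J_p // J_z // scaleN1r [k + i]addrC addrK.
Qed.

Lemma J_F k b v : k != 0 -> Jcur k (Fcur b v) = Fcur b (Jcur k v) - Fcur (b + k) v.
Proof.
move=> k0.
have -> : Fcur (b + k) v = lsum (fun i => z (b - i) (m (i + k) v)).
  rewrite /Fcur -(lsum_shift k); apply: eq_lsum => i; congr (z _ (m _ _)); lia.
have fy : lfin (fun i => z (b - i) (m (i + k) v)).
  apply: lfin_sub (lfin_shift k (lfin_zm (b + k) v)) _ => i.
  by rewrite (_ : b + k - (i + k) = b - i) //; lia.
rewrite /Fcur [X in _ = X - _](lsum_commute (D := Jcur k) (x := fun i w => z (b - i) (m i w)) 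
  (lfin_zm b v) fy) => [|i]; first by rewrite addrK.
by rewrite /= J_z // J_m // linearB /= [k + i]addrC subrK.
Qed.

(** Moving [Ecur a] through both factors of [Fcur b] produces the terms of 2 J and a sum of products
    z z. The indices of the latter add up to [a + b + 1], which the hypothesis keeps away from the
    contraction value [r - 1], so this sum is antisymmetric under [i] to [b - a - 1 - i] and
    vanishes. *)
Lemma E_F a b v : a + b + 2 - r != 0 ->
  Ecur a (Fcur b v) - Fcur b (Ecur a v) = 2 *: Jcur (a + b + 2 - r) v.
Proof.
move=> k0; set k := a + b + 2 - r.
have fp : lfin (fun i => p (k - 1 - i) (m i v)).
  apply: lfin_sub (lfin_rev (k - 1) (lfin_J v k0)) _ => i.
  by rewrite (_ : k - 1 - (k - 1 - i) = i) //; lia.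
have fz : lfin (fun i => z (b - i) (z (a + 1 + i) v)).
  have h : a + b + 1 != r - 1 by apply: contra k0 => /eqP; lia.
  apply: lfin_sub (lfin_rev b (lfin_zz v h)) _ => i.
  by rewrite (_ : a + b + 1 - (b - i) = a + 1 + i) //; lia.
have z0 : lsum (fun i => z (b - i) (z (a + 1 + i) v)) = 0.
  apply: (lsum_antisym (k := b - a - 1)) => // i.
  rewrite zz [X in (nat_of_bool X)%:R](_ : _ = false) ?mulr0 ?scale0r ?sub0r; last by lia.
  by congr (- z _ (z _ _)); lia.
have -> : Jcur k v = lsum (fun i => p (k - 1 - i) (m i v)).
  rewrite JcurE // -(lsum_rev (k - 1)); apply: eq_lsum => i.
  by congr (p _ (m _ _)); lia.
rewrite [X in _ - X](lsum_commute (D := Ecur a) (x := fun i w => z (b - i) (m i w)) 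
  (y := fun i => z (b - i) (z (a + 1 + i) v) + (-2) *: p (k - 1 - i) (m i v))) => [|||i].
- rewrite lsumD ?z0 //; last exact: lfinZ.
  by rewrite lsumZ // add0r opprD addrA subrr sub0r scaleNr opprK.
- exact: lfin_zm.
- exact/lfinD/lfinZ.
rewrite /= E_z E_m linearB /= scaleNr.
rewrite (_ : a - r + 1 + (b - i) = k - 1 - i); last by rewrite /k; lia.
by rewrite addrACA subrr addr0 subrK.
Qed.

(** The commutator is a multiple of the sum of the [p i (p (k - i) v)], which reversing [i] turns
    into its opposite. *)
Lemma E_E a b v : Ecur a (Ecur b v) = Ecur b (Ecur a v).
Proof.
set k := a + b - r + 1.
have fy : lfin (fun i => (-2) *: p i (p (k - i) v)) by exact/lfinZ/lfin_pp.
rewrite [RHS](lsum_commute (D := Ecur a) (x := fun i w => p i (z (b - i) w)) (lfin_pz b v) fy) => [|i].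
  rewrite [X in _ + X](lsumZ _ (lfin_pp k v)).
  rewrite (lsum_antisym (x := fun i => p i (p (k - i) v)) (k := k)) ?scaler0 ?addr0 // => [|i]; first exact: lfin_pp.
  by rewrite pp; congr (- p _ (p _ _)); lia.
rewrite /= E_p E_z linearD linearZ /= scaleNr.
by rewrite (_ : a - r + 1 + (b - i) = k - i) ?addrK //; rewrite /k; lia.
Qed.

Lemma F_F a b v : Fcur a (Fcur b v) = Fcur b (Fcur a v).
Proof.
set k := a + b - r + 1.
have fy : lfin (fun i => 2 *: m (k - i) (m i v)).
  apply/lfinZ; apply: lfin_sub (lfin_mm k v) _ => i h.
  by rewrite mm h oppr0.
rewrite [RHS](lsum_commute (D := Fcur a) (x := fun i w => z (b - i) (m i w)) (lfin_zm b v) fy) => [|i].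
  rewrite [X in _ + X](lsum_antisym (k := k)) ?addr0 // => i.
  by rewrite mm scalerN; congr (- (_ *: m _ (m _ _))); lia.
rewrite /= F_z F_m (_ : a - r + 1 + (b - i) = k - i) ?subrK //; rewrite /k; lia.
Qed.

End Currents.

(** * Subspaces and polynomial interpolation *)

Section Subspaces.
Variables (K : numFieldType) (V : lmodType K) (W : set V).
Hypothesis Wsub : subspace W.
Implicit Types u v : V.

Lemma subspace0 : W 0. Proof. by case: Wsub. Qed.

Lemma subspaceZ a v : W v -> W (a *: v).
Proof. by move=> h; rewrite -[_ *: _]addr0; case: Wsub => W0; apply. Qed.

Lemma subspaceD u v : W u -> W v -> W (u + v).
Proof. by move=> hu hv; rewrite -[u]scale1r; case: Wsub => W0; apply. Qed.

Lemma subspaceN v : W v -> W (- v).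
Proof. by move=> h; rewrite -scaleN1r; apply: subspaceZ. Qed.

Lemma subspaceB u v : W u -> W v -> W (u - v).
Proof. by move=> hu hv; apply/subspaceD/subspaceN. Qed.

Lemma subspace_sum (I : Type) (s : seq I) (P : pred I) (f : I -> V) :
  (forall i, P i -> W (f i)) -> W (\sum_(i <- s | P i) f i).
Proof. by move=> h; apply: big_ind => //; [exact: subspace0|exact: subspaceD]. Qed.

Lemma subspace_sum_seq (I : eqType) (s : seq I) (f : I -> V) :
  (forall i, i \in s -> W (f i)) -> W (\sum_(i <- s) f i).
Proof. by move=> h; rewrite big_seq; apply: subspace_sum. Qed.

Lemma subspaceZE a v : a != 0 -> W (a *: v) -> W v.
Proof. by move=> a0 /(subspaceZ a^-1); rewrite scalerA mulVf // scale1r. Qed.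

(** Combining the moments gives the sum weighted by [q.[c i]] for any polynomial [q]; the Lagrange
    polynomial vanishing at all nodes except [c i0] isolates [y i0]. *)
Lemma subspace_moments (n : nat) (c : 'I_n -> K) (y : 'I_n -> V) : injective c ->
  (forall d, W (\sum_i c i ^+ d *: y i)) -> forall i, W (y i).
Proof.
move=> c_inj h i0.
have hq (q : {poly K}) : W (\sum_i q.[c i] *: y i).
  have -> : \sum_i q.[c i] *: y i = \sum_(d < size q) q`_d *: \sum_i c i ^+ d *: y i.
    under [RHS]eq_bigr do rewrite scaler_sumr.
    rewrite exchange_big /=; apply: eq_bigr => i _.
    by rewrite horner_coef scaler_suml; apply: eq_bigr => d _; rewrite scalerA.
  by apply: subspace_sum => d _; exact: subspaceZ.
have := hq (\prod_(j | j != i0) ('X - (c j)%:P)).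
rewrite (bigD1 i0) //= [X in _ + X]big1 ?addr0 => [|i i_i0]; last first.
  by rewrite horner_prod (bigD1 i) //= hornerXsubC subrr mul0r scale0r.
apply: subspaceZE; rewrite horner_prod; apply/prodf_neq0 => j j_i0.
by rewrite hornerXsubC subr_eq0 (inj_eq c_inj) eq_sym.
Qed.

End Subspaces.

(** * The Heisenberg quadratic *)

Section HeisenbergQuadratic.
Variables (K : numFieldType) (V : lmodType K) (b c : nat -> {linear V -> V}).
Hypothesis bb : forall i j v, b i (b j v) = - b j (b i v).
Hypothesis cc : forall i j v, c i (c j v) = - c j (c i v).
Hypothesis cb : forall i j v, c i (b j v) = (i == j)%:R *: v - b j (c i v).

Definition occ i v := b i (c i v).

Lemma sum_antisym n (g : nat -> V) : (forall k, (0 < k < n)%N -> g (n - k)%N = - g k) ->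
  \sum_(1 <= k < n) g k = 0.
Proof.
move=> h; set s := \sum_(_ <= _ < _) _.
have : s = - s.
  rewrite {1}/s big_nat_rev -sumrN; apply: eq_big_nat => k kn.
  by rewrite (_ : (1 + n - k.+1 = n - k)%N) ?h //; lia.
move/eqP; rewrite -subr_eq0 opprK -mulr2n -scaler_nat scaler_eq0 pnatr_eq0 /=.
by move/eqP.
Qed.

(** For fixed [i], the involution [k] to [n - i - k] pairs off the terms of the column. The two
    families of mixed terms in [heis_quad_rec] cancel in this way. *)
Lemma triangle_antisym n (f : nat -> nat -> V) :
  (forall k i, (0 < k)%N -> (i + k < n)%N -> f (n - i - k)%N i = - f k i) ->
  \sum_(1 <= k < n.+1) \sum_(0 <= i < n - k) f k i = 0.
Proof.
move=> h.
under eq_bigr => k _ do rewrite (big_nat_widen _ _ n) ?leq_subr //=.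
rewrite (exchange_big_dep xpredT) //= big1 // => i _.
have -> : \sum_(1 <= k < n.+1 | (i < n - k)%N) f k i = \sum_(1 <= k < n - i) f k i.
  rewrite [RHS](big_nat_widen _ _ n.+1) /=; last by lia.
  by apply: eq_bigl => k; lia.
by apply: sum_antisym => k kn; apply: h; lia.
Qed.

(** The sums over [j] and over [i] are J_k and J_(-k) truncated to [n] consecutive modes;
    [heis_quad_J] removes the truncation. *)
Definition heis_quad n v : V := \sum_(1 <= k < n) \sum_(0 <= i < n - k)
  \sum_(0 <= j < n - k) b i (c (i + k) (b (j + k) (c j v))).

(* Terms that are not of the form [occ i (occ j v)] cancel in pairs, because the
   b's anticommute and so do the c's. *)
Lemma heis_quad_rec n v :
  heis_quad n.+1 v = heis_quad n v + \sum_(0 <= i < n) (occ i v - occ i (occ n v)).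
Proof.
rewrite /heis_quad.
under eq_big_nat => k kn.
  rewrite subSn; last by lia.
  rewrite big_nat_recr //= [X in _ + X]big_nat_recr //=.
  under eq_bigr do rewrite big_nat_recr //=.
  rewrite big_split /=.
over.
rewrite !big_split /=.
have -> : \sum_(1 <= k < n.+1) \sum_(0 <= i < n - k)
    b i (c (i + k) (b (n - k + k) (c (n - k) v))) = 0.
  apply: triangle_antisym => k i k0 ikn.
  rewrite !subnK; try lia; rewrite (_ : (i + (n - i - k) = n - k)%N); last by lia.
  rewrite (_ : (n - (n - i - k) = i + k)%N); last by lia.
  rewrite !cb; have -> : ((i + k)%N == n) = false by lia.
  have -> : ((n - k)%N == n) = false by lia.
  by rewrite !scale0r !sub0r cc !linearN /= opprK.
have -> : \sum_(1 <= k < n.+1) \sum_(0 <= j < n - k)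
    b (n - k) (c (n - k + k) (b (j + k) (c j v))) = 0.
  apply: triangle_antisym => k i k0 ikn.
  rewrite !subnK; try lia; rewrite (_ : (i + (n - i - k) = n - k)%N); last by lia.
  rewrite (_ : (n - (n - i - k) = i + k)%N); last by lia.
  rewrite !cb; have -> : (n == (i + k)%N) = false by lia.
  have -> : (n == (n - k)%N) = false by lia.
  by rewrite !scale0r !sub0r !linearN /= bb opprK.
rewrite addr0 add0r; congr (_ + _).
  case: n => [|n]; first by rewrite !big_geq.
  by rewrite big_nat_recr //= subnn [X in _ + X]big_geq ?addr0.
(* What remains are the corners [i = j = n - k], where [c n] meets [b n]: the contraction leaves
   [occ i v] and the other term is [- occ i (occ n v)]. *)
rewrite -big_split big_nat_rev /= big_add1 /=; apply: eq_big_nat => i hin.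
rewrite (_ : (1 + n.+1 - i.+2 = n - i)%N); last by lia.
rewrite (_ : (n - (n - i) = i)%N); last by lia.
rewrite subnKC; last by lia.
rewrite cb eqxx scale1r linearB /=; congr (_ - _).
rewrite /occ cb (_ : i == n = false); last by lia.
by rewrite scale0r sub0r cc !linearN /=.
Qed.

Lemma occ_sqr i v : occ i (occ i v) = occ i v.
Proof.
rewrite /occ cb eqxx scale1r linearB /=.
have /eqP := bb i i (c i (c i v)); rewrite -subr_eq0 opprK -mulr2n -scaler_nat.
by rewrite scaler_eq0 pnatr_eq0 /= => /eqP ->; rewrite subr0.
Qed.

Lemma occ_comm i j v : occ i (occ j v) = occ j (occ i v).
Proof.
have [->//|ij] := eqVneq i j.
rewrite /occ !cb [j == i]eq_sym (negPf ij) !scale0r !sub0r !linearN /=.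
by rewrite (bb i j) opprK (cc i j) [b i (- _)]raddfN [b j (- _)]raddfN.
Qed.

(** Finite form of the equality of bosonic and fermionic energy: with T the total occupation number,
    twice the quadratic is twice the weighted occupation minus T^2 - T. The induction rests on the
    [occ i] being commuting idempotents, which assemble the corner terms into T^2. *)
Lemma heis_quadE n v : 2 *: heis_quad n v =
  2 *: (\sum_(0 <= i < n) (n - i.+1)%:R *: occ i v)
  - \sum_(0 <= i < n) occ i (\sum_(0 <= j < n) occ j v) + \sum_(0 <= i < n) occ i v.
Proof.
have occ_sum i s : occ i (\sum_(j <- s) occ j v) = \sum_(j <- s) occ i (occ j v).
  by rewrite /occ !linear_sum.
under [X in _ - X + _]eq_bigr do rewrite occ_sum.
elim: n => [|n IH]; first by rewrite /heis_quad !big_geq // !scaler0 subr0 addr0.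
rewrite heis_quad_rec scalerDr {}IH big_split /= sumrN.
rewrite !big_nat_recr //= subnn scale0r addr0.
rewrite [\sum_(0 <= i < n) (n.+1 - i.+1)%:R *: _](_ : _ =
   \sum_(0 <= i < n) (n - i.+1)%:R *: occ i v + \sum_(0 <= i < n) occ i v); last first.
  rewrite -big_split; apply: eq_big_nat => i hi /=.
  by rewrite -[X in _ + X]scale1r -scalerDl natr1; congr (_%:R *: _); lia.
rewrite [\sum_(0 <= i < n) \sum_(0 <= j < n.+1) _](_ : _ =
   \sum_(0 <= i < n) \sum_(0 <= j < n) occ i (occ j v) + \sum_(0 <= i < n) occ i (occ n v)); last first.
  by rewrite -big_split; apply: eq_bigr => i _; rewrite big_nat_recr.
rewrite occ_sqr [\sum_(0 <= j < n) occ n _](_ : _ = \sum_(0 <= i < n) occ i (occ n v)); last first.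
  by apply: eq_bigr => i _; rewrite occ_comm.
rewrite !scalerDr scalerN !scaler_nat !mulr2n !opprD.
set x := \sum_(_ <= _ < _) _ *: _; set y := \sum_(_ <= _ < _) \sum_(_ <= _ < _) _.
set t := \sum_(0 <= i < n) occ i v; set q := \sum_(_ <= _ < _) _; set o := occ n v.
by rewrite [RHS](AC ((2*2)*(2*2)*2) ((1*2*5*3*(4*9*(6*7)))*(8*10))) /= addNr addr0.
Qed.

End HeisenbergQuadratic.

(** * Generation of the Fock space from the vacuum *)

Section FockInduction.
Variables (K : numFieldType) (rho : bool).
Notation F := (fock K).

Lemma ladder_basis t (S : state) : t \notin S ->
  ladder true t (basis K S) = chi K t S *: basis K (t |` S)%fset.
Proof.
move=> tS; apply/malgP => S'; rewrite tog_opE mcoeffZ !coef_basis.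
have -> : (t |` S)%fset = tog t S by rewrite /tog (negPf tS).
have -> : (S == tog t S') = (tog t S == S') by rewrite -(inj_eq (inv_inj (togK t))) togK.
case: (eqVneq (tog t S) S') => [<-|_] /=; last by rewrite !mulr0.
by rewrite in_tog eqxx addbT tS chi_tog ltnn expr0 !mul1r.
Qed.

Lemma par_basis (S : state) : par (basis K S) = parity K S *: basis K S.
Proof.
apply/malgP => S'; rewrite diag_opE mcoeffZ !coef_basis.
by case: eqVneq => [<-|_] /=; rewrite ?mulr0.
Qed.

Lemma fock_ind (P : set F) : subspace P -> P (vac K) ->
  (forall t v, P v -> P (ladder true t v)) -> forall v, P v.
Proof.
move=> subP P0 PS v; rewrite (fock_basis v).
apply: subspace_sum => // S _; apply: subspaceZ => //.
elim/finSet_rect: S => S IH.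
have [->//|[t tS]] := fset_0Vmem S.
have tS' : t \notin (S `\ t)%fset by rewrite !inE eqxx.
have := PS t _ (IH _ (fproperD1 tS)).
by rewrite ladder_basis // fsetD1K //; apply: subspaceZE; rewrite ?chi_neq0.
Qed.

(** Creation modes generate the Fock space, so an identity between operators need only be checked on
    the vacuum and shown to survive each mode, usually by comparing commutators with it. *)
Lemma mode_ind (P : set F) : subspace P -> P (vac K) ->
  (forall j v, P v -> [/\ P (pmode j v), P (mmode j v) & P (zmode rho j v)]) ->
  forall v, P v.
Proof.
move=> subP P0 PS; apply: fock_ind => // -[[k|k]|k] v Pv.
- by case: (PS (Negz k) v Pv).
- by case: (PS (Negz k) v Pv).
- case: (PS (Negz k) v Pv) => _ _; apply: subspaceZE => //.
  by rewrite pnatr_eq0.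
Qed.

End FockInduction.

Section AdditiveDiagonal.
Variables (K : numFieldType) (a0 : K) (w : slot -> K).
Notation F := (fock K).

Definition weight_op : F -> F := diag_op (fun S => a0 + \sum_(s <- S) w s).
HB.instance Definition _ := GRing.Linear.on weight_op.

Lemma weight_op_basis (S : state) :
  weight_op (basis K S) = (a0 + \sum_(s <- S) w s) *: basis K S.
Proof.
apply/malgP => S'; rewrite diag_opE mcoeffZ !coef_basis.
by case: eqVneq => [<-|_] /=; rewrite ?mulr0.
Qed.

Lemma weight_op_ladder b t v : weight_op (ladder b t v) =
  ladder b t (weight_op v) + (if b then w t else - w t) *: ladder b t v.
Proof.
apply/malgP => S; rewrite mcoeffD mcoeffZ !diag_opE !tog_opE diag_opE sum_tog.
by case: b; case: (t \in S) => /=; ring.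
Qed.

Lemma weight_op_par v : weight_op (par v) = par (weight_op v).
Proof. by apply/malgP => S; rewrite !diag_opE mulrCA. Qed.

End AdditiveDiagonal.

(** * Charge and occupation numbers in a window of modes *)

Section Charge.
Variables (K : numFieldType) (rho : bool).
Notation F := (fock K).
Notation p := (@pmode K).
Notation m := (@mmode K).
Notation z := (@zmode K rho).

Definition chg (t : slot) : K :=
  match t with inl (inl _) => 1 | inl (inr _) => -1 | inr _ => 0 end.

Definition charge : F -> F := weight_op 0 chg.
HB.instance Definition _ := GRing.Linear.on charge.

Lemma charge_vac : charge (vac K) = 0.
Proof. by rewrite /charge weight_op_basis big_seq_fset0 addr0 scale0r. Qed.

Lemma charge_p j v : charge (p j v) = p j (charge v) + p j v.
Proof. by case: j => j /=; rewrite /charge weight_op_ladder /= ?opprK scale1r. Qed.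

Lemma charge_m j v : charge (m j v) = m j (charge v) - m j v.
Proof. by case: j => j /=; rewrite /charge weight_op_ladder /= scaleN1r. Qed.

Lemma charge_z j v : charge (z j v) = z j (charge v).
Proof.
case: j => j /=; last first.
  by rewrite linearZ /= /charge weight_op_ladder /= scale0r addr0.
case: {+}rho; last by rewrite /charge weight_op_ladder /= oppr0 scale0r addr0.
case: j => [|j]; first by rewrite /charge weight_op_par.
by rewrite /charge weight_op_ladder /= oppr0 scale0r addr0.
Qed.

(** Position [i] stands for the mode [j = i - N] of psi^+ and the conjugate mode [-1 - j] of psi^-,
    so that [cwin_bwin] becomes a plain Kronecker relation on naturals. *)
Definition bwin (N i : nat) : {linear F -> F} := @pmode K (i%:Z - N%:Z).
Definition cwin (N i : nat) : {linear F -> F} := @mmode K (N%:Z - 1 - i%:Z).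

Definition occ_sum (a : nat -> K) (N : nat) (v : F) : F :=
  \sum_(0 <= i < N + N) a i *: occ (bwin N) (cwin N) i v.

Fact occ_sum_linear a N : linear (occ_sum a N).
Proof.
move=> c u v; rewrite /occ_sum scaler_sumr -big_split; apply: eq_bigr => i _ /=.
by rewrite /occ (linearP (cwin N i)) (linearP (bwin N i)) scalerDr !scalerA mulrC.
Qed.
HB.instance Definition _ a N :=
  GRing.isLinear.Build K F F _ (occ_sum a N) (@occ_sum_linear a N).

Definition window (a : nat -> K) (N : nat) (j : int) : K :=
  if - N%:Z <= j < N%:Z then a (absz (j + N%:Z)) else 0.

Lemma sum_window (a : nat -> K) N j (u : F) :
  \sum_(0 <= i < N + N) (a i * (i%:Z - N%:Z == j)%:R) *: u = window a N j *: u.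
Proof.
rewrite -scaler_suml /window; congr (_ *: _); case: ifP => hj.
  rewrite (bigD1_seq (absz (j + N%:Z))) ?iota_uniq ?mem_index_iota //=; last by lia.
  rewrite big1 ?addr0 => [|i hi]; last by rewrite (_ : _ == j = false) ?mulr0 //; lia.
  by rewrite (_ : _ == j = true) ?mulr1 //; lia.
rewrite big1_seq // => i; rewrite mem_index_iota => /andP[_ hi].
by rewrite (_ : _ == j = false) ?mulr0 //; lia.
Qed.

Lemma occ_p N i j v : occ (bwin N) (cwin N) i (p j v) =
  p j (occ (bwin N) (cwin N) i v) + (i%:Z - N%:Z == j)%:R *: p j v.
Proof.
rewrite /occ /= mp linearB linearZ /= pp opprK addrC.
have [h|h] := eqVneq (i%:Z - N%:Z) j.
  by rewrite [X in (nat_of_bool X)%:R](_ : _ = true) ?h //; lia.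
by rewrite [X in (nat_of_bool X)%:R](_ : _ = false) ?scale0r //; lia.
Qed.

Lemma occ_m N i j v : occ (bwin N) (cwin N) i (m j v) =
  m j (occ (bwin N) (cwin N) i v) - (i%:Z - N%:Z == -1 - j)%:R *: m j v.
Proof.
rewrite /occ /= mm [p _ (- _)]raddfN /= pm opprB.
have [h|h] := eqVneq (i%:Z - N%:Z) (-1 - j).
  rewrite [X in (nat_of_bool X)%:R](_ : _ = true); last by lia.
  by rewrite !scale1r (_ : N%:Z - 1 - i%:Z = j) //; lia.
by rewrite [X in (nat_of_bool X)%:R](_ : _ = false) ?scale0r //; lia.
Qed.

Lemma occ_z N i j v : occ (bwin N) (cwin N) i (z j v) = z j (occ (bwin N) (cwin N) i v).
Proof. by rewrite /occ /= mz [p _ (- _)]raddfN /= pz opprK. Qed.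

Lemma occ_sum_p a N j v :
  occ_sum a N (p j v) = p j (occ_sum a N v) + window a N j *: p j v.
Proof.
rewrite -sum_window /occ_sum linear_sum -big_split; apply: eq_bigr => i _.
by rewrite occ_p scalerDr scalerA [in RHS]linearZ.
Qed.

Lemma occ_sum_m a N j v :
  occ_sum a N (m j v) = m j (occ_sum a N v) - window a N (-1 - j) *: m j v.
Proof.
rewrite -sum_window /occ_sum linear_sum -sumrB; apply: eq_bigr => i _.
by rewrite occ_m scalerBr scalerA [in RHS]linearZ.
Qed.

Lemma occ_sum_z a N j v : occ_sum a N (z j v) = z j (occ_sum a N v).
Proof.
by rewrite /occ_sum linear_sum; apply: eq_bigr => i _; rewrite occ_z linearZ.
Qed.

(** From position [N] on, [bwin] annihilates and [cwin] creates, so these positions count as filled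
    in the vacuum: a Dirac sea cut off at [N] levels. Below [N] the roles are exchanged. *)
Lemma occ_sum_vac a N : occ_sum a N (vac K) = (\sum_(N <= i < N + N) a i) *: vac K.
Proof.
rewrite /occ_sum (big_cat_nat (n := N)) ?leq_addr //= big1_seq ?add0r => [|i].
  rewrite scaler_suml; apply: eq_big_nat => i hi; congr (_ *: _).
  rewrite /occ /= pm [X in (nat_of_bool X)%:R](_ : _ = true) ?scale1r; last by lia.
  have -> : i%:Z - N%:Z = Posz (i - N) by lia.
  rewrite /= annihilate ?linear0 ?addr0 ?subr0 // => S.
  by rewrite /vac /basis msuppU oner_eq0 inE => /eqP ->; rewrite inE.
rewrite mem_index_iota => /andP[_ hi].
rewrite /occ /=; have -> : N%:Z - 1 - i%:Z = Posz (N - 1 - i) by lia.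
rewrite /= annihilate ?linear0 ?scaler0 // => S.
by rewrite /vac /basis msuppU oner_eq0 inE => /eqP ->; rewrite inE.
Qed.

(** The summand [N%:R *: v] counts the filled levels of the vacuum. A mode changes both sides alike
    as soon as its index lies in the window, so the threshold grows with the modes needed to build
    [v]. *)
Lemma occ_charge v : exists N0 : nat, forall N, (N0 <= N)%N ->
  occ_sum (fun=> 1) N v = N%:R *: v + charge v.
Proof.
pose P v := exists N0 : nat, forall N, (N0 <= N)%N ->
  occ_sum (fun=> 1) N v = N%:R *: v + charge v.
apply: (mode_ind (rho := rho) (P := P)) => [||j u [N0 hN]].
- split=> [|c u w [N0 h0] [N1 h1]].
    by exists 0%N => N _; rewrite !linear0 addr0.
  exists (maxn N0 N1) => N hN.
  rewrite [LHS]linearP [charge _]linearP /= (h0 N) ?(h1 N); [|lia|lia].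
  by rewrite !scalerDr !scalerA [N%:R * c]mulrC; exact: addrACA.
- exists 0%N => N _; rewrite occ_sum_vac charge_vac addr0.
  by rewrite sumr_const_nat addnK.
split; exists (maxn N0 (absz j).+2) => N hj.
- rewrite occ_sum_p charge_p hN; last by lia.
  rewrite /window ifT ?scale1r; last by lia.
  by rewrite linearD linearZ /= addrA.
- rewrite occ_sum_m charge_m hN; last by lia.
  rewrite /window ifT ?scale1r; last by lia.
  by rewrite linearD linearZ /= addrA.
- rewrite occ_sum_z charge_z hN; last by lia.
  by rewrite linearD linearZ.
Qed.

Lemma bwin_bwin N i j v : bwin N i (bwin N j v) = - bwin N j (bwin N i v).
Proof. exact: pp. Qed.

Lemma cwin_cwin N i j v : cwin N i (cwin N j v) = - cwin N j (cwin N i v).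
Proof. exact: mm. Qed.

Lemma cwin_bwin N i j v :
  cwin N i (bwin N j v) = (i == j)%:R *: v - bwin N j (cwin N i v).
Proof.
rewrite /cwin /bwin /= mp.
by have -> : (N%:Z - 1 - i%:Z + (j%:Z - N%:Z) == -1) = (i == j) by lia.
Qed.

(** Commuting with [Jcur k] turns mode [j] into mode [k + j], which is still at least [B] because
    [k] is nonnegative. *)
Lemma J_bounded B k (w : F) : bounded rho B w -> bounded rho B (Jcur k%:Z w).
Proof.
move=> bw j hj; rewrite /Jcur; case: eqP => [_|/eqP k0]; first by rewrite !linear0.
have [pj mj zj] := bw j hj; have [pkj mkj _] := bw (k%:Z + j) ltac:(lia).
have := J_p j w k0; have := J_m j w k0; have := J_z rho j w k0.
rewrite !JcurE // pj mj zj pkj mkj.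
have -> : lsum (fun i => p i (m (k%:Z - 1 - i) 0)) = 0 :> F.
  by under eq_lsum do rewrite !linear0; exact: lsum0.
by rewrite subr0 addr0 => <- <- <-.
Qed.

Lemma J_large B k (w : F) : bounded rho B w -> (B + B <= k)%N -> (0 < k)%N -> Jcur k%:Z w = 0.
Proof.
move=> bw kB k0; rewrite JcurE; last by lia.
rewrite -[RHS]lsum0; apply: eq_lsum => i.
have [Bi|iB] := leP B%:Z i.
  have [pi _ _] := bw i Bi.
  rewrite pm [X in (nat_of_bool X)%:R](_ : _ = false); last by lia.
  by rewrite pi linear0 scale0r subr0.
by have [_ -> _] := bw (k%:Z - 1 - i) ltac:(lia); rewrite linear0.
Qed.

(** Terms of J_k outside the window vanish on [w], and so do the first [k] terms inside it, where
    the index of [m] is at least [N]. Dropping these leaves the truncated sum. *)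
Lemma J_window B k N (w : F) : bounded rho B w -> (B <= N)%N -> (0 < k < N + N)%N ->
  \sum_(0 <= j < N + N - k) bwin N (j + k) (cwin N j w) = Jcur k%:Z w.
Proof.
move=> bw BN kN.
have vx : vanish_outside N (fun i => p i (m (k%:Z - 1 - i) w)).
  move=> i hi; have [Bi|iB] := leP B%:Z i.
    have [pi _ _] := bw i Bi.
    rewrite pm [X in (nat_of_bool X)%:R](_ : _ = false); last by lia.
    by rewrite pi linear0 scale0r subr0.
  by have [_ -> _] := bw (k%:Z - 1 - i) ltac:(lia); rewrite linear0.
rewrite JcurE; last by lia.
rewrite (lsumE vx) -(big_mkord xpredT (fun i : nat => p (i%:Z - N%:Z) (m (k%:Z - 1 - (i%:Z - N%:Z)) w))).
rewrite [RHS](big_cat_nat (n := k)) //=; last by lia.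
rewrite [X in _ = X + _]big1_seq ?add0r => [|i]; last first.
  rewrite mem_index_iota => /andP[_ hi].
  by have [_ -> _] := bw (k%:Z - 1 - (i%:Z - N%:Z)) ltac:(lia); rewrite linear0.
rewrite -[k in RHS]add0n big_addn; apply: eq_bigr => i _ /=.
by congr (p _ (m _ _)); lia.
Qed.

Lemma J_window_neg B k N (w : F) : bounded rho B w -> (B + k <= N)%N -> (0 < k < N + N)%N ->
  \sum_(0 <= i < N + N - k) bwin N i (cwin N (i + k) w) = Jcur (- k%:Z) w.
Proof.
move=> bw BN kN.
have van i : (N%:Z - k%:Z <= i) || (i < - N%:Z) -> p i (m (- k%:Z - 1 - i) w) = 0.
  move=> hi; have [Bi|iB] := leP B%:Z i.
    have [pi _ _] := bw i Bi.
    rewrite pm [X in (nat_of_bool X)%:R](_ : _ = false); last by lia.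
    by rewrite pi linear0 scale0r subr0.
  by have [_ -> _] := bw (- k%:Z - 1 - i) ltac:(lia); rewrite linear0.
rewrite JcurE; last by lia.
rewrite (@lsumE _ _ N) => [|i hi]; last by apply: van; lia.
rewrite -(big_mkord xpredT (fun i : nat => p (i%:Z - N%:Z) (m (- k%:Z - 1 - (i%:Z - N%:Z)) w))).
rewrite [RHS](big_cat_nat (n := N + N - k)) //=; last by lia.
rewrite [X in _ = _ + X]big1_seq ?addr0 => [|i]; last first.
  by rewrite mem_index_iota => /andP[_ hi]; apply: van; lia.
by apply: eq_bigr => i _ /=; congr (p _ (m _ _)); lia.
Qed.

Lemma heis_quad_J (w : F) : exists N0 : nat, forall N, (N0 <= N)%N ->
  heis_quad (bwin N) (cwin N) (N + N) w =
  \sum_(1 <= k < N + N) Jcur (- k%:Z) (Jcur k%:Z w).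
Proof.
(* For [k >= B + B], J_k kills [w]; for smaller [k], [J_window_neg] asks for [B + k <= N], which
   three times [B] guarantees. *)
have [B bw] := ex_bounded rho w; exists (B + B + B)%N => N hN.
apply: eq_big_nat => k hk.
transitivity (\sum_(0 <= i < N + N - k) bwin N i (cwin N (i + k) (Jcur k%:Z w))).
  apply: eq_bigr => i _; rewrite -(J_window bw (N := N)); try lia.
  by rewrite (linear_sum (cwin N (i + k))) (linear_sum (bwin N i)).
have [kB|Bk] := ltnP k (B + B).
  by rewrite (J_window_neg (J_bounded k bw)) //; lia.
rewrite (J_large bw Bk) ?linear0; last by lia.
by rewrite big1 // => i _; rewrite !linear0.
Qed.

End Charge.

(** * Irreducibility of the sectors *)

Section Irreducibility.
Variables (K : numFieldType) (rho : bool) (A : int).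
Notation F := (fock K).
Notation p := (@pmode K).
Notation m := (@mmode K).
Notation z := (@zmode K rho).
Notation r := (nat_of_bool rho)%:Z.
Notation B := (r - 2 - A).
Notation Ec := (@Ecur K rho).
Notation Fc := (@Fcur K rho).

Variable W : set F.
Hypothesis Wsub : subspace W.
Hypothesis W_e1 : forall v, W v -> W (Ec A v).
Hypothesis W_e0 : forall v, W v -> W (Fc (B + 1) v).
Hypothesis W_f1 : forall v, W v -> W (Fc B v).
Hypothesis W_f0 : forall v, W v -> W (Ec (A - 1) v).
Hypothesis W_charge : forall v, W v -> W (charge v).

Lemma two_neq0 : (2 : K) != 0. Proof. by rewrite pnatr_eq0. Qed.

Lemma W_half v : W (2 *: v) -> W v.
Proof. exact: subspaceZE two_neq0. Qed.

(** Twice J_1 is [e_1, e_0], a root vector for delta. Commutators with it and with its opposite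
    J_(-1) then move the index of [Ec] and [Fc] by one either way. *)
Lemma W_J1 v : W v -> W (Jcur 1 v).
Proof.
move=> h; apply: W_half; rewrite (_ : (1 : int) = A + (B + 1) + 2 - r); last by lia.
rewrite -E_F; last by lia.
by apply: subspaceB => //; [apply/W_e1/W_e0|apply/W_e0/W_e1].
Qed.

Lemma W_Jm1 v : W v -> W (Jcur (-1) v).
Proof.
move=> h; apply: W_half; rewrite (_ : (-1 : int) = A - 1 + B + 2 - r); last by lia.
rewrite -E_F; last by lia.
by apply: subspaceB => //; [apply/W_f0/W_f1|apply/W_f1/W_f0].
Qed.

Lemma int_propagate (P : int -> Prop) a : P a ->
  (forall n, P n -> P (n + 1)) -> (forall n, P n -> P (n - 1)) -> forall n, P n.
Proof.
move=> Pa up down n.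
have Pu (k : nat) : P (a + k%:Z).
  by elim: k => [|k /up]; rewrite ?addr0 // (_ : a + k.+1%:Z = a + k%:Z + 1) //; lia.
have Pd (k : nat) : P (a - k%:Z).
  by elim: k => [|k /down]; rewrite ?subr0 // (_ : a - k.+1%:Z = a - k%:Z - 1) //; lia.
have [h|h] := leP a n.
  by rewrite (_ : n = a + (absz (n - a))%:Z) //; lia.
by rewrite (_ : n = a - (absz (n - a))%:Z) //; lia.
Qed.

Lemma W_E n v : W v -> W (Ec n v).
Proof.
move: n v; apply: (int_propagate (a := A)) => [|n IH v h|n IH v h]; first exact: W_e1.
- have <- : Jcur 1 (Ec n v) - Ec n (Jcur 1 v) = Ec (n + 1) v by rewrite J_E // addrC addKr.
  by apply: subspaceB => //; [apply/W_J1/IH|apply/IH/W_J1].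
- have <- : Jcur (-1) (Ec n v) - Ec n (Jcur (-1) v) = Ec (n - 1) v by rewrite J_E // addrC addKr.
  by apply: subspaceB => //; [apply/W_Jm1/IH|apply/IH/W_Jm1].
Qed.

Lemma W_F n v : W v -> W (Fc n v).
Proof.
move: n v; apply: (int_propagate (a := B)) => [|n IH v h|n IH v h]; first exact: W_f1.
- have <- : Fc n (Jcur 1 v) - Jcur 1 (Fc n v) = Fc (n + 1) v by rewrite J_F // opprB addrC subrK.
  by apply: subspaceB => //; [apply/IH/W_J1|apply/W_J1/IH].
- have <- : Fc n (Jcur (-1) v) - Jcur (-1) (Fc n v) = Fc (n - 1) v by rewrite J_F // opprB addrC subrK.
  by apply: subspaceB => //; [apply/IH/W_Jm1|apply/W_Jm1/IH].
Qed.

Lemma W_J k v : k != 0 -> W v -> W (Jcur k v).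
Proof.
move=> k0 h; apply: W_half.
have E : k = A + (k - A - 2 + r) + 2 - r by lia.
rewrite E -E_F; last by rewrite -E.
by apply: subspaceB => //; [apply/W_E/W_F|apply/W_F/W_E].
Qed.

(* On a fixed vector and for large [N], the Heisenberg quadratic [\sum_k J (-k) J k] is
   [height N] plus a polynomial in the charge, by [heis_quadE]. *)
Definition height (N : nat) : F -> F := occ_sum (fun i => (N + N - i.+1)%:R) N.
HB.instance Definition _ N := GRing.Linear.on (height N).

Lemma W_height v : W v -> exists N0 : nat, forall N, (N0 <= N)%N -> W (height N v).
Proof.
move=> h; have [N1 h1] := heis_quad_J rho v.
have [N2 h2] := occ_charge rho v; have [N3 h3] := occ_charge rho (charge v).
exists (maxn N1 (maxn N2 N3)) => N hN.
have Wq : W (heis_quad (bwin K N) (cwin K N) (N + N) v).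
  rewrite h1; last by lia.
  apply: subspace_sum_seq => // k; rewrite mem_index_iota => hk.
  by apply: W_J; [lia|apply: W_J => //; lia].
have E1 u : \sum_(0 <= i < N + N) occ (bwin K N) (cwin K N) i u = occ_sum (fun=> 1) N u.
  by rewrite /occ_sum; apply: eq_bigr => i _; rewrite scale1r.
have := heis_quadE (@bwin_bwin K N) (@cwin_cwin K N) (@cwin_bwin K N) (N + N) v.
rewrite !E1 h2; last by lia.
rewrite linearD linearZ /= h2 ?h3; try lia.
(* Solves the quadratic identity for twice [height N v]: the terms moved across are the total
   occupation [N + charge] and its square, applied to [v]. *)
move=> /(congr1 (fun x => x - (N%:R *: v + charge v) + (N%:R *: (N%:R *: v + charge v) + (N%:R *: charge v + charge (charge v))))).
rewrite addrK subrK => E; apply: W_half; rewrite -[X in W X]E.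
have hc := W_charge h.
apply: subspaceD => //; first apply: subspaceB => //; first exact: subspaceZ.
  by apply: subspaceD => //; apply: subspaceZ.
by apply: subspaceD => //; [apply: subspaceZ => //; apply: subspaceD => //; apply: subspaceZ|
  apply: subspaceD => //; [apply: subspaceZ|apply: W_charge]].
Qed.

(* [height N] multiplies the [i]-th term of the current by an affine function of [i]:
   iterated commutators give all moments of its terms, hence the terms. *)
Lemma separate_modes (x : int -> F -> F) (alpha : nat -> K) (beta : K) :
  beta != 0 ->
  (forall v, lfin (x^~ v)) ->
  (forall v, W v -> W (lsum (x^~ v))) ->
  (forall (N : nat) i v, height N (x i v) = x i (height N v) +
     (if - N%:Z <= i < N%:Z then alpha N + beta * i%:~R else 0) *: x i v) ->
  forall i v, W v -> W (x i v).
Proof.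
move=> beta0 fx Wx comm.
have fxd d v : lfin (fun i : int => i%:~R ^+ d *: x i v).
  by have [N hN] := fx v; exists N => i /hN ->; rewrite scaler0.
have Wd d : forall v, W v -> W (lsum (fun i : int => i%:~R ^+ d *: x i v)).
  elim: d => [|d IH] v h.
    by rewrite (eq_lsum (y := x^~ v)) => [|i]; [exact: Wx|rewrite expr0 scale1r].
  have [N1 h1] := W_height h; have [N2 h2] := W_height (IH v h).
  (* [N] must be good for [v] and for its moment of order [d], and beyond it the terms [x i v]
     vanish, so that the commutator [y] may be written with the affine formula for every [i]. *)
  have [N3 h3] := fx v; pose N := maxn N1 (maxn N2 N3).
  have van : vanish_outside N (x^~ v) by apply: vanish_outside_le h3; lia.
  pose y (i : int) := - (alpha N) *: (i%:~R ^+ d *: x i v) + - beta *: (i%:~R ^+ d.+1 *: x i v).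
  have fy : lfin y by apply: lfinD; apply/lfinZ/fxd.
  have E := lsum_commute (D := height N) (x := fun i v => i%:~R ^+ d *: x i v) (v := v) (fxd d v) fy.
  have Ey : lsum y = - alpha N *: lsum (fun i : int => i%:~R ^+ d *: x i v)
                   + - beta *: lsum (fun i : int => i%:~R ^+ d.+1 *: x i v).
    by rewrite -(lsumZ _ (fxd d v)) -(lsumZ _ (fxd d.+1 v)) -lsumD //; apply/lfinZ.
  have Ei i : i%:~R ^+ d *: x i (height N v) = height N (i%:~R ^+ d *: x i v) + y i.
    have -> : y i = - (i%:~R ^+ d *: ((if - N%:Z <= i < N%:Z then alpha N + beta * i%:~R else 0) *: x i v)).
      rewrite /y; case: ifPn => [_|hi]; last by rewrite (van i hi : x i v = 0) !scaler0 addr0 oppr0.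
      by rewrite exprSr !scalerA -scalerDl -scaleNr; congr (_ *: _); ring.
    by rewrite [height N (_ *: _)]linearZ /= comm scalerDr addrK.
  have Wy : W (lsum y).
    have -> : lsum y = lsum (fun i : int => i%:~R ^+ d *: x i (height N v))
        - height N (lsum (fun i : int => i%:~R ^+ d *: x i v)).
      by apply/eqP; rewrite eq_sym subr_eq addrC; apply/eqP; exact: E Ei.
    apply: subspaceB => //; first by apply: IH; apply: h1; lia.
    by apply: h2; lia.
  move: Wy; rewrite Ey => Wy.
  have : W (- beta *: lsum (fun i : int => i%:~R ^+ d.+1 *: x i v)).
    rewrite -[X in W X](addKr (- alpha N *: lsum (fun i : int => i%:~R ^+ d *: x i v))).
    by apply: subspaceD => //; apply: subspaceN => //; apply: subspaceZ => //; exact: IH.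
  by apply: subspaceZE; rewrite ?oppr_eq0.
move=> i v h; have [N hN] := fx v.
have [hi|/hN ->] := boolP (- N%:Z <= i < N%:Z); last exact: subspace0.
pose c (k : 'I_(N + N)) : K := (k%:Z - N%:Z)%:~R.
have c_inj : injective c.
  by move=> k l /intr_inj h'; apply: val_inj => /=; lia.
have hk : (absz (i + N%:Z)%R < N + N)%N by lia.
have := subspace_moments Wsub c_inj (y := fun k : 'I_(N + N) => x (k%:Z - N%:Z) v) _ (Ordinal hk).
rewrite /= (_ : _ - N%:Z = i); last by lia.
apply=> d; have := Wd d v h; rewrite (lsumE (N := N)) // => j /hN ->.
by rewrite scaler0.
Qed.

(** Mode [j] of psi^+ fills position [j + N], whose weight is [N - 1 - j]; mode [j] of psi^- empties
    position [N - 1 - j], of weight [N + j]. Both shifts have slope -1 in [j], nonzero as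
    [separate_modes] demands. *)
Lemma height_p N j v : height N (p j v) =
  p j (height N v) + (if - N%:Z <= j < N%:Z then (N%:R - 1) + -1 * j%:~R else 0) *: p j v.
Proof.
have E : window (fun i => (N + N - i.+1)%:R) N j =
    (if - N%:Z <= j < N%:Z then (N%:R - 1) + -1 * j%:~R else 0) :> K.
  rewrite /window; case: ifP => // hj.
  have -> : (N + N - (absz (j + N%:Z)%R).+1)%:R = ((N + N - (absz (j + N%:Z)%R).+1)%N%:Z)%:~R :> K by [].
  have -> : (N + N - (absz (j + N%:Z)%R).+1)%N%:Z = N%:Z - 1 - j by lia.
  by rewrite !rmorphB /= mulN1r.
by rewrite -E; exact: occ_sum_p.
Qed.

Lemma height_m N j v : height N (m j v) =
  m j (height N v) + (if - N%:Z <= j < N%:Z then - N%:R + -1 * j%:~R else 0) *: m j v.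
Proof.
have E : - window (fun i => (N + N - i.+1)%:R) N (-1 - j) =
    (if - N%:Z <= j < N%:Z then - N%:R + -1 * j%:~R else 0) :> K.
  rewrite /window (_ : (- N%:Z <= -1 - j < N%:Z) = (- N%:Z <= j < N%:Z)); last by lia.
  case: ifP => hj; last by rewrite oppr0.
  have -> : (N + N - (absz (-1 - j + N%:Z)%R).+1)%:R = ((N + N - (absz (-1 - j + N%:Z)%R).+1)%N%:Z)%:~R :> K by [].
  have -> : (N + N - (absz (-1 - j + N%:Z)%R).+1)%N%:Z = N%:Z + j by lia.
  by rewrite rmorphD /= opprD mulN1r.
by rewrite -E scaleNr; exact: occ_sum_m.
Qed.

Lemma height_z N j v : height N (z j v) = z j (height N v).
Proof. exact: occ_sum_z. Qed.

Lemma W_pz i j v : W v -> W (p i (z j v)).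
Proof.
move=> h; rewrite (_ : j = i + j - i); last by lia.
apply: (separate_modes (x := fun i' v => p i' (z (i + j - i') v))
  (alpha := fun N => N%:R - 1) (beta := -1)) => //.
- by rewrite oppr_eq0 oner_eq0.
- exact: lfin_pz.
- by move=> u; exact: W_E.
by move=> N k u; rewrite height_p height_z.
Qed.

Lemma W_zm i j v : W v -> W (z i (m j v)).
Proof.
move=> h; rewrite (_ : i = i + j - j); last by lia.
apply: (separate_modes (x := fun j' v => z (i + j - j') (m j' v))
  (alpha := fun N => - N%:R) (beta := -1)) => //.
- by rewrite oppr_eq0 oner_eq0.
- exact: lfin_zm.
- by move=> u; exact: W_F.
by move=> N k u; rewrite height_z height_m linearD linearZ.
Qed.

(* An even number of modes is a combination of products of the generators [p z] and
   [z m], by inserting [z r z (-1) + z (-1) z r = 2]. *)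
Lemma split2 (u : F) : 2 *: u = z r (z (-1) u) + z (-1) (z r u).
Proof. by rewrite zz eqxx mulr1 subrK. Qed.

Lemma split2_p i (u : F) : 2 *: p i u = p i (z r (z (-1) u)) + p i (z (-1) (z r u)).
Proof. by rewrite -(linearD (p i)) -split2 linearZ. Qed.

Lemma split2_m i (u : F) : 2 *: m i u = - z r (m i (z (-1) u)) - z (-1) (m i (z r u)).
Proof. by rewrite -!mz -(linearD (m i)) -split2 linearZ. Qed.

Lemma W_pm i j v : W v -> W (p i (m j v)).
Proof.
move=> h; apply: W_half; rewrite split2_p.
by apply: subspaceD => //; apply/W_pz/W_zm.
Qed.

Lemma W_pp i j v : W v -> W (p i (p j v)).
Proof.
move=> h; apply: W_half; rewrite split2_p.
have Wk k l : W (p i (z k (z l (p j v)))).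
  rewrite zp [z k _]raddfN [p i _]raddfN; apply: subspaceN => //.
  by apply/W_pz/W_pz.
exact: subspaceD.
Qed.

Lemma W_mm i j v : W v -> W (m i (m j v)).
Proof.
move=> h; apply: W_half; rewrite split2_m.
have Wk k l : W (- z k (m i (z l (m j v)))) by apply: subspaceN => //; apply/W_zm/W_zm.
exact: subspaceD.
Qed.

Lemma W_mp i j v : W v -> W (m i (p j v)).
Proof.
by move=> h; rewrite mp; apply: subspaceB => //; [apply: subspaceZ|apply: W_pm].
Qed.

(** Inserting [p 0 m (-1) + m (-1) p 0 = 1] in front and moving one charged mode inside splits the
    product into one factor p z and one factor z m. *)
Lemma W_zz i j v : W v -> W (z i (z j v)).
Proof.
move=> h; set u := z i _.
have -> : u = p 0 (m (-1) u) + m (-1) (p 0 u) by rewrite pm scale1r subrK.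
rewrite /u; apply: subspaceD => //.
  by rewrite mz [m _ (z j v)]mz [z i _]raddfN opprK; apply/W_pz/W_zm.
have mN w : m (-1) (- w) = - m (-1) w by exact: raddfN.
by rewrite pz mN mz opprK; apply/W_zm/W_pz.
Qed.

Definition mode (c : option bool) (j : int) : {linear F -> F} :=
  match c with Some true => p j | Some false => m j | None => z j end.

Lemma W_mode2 c c' i j v : W v -> W (mode c i (mode c' j v)).
Proof.
move=> h; case: c c' => [[]|] [[]|] /=.
- exact: W_pp.
- exact: W_pm.
- exact: W_pz.
- exact: W_mp.
- exact: W_mm.
- by rewrite mz; apply: subspaceN => //; exact: W_zm.
- by rewrite zp; apply: subspaceN => //; exact: W_pz.
- exact: W_zm.
- exact: W_zz.
Qed.

Lemma ladder_mode b t : exists c j (a : K), forall v, ladder b t v = a *: mode c j v.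
Proof.
case: t => [[k|k]|k].
- exists (if b then Some true else Some false), (if b then Negz k else Posz k), 1 => v.
  by case: b; rewrite /= scale1r.
- exists (if b then Some false else Some true), (if b then Negz k else Posz k), 1 => v.
  by case: b; rewrite /= scale1r.
case: b; last first.
  exists None, (Posz (k + rho)), 1 => v; rewrite scale1r /=.
  by case: {+}rho; rewrite ?addn1 ?addn0.
exists None, (Negz k), 2^-1 => v.
by rewrite /= scalerA mulVf ?scale1r ?two_neq0.
Qed.

Lemma W_ladder2 b b' s t v : W v -> W (ladder b s (ladder b' t v)).
Proof.
move=> h; have [c [i [a ->]]] := ladder_mode b s; have [c' [j [a' ->]]] := ladder_mode b' t.
by rewrite linearZ; do 2! apply: subspaceZ => //; exact: W_mode2.
Qed.

(** In the Ramond sector [par] is itself the mode [z 0], so this is a product of two modes. *)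
Lemma W_par_ladder b t v : rho -> W v -> W (par (ladder b t v)).
Proof.
move=> hr h; have -> u : par u = z 0 u by rewrite /= hr.
have [c [j [a ->]]] := ladder_mode b t.
by rewrite linearZ; apply: subspaceZ => //; exact: (W_mode2 None).
Qed.

(** The implication makes the sector the whole Fock space in the Ramond case, where the zero mode
    lets particles be added or removed one at a time. *)
Definition sector : set F := fun v => ~~ rho -> par v = v.

Lemma parityE (S : state) : parity K S = (-1) ^+ odd #|` S|.
Proof. by rewrite /parity big_const_seq count_predT iter_mulr_1 signr_odd. Qed.

Lemma sector_even v (S : state) :
  sector v -> S \in msupp v -> ~~ rho -> ~~ odd #|` S|.
Proof.
move=> sv Sv /sv /(congr1 (mcoeff S)); rewrite diag_opE parityE.
move: Sv; rewrite -mcoeff_neq0; case: (odd _) => //.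
by rewrite expr1 mulN1r => v0 /eqP; rewrite eq_sym -subr_eq0 opprK -mulr2n mulrn_eq0 (negPf v0).
Qed.

Hypothesis W_sector : forall v, W v -> sector v.

Definition deg_le (n : nat) (v : F) := forall S, S \in msupp v -> (#|` S| <= n)%N.

Lemma card_tog_in t (S : state) : t \in S -> #|` S| = (#|` tog t S|).+1.
Proof. by move=> tS; rewrite /tog tS (cardfsD1 t S) tS. Qed.

Lemma deg_le_lower n t v : deg_le n.+1 v -> deg_le n (ladder false t v).
Proof.
move=> dv S; rewrite -mcoeff_neq0 tog_opE; case: (boolP (t \in S)) => tS /=.
  by rewrite !mul0r eqxx.
rewrite mulf_eq0 negb_or mcoeff_neq0 => /andP[_ /dv].
by rewrite [X in (X <= _)%N](@card_tog_in t) ?togK ?in_tog ?eqxx ?addbT.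
Qed.

Lemma lower_supp t (v : F) (S : state) :
  S \in msupp v -> t \in S -> tog t S \in msupp (ladder false t v).
Proof.
move=> Sv tS; rewrite -mcoeff_neq0 tog_opE in_tog eqxx addbT tS togK mul1r.
by rewrite mulf_neq0 ?chi_neq0 ?mcoeff_neq0.
Qed.

Lemma msupp_neq0 (v : F) : v != 0 -> exists S, S \in msupp v.
Proof.
move=> v0; apply/fset0Pn; apply: contra v0 => /eqP v0.
by apply/eqP/malgP => S; rewrite mcoeff0 mcoeff_outdom ?v0.
Qed.

Lemma supp_neq0 (v : F) S : S \in msupp v -> v != 0.
Proof. by rewrite -mcoeff_neq0; apply: contra => /eqP ->; rewrite mcoeff0. Qed.

Lemma deg_le_par n v : deg_le n v -> deg_le n (par v).
Proof.
move=> dv S; rewrite -mcoeff_neq0 diag_opE mulf_eq0 negb_or => /andP[_].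
by rewrite mcoeff_neq0 => /dv.
Qed.

Lemma par_neq0 (v : F) : v != 0 -> par v != 0.
Proof. by apply: contra => /eqP h; rewrite -(par_sqr v) h linear0. Qed.

(** Annihilating an occupied slot lowers the particle number while a chosen state of the support
    survives ([lower_supp]), so the vacuum is reached by induction. Without a zero mode only pairs
    can be removed, and evenness supplies the second particle. *)
Lemma W_vac v : W v -> v != 0 -> W (vac K).
Proof.
move=> Wv v0; have [n dv] : exists n, deg_le n v.
  exists (\max_(S <- msupp v) #|` S|) => S Sv.
  exact: (leq_bigmax_seq (F := fun S : state => #|` S|)).
elim/ltn_ind: n v Wv v0 dv => n IH v Wv v0 dv.
have [[S Sv [t tS]]|h] := pselect (exists2 S, S \in msupp v & exists t, t \in S); last first.
  have [S Sv] := msupp_neq0 v0.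
  have E S' : S' \in msupp v -> S' = fset0.
    move=> S'v; apply: contra_notP h => /eqP/fset0Pn hS'.
    by exists S'.
  have vE : v = v@_fset0 *: vac K.
    apply/malgP => S'; rewrite mcoeffZ coef_basis eq_sym.
    have [->|S'0] := eqVneq S' fset0; first by rewrite mulr1.
    by rewrite mulr0 mcoeff_outdom //; apply: contra S'0 => /E ->.
  move: Wv; rewrite vE; apply: subspaceZE => //.
  by rewrite mcoeff_neq0 -(E S).
have n0 : (0 < n)%N.
  by apply: leq_trans (dv S Sv); rewrite (card_tog_in tS).
have dv' : deg_le n.-1 (ladder false t v) by apply: deg_le_lower; rewrite prednK.
have Sv' := lower_supp Sv tS.
have [hr|hr] := boolP rho.
  apply: (IH n.-1 _ (par (ladder false t v))); first by lia.
  - exact: W_par_ladder.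
  - exact/par_neq0/supp_neq0/Sv'.
  - exact: deg_le_par.
have := sector_even (W_sector Wv) Sv hr; rewrite (card_tog_in tS) /= negbK => hodd.
have [s sS] : exists s, s \in tog t S.
  by apply/fset0Pn; apply: contraL hodd => /eqP ->; rewrite cardfs0.
apply: (IH n.-1 _ (ladder false s (ladder false t v))); first by lia.
- exact: W_ladder2.
- exact: supp_neq0 (lower_supp Sv' sS).
- have n1 : (0 < n.-1)%N by apply: leq_trans (dv' _ Sv'); rewrite (card_tog_in sS).
  by move=> S' hS'; apply: leq_trans (leq_pred _); apply: (@deg_le_lower n.-2 s) hS'; rewrite prednK.
Qed.

(** Particles are created from the vacuum one at a time with [par], or two at a time without it;
    each step yields the basis vector up to a nonzero sign. *)
Lemma W_basis (S : state) : W (vac K) -> (~~ rho -> ~~ odd #|` S|) -> W (basis K S).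
Proof.
move=> Wvac; have [n] := ubnP #|` S|; elim: n S => // n IH S /ltnSE hn hS.
have [->//|[t tS]] := fset_0Vmem S.
have tS' : t \notin (S `\ t)%fset by rewrite !inE eqxx.
have cS : #|` S| = #|` S `\ t|%fset.+1 by rewrite (cardfsD1 t) tS.
have Et : ladder true t (basis K (S `\ t)%fset) = chi K t (S `\ t)%fset *: basis K S.
  by rewrite ladder_basis ?fsetD1K.
have [hr|hr] := boolP rho.
  have : W (par (ladder true t (basis K (S `\ t)%fset))).
    by apply: W_par_ladder => //; apply: IH; [lia|rewrite hr].
  rewrite Et linearZ /= par_basis scalerA; apply: subspaceZE => //.
  by rewrite mulf_neq0 ?chi_neq0 // parityE signr_eq0.
have := hS hr; rewrite cS /= negbK => hodd.
have [E|[s sS]] := fset_0Vmem (S `\ t)%fset; first by rewrite E cardfs0 in hodd.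
have sS' : s \notin (S `\ t `\ s)%fset by rewrite !inE eqxx.
have cS' : #|` S `\ t|%fset = #|` S `\ t `\ s|%fset.+1 by rewrite (cardfsD1 s) sS.
have : W (ladder true t (ladder true s (basis K (S `\ t `\ s)%fset))).
  apply: W_ladder2; apply: IH; first by lia.
  by move=> _; move: hodd; rewrite cS'.
rewrite ladder_basis // fsetD1K // linearZ /= Et scalerA; apply: subspaceZE => //.
by rewrite mulf_neq0 ?chi_neq0.
Qed.

Lemma sector_irreducible : (exists2 v, W v & v != 0) -> forall v, sector v -> W v.
Proof.
move=> [u Wu u0] v sv; have Wvac := W_vac Wu u0.
rewrite (fock_basis v); apply: subspace_sum_seq => // S Sv; apply: subspaceZ => //.
by apply: W_basis => //; exact: sector_even sv Sv.
Qed.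

End Irreducibility.

(** * The action of the affine algebra *)

Section Pairing.
Variable K : numFieldType.
Implicit Types (mu nu : 'rV[K]_3) (h : 'cV[K]_3).

Lemma pairingDl mu nu h : pairing (mu + nu) h = pairing mu h + pairing nu h.
Proof. by rewrite /pairing mulmxDl mxE. Qed.

Lemma pairingZl a mu h : pairing (a *: mu) h = a * pairing mu h.
Proof. by rewrite /pairing -scalemxAl mxE. Qed.

Lemma pairingNl mu h : pairing (- mu) h = - pairing mu h.
Proof. by rewrite -scaleN1r pairingZl mulN1r. Qed.

Lemma pairing_suml (s : seq slot) (f : slot -> 'rV[K]_3) h :
  pairing (\sum_(t <- s) f t) h = \sum_(t <- s) pairing (f t) h.
Proof. by rewrite /pairing mulmx_suml summxE. Qed.

Lemma pairingE mu h : pairing mu h = \sum_j mu 0 j * h j 0.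
Proof. by rewrite /pairing mxE. Qed.

Lemma pairing_coroot mu (i : 'I_2) : pairing mu (coroot K i) = mu 0 (inord i).
Proof.
have hi : (i < 3)%N by apply: ltn_trans (ltn_ord i) _.
rewrite pairingE (bigD1 (inord i)) //= mxE inordK // eqxx mulr1 big1 ?addr0 // => j ji.
rewrite mxE (_ : _ == _ :> nat = false) ?mulr0 //.
by apply: contraNF ji => /eqP e; apply/eqP/val_inj; rewrite /= inordK.
Qed.

Lemma delta_coroot (i : 'I_2) : pairing delta (coroot K i) = 0.
Proof.
rewrite pairing_coroot /delta /alpha !mxE inordK; last by apply: ltn_trans (ltn_ord i) _.
by rewrite ltn_ord inord_val; case: i => -[|[|//]] hi; rewrite -!val_eqE /=; ring.
Qed.

Lemma alpha1_coroot (i : 'I_2) : pairing (alpha 1) (coroot K i) = if i == 0 then -2 else 2.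
Proof.
rewrite pairing_coroot /alpha mxE inordK; last by apply: ltn_trans (ltn_ord i) _.
by rewrite ltn_ord mxE inord_val; case: i => -[|[|//]] hi; rewrite -!val_eqE.
Qed.

End Pairing.

Definition zshift (K : numFieldType) (rho : bool) : K := (1 - rho%:Z)%:~R / 2.

Section Model.
Variables (K : numFieldType) (rho : bool) (A : int).
Notation F := (fock K).
Notation p := (@pmode K).
Notation m := (@mmode K).
Notation z := (@zmode K rho).
Notation r := (nat_of_bool rho)%:Z.
Notation B := (r - 2 - A).
Notation Ec := (@Ecur K rho).
Notation Fc := (@Fcur K rho).
Notation a1 := (alpha (K := K) 1).
Notation d := (delta (K := K)).

Notation q := (zshift K rho).

(** Forced by homogeneity: every term [p i z (a - i)] of [Ec a] must have weight alpha_1 + (a - A)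
    delta, and an annihilator has the opposite weight of its slot. The shift [q] is 0 in the Ramond
    case and 1/2 otherwise. *)
Definition slot_wt (t : slot) : 'rV[K]_3 :=
  match t with
  | inl (inl k) => a1 - ((A + 1 + k%:Z)%:~R + q) *: d
  | inl (inr k) => - a1 + ((A - k%:Z)%:~R + q) *: d
  | inr k => ((-1 - k%:Z)%:~R + q) *: d
  end.

(** The label [r - 2 * A] is the scalar of [z (B + 1)] after [z A] on the vacuum ([zz_vac]); the two
    labels add up to the level 2. *)
Definition lam : 'rV[K]_3 :=
  (r - 2 * A)%:~R *: Lambda 0 + (2 + 2 * A - r)%:~R *: Lambda 1.

Definition state_wt (S : state) : 'rV[K]_3 := lam + \sum_(t <- S) slot_wt t.

Definition hop (h : 'cV[K]_3) : F -> F :=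
  weight_op (pairing lam h) (fun t => pairing (slot_wt t) h).
HB.instance Definition _ h := GRing.Linear.on (hop h).

Lemma hop_basis h (S : state) : hop h (basis K S) = pairing (state_wt S) h *: basis K S.
Proof. by rewrite /hop weight_op_basis /state_wt pairingDl pairing_suml. Qed.

Lemma hop_ladder h b t v : hop h (ladder b t v) =
  ladder b t (hop h v) + pairing (if b then slot_wt t else - slot_wt t) h *: ladder b t v.
Proof. by rewrite /hop weight_op_ladder; case: b; rewrite ?pairingNl. Qed.

Lemma hop_p h j v : hop h (p j v) =
  p j (hop h v) + pairing (a1 - ((A - j)%:~R + q) *: d) h *: p j v.
Proof.
case: j => j; rewrite [LHS]hop_ladder.
  have -> : a1 - ((A - j%:Z)%:~R + q) *: d = - slot_wt (inl (inr j)).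
    by rewrite /= opprD opprK.
  by [].
have -> : A - Negz j = A + 1 + j%:Z by lia.
by [].
Qed.

Lemma hop_m h j v : hop h (m j v) =
  m j (hop h v) + pairing (- a1 + ((A + 1 + j)%:~R + q) *: d) h *: m j v.
Proof.
case: j => j; rewrite [LHS]hop_ladder.
  have -> : - a1 + ((A + 1 + j%:Z)%:~R + q) *: d = - slot_wt (inl (inl j)).
    by rewrite /= opprB addrC.
  by [].
have -> : A + 1 + Negz j = A - j%:Z by lia.
by [].
Qed.

Lemma q_rho : rho -> q = 0.
Proof. by rewrite /zshift => ->; rewrite subrr mul0r. Qed.

Lemma q_Nrho : ~~ rho -> q = 2^-1.
Proof. by rewrite /zshift => /negPf ->; rewrite subr0 mul1r. Qed.

Lemma hop_z h j v : hop h (z j v) =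
  z j (hop h v) + pairing ((j%:~R + q) *: d) h *: z j v.
Proof.
case: j => j; last first.
  have -> : (Negz j)%:~R + q = (-1 - j%:Z)%:~R + q by congr (_%:~R + _); lia.
  rewrite /zmode linearZ /= hop_ladder scalerDr scalerA mulrC -scalerA.
  by [].
rewrite /=; have [hr|hr] := boolP rho; last first.
  have -> : zshift K false = q by rewrite (negPf hr).
  rewrite hop_ladder /= -scaleNr.
  have -> : - ((-1 - j%:Z)%:~R + q) = (Posz j)%:~R + q by rewrite (q_Nrho hr) rmorphB rmorphN /=; field.
  by [].
have -> : zshift K true = q by rewrite hr.
rewrite (q_rho hr) addr0; case: j => [|j].
  by rewrite /hop weight_op_par pairingZl mul0r scale0r addr0.
rewrite hop_ladder /= -scaleNr (q_rho hr).
have -> : - ((-1 - j%:Z)%:~R + 0) = (Posz j.+1)%:~R :> K.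
  by rewrite addr0 -rmorphN /=; have -> : - (-1 - j%:Z) = Posz j.+1 by lia.
by [].
Qed.

Lemma hop_lsum h (x : int -> F -> F) mu v : lfin (x^~ v) ->
  (forall i, hop h (x i v) = x i (hop h v) + pairing mu h *: x i v) ->
  hop h (lsum (x^~ v)) = lsum (x^~ (hop h v)) + pairing mu h *: lsum (x^~ v).
Proof.
move=> fx hx; pose y i := - pairing mu h *: x i v.
have fy : lfin y by exact: lfinZ.
have Ei i : x i (hop h v) = hop h (x i v) + y i by rewrite hx /y scaleNr addrK.
have E : lsum (x^~ (hop h v)) = hop h (lsum (x^~ v)) + lsum y.
  exact: (lsum_commute (D := hop h) fx fy Ei).
by rewrite E (lsumZ _ fx) scaleNr subrK.
Qed.

Lemma hop_E h a v :
  hop h (Ec a v) = Ec a (hop h v) + pairing (a1 + (a - A)%:~R *: d) h *: Ec a v.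
Proof.
apply: (hop_lsum (x := fun i v => p i (z (a - i) v))) => [|i]; first exact: lfin_pz.
rewrite hop_p hop_z linearD linearZ /= -addrA -scalerDl -pairingDl.
have -> : (a - i)%:~R = (a - A)%:~R + (A - i)%:~R :> K by rewrite -rmorphD /=; congr _%:~R; lia.
by rewrite addrCA -scalerBl; have -> : (a - A)%:~R + (A - i)%:~R + q - ((A - i)%:~R + q) = (a - A)%:~R by ring.
Qed.

Lemma hop_F h b v :
  hop h (Fc b v) = Fc b (hop h v) + pairing (- a1 + (b - B)%:~R *: d) h *: Fc b v.
Proof.
apply: (hop_lsum (x := fun i v => z (b - i) (m i v))) => [|i]; first exact: lfin_zm.
rewrite hop_z hop_m linearD linearZ /= -addrA -scalerDl -pairingDl.
rewrite -addrA -scalerDl.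
have -> : (A + 1 + i)%:~R + q + ((b - i)%:~R + q) = (b - B)%:~R :> K.
  (* The two shifts [q] add up to [1 - r], an integer in both sectors. *)
  have -> : b - B = (A + 1 + i) + (b - i) + (1 - r) by lia.
  by rewrite !rmorphD /zshift; field.
by [].
Qed.

Lemma annihilate_vac t : ladder false t (vac K) = 0.
Proof.
apply: annihilate => S.
by rewrite /vac /basis msuppU oner_eq0 inE => /eqP ->; rewrite inE.
Qed.

Lemma vac_p j : 0 <= j -> p j (vac K) = 0.
Proof. by case: j => // j _; exact: annihilate_vac. Qed.

Lemma vac_m j : 0 <= j -> m j (vac K) = 0.
Proof. by case: j => // j _; exact: annihilate_vac. Qed.

Lemma par_vac : par (vac K) = vac K.
Proof. by rewrite /vac par_basis /parity big_seq_fset0 scale1r. Qed.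

Lemma vac_z j : r <= j -> z j (vac K) = 0.
Proof.
case: j => j; last by case: {+}rho.
by rewrite /=; case: {+}rho => [|_]; [case: j => // j _|]; exact: annihilate_vac.
Qed.

(* [(rho, A) = (true, 0), (false, -1), (false, 0)] give [lam = Lambda_0 + Lambda_1,
   2 Lambda_0, 2 Lambda_1]. *)
Hypothesis hA : (A == 0) || ~~ rho && (A == -1).

(** For [i >= 0] the charged mode kills the vacuum; for [i < 0] the neutral index [A - i] is at
    least [r] by [hA], so the neutral mode does. The next three lemmas run on the same dichotomy. *)
Lemma E_A_vac : Ec A (vac K) = 0.
Proof.
rewrite /Ecur -[RHS]lsum0; apply: eq_lsum => i; have [i0|i0] := leP 0 i.
  by rewrite pz vac_p // linear0 oppr0.
rewrite vac_z ?linear0 //; move: hA; case: {+}rho; lia.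
Qed.

Lemma F_B1_vac : Fc (B + 1) (vac K) = 0.
Proof.
rewrite /Fcur -[RHS]lsum0; apply: eq_lsum => i; have [i0|i0] := leP 0 i.
  by rewrite vac_m // linear0.
rewrite zm vac_z ?linear0 ?oppr0 //; move: hA; case: {+}rho; lia.
Qed.

Lemma F_B_vac : Fc B (vac K) = z (B + 1) (m (-1) (vac K)).
Proof.
rewrite /Fcur (lsum_single (k := -1)) => [|i hi]; first by rewrite opprK.
have [i0|i0] := leP 0 i; first by rewrite vac_m // linear0.
rewrite zm vac_z ?linear0 ?oppr0 //; move: hA; case: {+}rho; lia.
Qed.

Lemma E_A1_vac : Ec (A - 1) (vac K) = p (-1) (z A (vac K)).
Proof.
rewrite /Ecur (lsum_single (k := -1)) => [|i hi]; first by rewrite opprK subrK.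
have [i0|i0] := leP 0 i; first by rewrite pz vac_p // linear0 oppr0.
rewrite vac_z ?linear0 //; move: hA; case: {+}rho; lia.
Qed.

Lemma zz_vac : z (B + 1) (z A (vac K)) = (r - 2 * A)%:~R *: vac K.
Proof.
move: hA; have [hr|/negPn hr] := boolP (~~ rho); last first.
  by rewrite hr orbF => /eqP ->; rewrite /= !par_vac scale1r.
rewrite andTb (negPf hr) => /orP[] /eqP -> /=; first by rewrite !annihilate_vac !linear0 scale0r.
rewrite linearZ /= (ladder_conj false) /= annihilate_vac linear0 subr0.
by congr (_ *: _).
Qed.

(** Here J_0 would appear, whose sum is infinite, so [E_F] does not apply. The commutator still
    shifts each mode as [2 *: charge] does, hence differs from it by the scalar [c] measured on the
    vacuum. *)
Lemma EF_zero_mode a b c : a + b = r - 2 ->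
  Ec a (Fc b (vac K)) - Fc b (Ec a (vac K)) = c *: vac K ->
  forall v, Ec a (Fc b v) - Fc b (Ec a v) = 2 *: charge v + c *: v.
Proof.
move=> ab hv.
have tp j v : Ec a (Fc b (p j v)) - Fc b (Ec a (p j v)) =
    p j (Ec a (Fc b v) - Fc b (Ec a v)) + 2 *: p j v.
  rewrite F_p linearD /= !E_p F_p E_z.
  have -> : a - r + 1 + (b + 1 + j) = j by lia.
  by rewrite linearB /= addrA opprD [LHS](AC (3*2) ((1*4)*(2*5)*3)) /= subrr addr0.
have tm j v : Ec a (Fc b (m j v)) - Fc b (Ec a (m j v)) =
    m j (Ec a (Fc b v) - Fc b (Ec a v)) - 2 *: m j v.
  rewrite E_m linearB /= !F_m E_m F_z.
  have -> : b - r + 1 + (a + 1 + j) = j by lia.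
  rewrite [m j (_ - _)]linearB /= !opprB.
  by rewrite [LHS](AC (2*3) ((1*5*4)*(2*3))) /= addNr addr0.
have tz j v : Ec a (Fc b (z j v)) - Fc b (Ec a (z j v)) =
    z j (Ec a (Fc b v) - Fc b (Ec a v)).
  rewrite F_z E_z linearB linearD !linearZ /= E_z E_m F_z F_p.
  have -> : a + 1 + (b - r + 1 + j) = j by lia.
  have -> : b + 1 + (a - r + 1 + j) = j by lia.
  rewrite [z j (_ - _)]linearB [- (m _ _ - _)]opprB scalerBr scalerDr /=.
  set P := 2 *: p _ _; set M := 2 *: m _ _; set Z := 2 *: z _ _.
  set X := z j _; set Y := z j _.
  rewrite [- (Y - M + _)]opprD [- (Y - M)]opprB [- (P + Z)]opprD.
  by rewrite [LHS](AC ((2*2)*(2*2)) ((1*6)*((2*7)*(3*8)*(4*5)))) /= !subrr addNr !addr0.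
pose T : set F := fun v => Ec a (Fc b v) - Fc b (Ec a v) = 2 *: charge v + c *: v.
apply: (mode_ind (rho := rho) (P := T)) => [|//|j v hv'].
- split=> [|x u w hu hw]; rewrite /T; first by rewrite !linear0 ?subr0 ?addr0.
  rewrite [Fc b _]linearP [Ec a (_ + _)]linearP [Ec a _]linearP [Fc b (_ + _)]linearP [charge _]linearP /=.
  have -> (s t s' t' : F) : x *: s + t - (x *: s' + t') = x *: (s - s') + (t - t').
    by rewrite scalerBr opprD addrACA.
  rewrite hu hw !scalerDr !scalerA [2 * x]mulrC [c * x]mulrC; exact: addrACA.
- by rewrite /T charge_vac scaler0 add0r.
split; rewrite /T.
- rewrite tp hv' charge_p [p j (_ + _)]linearD /= [p j (2 *: _)]linearZ /= [p j (c *: _)]linearZ /= scalerDr; exact: addrAC.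
- rewrite tm hv' charge_m [m j (_ + _)]linearD /= [m j (2 *: _)]linearZ /= [m j (c *: _)]linearZ /= scalerBr; exact: addrAC.
- rewrite tz hv' charge_z [z j (_ + _)]linearD /= [z j (2 *: _)]linearZ /= [z j (c *: _)]linearZ /=; reflexivity.
Qed.

Lemma lam_coroot (i : 'I_2) :
  pairing lam (coroot K i) = (if i == 0 then r - 2 * A else 2 + 2 * A - r)%:~R.
Proof.
rewrite pairing_coroot !mxE inordK; last by apply: ltn_trans (ltn_ord i) _.
by case: i => -[|[|//]] hi; rewrite -!val_eqE /= ?mulr0 ?mulr1 ?addr0 ?add0r.
Qed.

Lemma slot_wt_coroot t (i : 'I_2) :
  pairing (slot_wt t) (coroot K i) = (if i == 0 then -2 else 2) * chg K t.
Proof.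
case: t => [[k|k]|k] /=; rewrite ?pairingDl ?pairingNl pairingZl delta_coroot.
- by rewrite alpha1_coroot mulr0 subr0 mulr1.
- by rewrite alpha1_coroot mulr0 addr0 mulrN1.
- by rewrite !mulr0.
Qed.

Lemma hop_coroot (i : 'I_2) v : hop (coroot K i) v =
  (if i == 0 then -2 else 2) *: charge v
  + (if i == 0 then r - 2 * A else 2 + 2 * A - r)%:~R *: v.
Proof.
apply/malgP => S; rewrite mcoeffD !mcoeffZ [(charge v)@_S]diag_opE diag_opE lam_coroot add0r.
under eq_bigr do rewrite slot_wt_coroot.
by rewrite -mulr_sumr mulrDl mulrA; exact: addrC.
Qed.

Lemma E1F1 v : Ec A (Fc B v) - Fc B (Ec A v) = hop (coroot K 1) v.
Proof.
rewrite hop_coroot; apply: EF_zero_mode; first by lia.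
have zN j w : z j (- w) = - z j w by exact: raddfN.
rewrite E_A_vac linear0 subr0 F_B_vac E_z E_m E_A_vac linear0 sub0r zN.
have -> : A + 1 + -1 = A by lia.
have -> : A - r + 1 + (B + 1) = 0 by lia.
rewrite zz_vac pm vac_p // linear0 subr0 scale1r addrC -scalerBl.
have -> : (2 + 2 * A - r)%:~R = 2 - (r - 2 * A)%:~R :> K.
  have -> : 2 + 2 * A - r = 2 - (r - 2 * A) by lia.
  by rewrite rmorphB.
by [].
Qed.

Lemma E0F0 v : Fc (B + 1) (Ec (A - 1) v) - Ec (A - 1) (Fc (B + 1) v) = hop (coroot K 0) v.
Proof.
have := EF_zero_mode (a := A - 1) (b := B + 1) (c := - (r - 2 * A)%:~R).
move=> /(_ ltac:(lia)) H; rewrite hop_coroot eqxx -opprB H.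
  by rewrite opprD -!scaleNr opprK.
rewrite F_B1_vac linear0 sub0r E_A1_vac F_p F_z F_B1_vac linear0 sub0r.
have -> : B + 1 + 1 + -1 = B + 1 by lia.
have -> : B + 1 - r + 1 + A = 0 by lia.
by rewrite vac_m // scaler0 oppr0 linear0 add0r zz_vac scaleNr.
Qed.

Definition eop (i : 'I_2) : {linear F -> F} :=
  if i == 0 then (Fc (B + 1) : {linear F -> F}) else (Ec A : {linear F -> F}).
Definition fop (i : 'I_2) : {linear F -> F} :=
  if i == 0 then (Ec (A - 1) : {linear F -> F}) else (Fc B : {linear F -> F}).

Lemma eop_fop i j v :
  eop i (fop j v) - fop j (eop i v) = if i == j then hop (coroot K i) v else 0.
Proof.
case: i j => -[|[|//]] hi [] [|[|//]] hj; rewrite -!val_eqE /eop /fop -!val_eqE /=.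
- by rewrite (_ : Ordinal hi = 0) ?E0F0 //; exact: val_inj.
- by rewrite F_F subrr.
- by rewrite E_E subrr.
- by rewrite (_ : Ordinal hi = 1) ?E1F1 //; exact: val_inj.
Qed.

Lemma hop_fop h i v : hop h (fop i v) = fop i (hop h v) - pairing (alpha i) h *: fop i v.
Proof.
rewrite -scaleNr -pairingNl; case: i => -[|[|//]] hi; rewrite /fop -val_eqE /=.
  rewrite hop_E (_ : Ordinal hi = 0); last exact: val_inj.
  have -> : A - 1 - A = -1 by lia.
  by have -> : a1 + (-1)%:~R *: d = - alpha 0 by rewrite scaleN1r /delta opprD addrCA subrr addr0.
rewrite hop_F subrr scale0r addr0 (_ : Ordinal hi = 1) //; exact: val_inj.
Qed.

Lemma hop_vac h : hop h (vac K) = pairing lam h *: vac K.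
Proof. by rewrite /vac hop_basis /state_wt big_seq_fset0 addr0. Qed.

Lemma eop_vac i : eop i (vac K) = 0.
Proof. by rewrite /eop; case: ifP => _; [exact: F_B1_vac|exact: E_A_vac]. Qed.

Lemma vac_neq0 : vac K != 0.
Proof.
by apply/eqP => /(congr1 (mcoeff fset0)); rewrite coef_basis mcoeff0 eqxx => /eqP; rewrite oner_eq0.
Qed.

Lemma par_p j v : par (p j v) = - p j (par v).
Proof. by case: j => j; exact: par_ladder. Qed.

Lemma par_m j v : par (m j v) = - m j (par v).
Proof. by case: j => j; exact: par_ladder. Qed.

Lemma par_z j v : ~~ rho -> par (z j v) = - z j (par v).
Proof.
move=> /negPf hr; case: j => j /=; first by rewrite hr; exact: par_ladder.
by rewrite linearZ /= par_ladder scalerN.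
Qed.

Lemma par_E a v : ~~ rho -> par (Ec a v) = Ec a (par v).
Proof.
move=> hr; rewrite [LHS](raddf_lsum _ (lfin_pz rho a v)); apply: eq_lsum => i.
by rewrite /= par_p (par_z _ _ hr) [p i (- _)]raddfN opprK.
Qed.

Lemma par_F a v : ~~ rho -> par (Fc a v) = Fc a (par v).
Proof.
move=> hr; rewrite [LHS](raddf_lsum _ (lfin_zm rho a v)); apply: eq_lsum => i.
by rewrite /= (par_z _ _ hr) par_m [z _ (- _)]raddfN opprK.
Qed.

Lemma sector_fop i v : sector rho v -> sector rho (fop i v).
Proof.
move=> sv hr; have {}sv := sv hr.
by rewrite /fop; case: ifP => _; rewrite /= (par_F, par_E) // sv.
Qed.

Lemma sector_vac : sector rho (vac K).
Proof. by move=> _; exact: par_vac. Qed.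

Lemma sector_subspace : subspace (sector rho : set F).
Proof.
split=> [|a u v su sv] hr; first exact: linear0.
by rewrite [LHS]linearP /= su // sv.
Qed.

Lemma sector_irred (W : set F) : subspace W ->
  (forall i v, W v -> W (eop i v)) -> (forall i v, W v -> W (fop i v)) ->
  (forall h v, W v -> W (hop h v)) -> (forall v, W v -> sector rho v) ->
  (exists2 v, W v & v != 0) -> forall v, sector rho v -> W v.
Proof.
move=> sW We Wf Wh Ws; apply: (sector_irreducible (A := A)) => //.
- by move=> v /(We 1).
- by move=> v /(We 0).
- by move=> v /(Wf 1).
- by move=> v /(Wf 0).
(* The coroot of index 1 acts as twice the charge plus a scalar, which recovers the charge. *)
move=> v Wv; apply: (subspaceZE sW (a := 2)); first by rewrite pnatr_eq0.
have := Wh (coroot K 1) v Wv; rewrite hop_coroot => h.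
have := subspaceB sW h (subspaceZ sW (2 + 2 * A - r)%:~R Wv).
by rewrite addrK.
Qed.

Lemma pairing_inj (mu nu : 'rV[K]_3) : (forall h, pairing mu h = pairing nu h) -> mu = nu.
Proof.
move=> h; apply/rowP => j; have := h (delta_mx j 0).
by rewrite /pairing -!colE !mxE.
Qed.

Lemma hopE h v S : (hop h v)@_S = pairing (state_wt S) h * v@_S.
Proof. by rewrite diag_opE /state_wt pairingDl pairing_suml. Qed.

Definition sector_state (S : state) : bool := ~~ rho ==> ~~ odd #|` S|.

Lemma sector_basis S : sector_state S -> sector rho (basis K S).
Proof. by move=> hS hr; rewrite par_basis parityE (negPf (implyP hS hr)) scale1r. Qed.

Lemma has_dim_state_wt (mu : 'rV[K]_3) (T : {fset state}) :
  (forall S, (S \in T) = sector_state S && (state_wt S == mu)) ->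
  has_dim [set v : F | sector rho v /\ forall h, hop h v = pairing mu h *: v] #|` T|.
Proof.
move=> hT; exists (fun i => basis K (nth fset0 T i)); split=> [c c0 i|v].
  move/(congr1 (mcoeff (nth fset0 T i))): c0; rewrite mcoeff0 raddf_sum (bigD1 i) //=.
  rewrite [X in _ + X]big1 => [|j ji]; first by rewrite addr0 mcoeffZ coef_basis eqxx mulr1.
  rewrite mcoeffZ coef_basis nth_uniq ?ltn_ord ?fset_uniq //.
  by rewrite (negPf (_ : j != i :> nat)) ?mulr0.
split=> [[sv hv]|[c ->]].
  exists (fun i => v@_(nth fset0 T i)).
  have sT : (msupp v `<=` T)%fset.
    apply/fsubsetP => S Sv; rewrite hT; apply/andP; split.
      by apply/implyP => hr; exact: sector_even sv Sv hr.
    apply/eqP/pairing_inj => h; have := congr1 (mcoeff S) (hv h).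
    rewrite hopE mcoeffZ; apply: mulIf; by rewrite mcoeff_neq0.
  rewrite [LHS](monalgEw sT) (big_nth fset0) big_mkord; apply: eq_bigr => i _.
  by apply/malgP => S'; rewrite mcoeffZ !mcoeffU mulr_natr.
split.
  apply: (subspace_sum sector_subspace) => i _; apply: (subspaceZ sector_subspace).
  apply: sector_basis.
  by have := mem_nth fset0 (ltn_ord i); rewrite hT => /andP[].
move=> h; rewrite linear_sum scaler_sumr; apply: eq_bigr => i _.
rewrite linearZ /= hop_basis !scalerA mulrC.
by have := mem_nth fset0 (ltn_ord i); rewrite hT => /andP[_ /eqP ->].
Qed.

End Model.

(** * Uniqueness of irreducible highest weight modules *)

Section Shifts.
Variables (K : numFieldType) (U : lmodType K) (D : {linear U -> U}) (a : K).

(* Acts on the [D]-eigenvectors of eigenvalue [a] by a nonzero scalar, and kills the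
   vectors of eigenvalue [a - n - 1], [n] in [s]. *)
Definition shifts (s : seq nat) (u : U) : U :=
  foldr (fun n w => D w - (a - n%:R - 1) *: w) u s.

Lemma shifts_linear s : linear (shifts s).
Proof.
elim: s => [//|n s IH] c u v /=; rewrite IH linearP /= scalerDr scalerBr !scalerA [_ * c]mulrC.
by rewrite opprD addrACA.
Qed.
HB.instance Definition _ s := GRing.isLinear.Build K U U _ (shifts s) (@shifts_linear s).

Lemma shifts_eigen s u : D u = a *: u -> shifts s u = (\prod_(n <- s) n.+1%:R) *: u.
Proof.
move=> Du; elim: s => [|n s IH] /=; first by rewrite big_nil scale1r.
rewrite IH big_cons linearZ /= Du !scalerA -scalerBl; congr (_ *: _).
by rewrite -natr1; ring.
Qed.

Lemma shiftsD s u : shifts s (D u) = D (shifts s u).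
Proof. by elim: s => [//|n s IH] /=; rewrite IH [D (_ - _)]linearB /= [D (_ *: _)]linearZ. Qed.

Lemma shifts_cat s s' u : shifts (s ++ s') u = shifts s (shifts s' u).
Proof. exact: foldr_cat. Qed.

Lemma shiftsC s s' u : shifts s (shifts s' u) = shifts s' (shifts s u).
Proof.
elim: s => [//|n s IH] /=; rewrite IH.
by rewrite [shifts s' (_ - _)]linearB /= [shifts s' (_ *: _)]linearZ /= shiftsD.
Qed.

Lemma shifts_lower (f : {linear U -> U}) s u : (forall w, D (f w) = f (D w) - f w) ->
  shifts (map succn s) (f u) = f (shifts s u).
Proof.
move=> Df; elim: s => [//|n s IH] /=; rewrite IH Df [f (_ - _)]linearB /= [f (_ *: _)]linearZ /=.
have -> : a - n%:R - 1 = 1 + (a - n.+1%:R - 1) by rewrite -natr1; ring.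
by rewrite [(1 + _) *: _]scalerDl scale1r opprD addrA.
Qed.

Lemma shifts_step (f : {linear U -> U}) u : (forall w, D (f w) = f (D w) - f w) ->
  D u = a *: u -> shifts [:: 0%N] (f u) = 0.
Proof.
move=> Df Du; rewrite /= Df Du linearZ /= subr0 scalerBl scale1r.
by rewrite subrr.
Qed.

End Shifts.
Arguments shifts : simpl never.

Section LieModuleLinearity.
Variables (K : numFieldType) (g : lieAlgebra K) (V : lieModule g).

Fact act_linear (x : g) : linear (act x : V -> V).
Proof. by move=> a u v; exact: actDr. Qed.
HB.instance Definition _ (x : g) :=
  GRing.isLinear.Build K V V _ (act x) (act_linear x).

Lemma act0 (v : V) : act (0 : g) v = 0.
Proof. by have := actDl (-1) (0 : g) 0 v; rewrite scaler0 addr0 scaleN1r addNr. Qed.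

Lemma act_scale a (x : g) (v : V) : act (a *: x) v = a *: act x v.
Proof. by have := actDl a x 0 v; rewrite act0 !addr0. Qed.

End LieModuleLinearity.

(** * Comparison of a highest weight module with an operator model *)

Section Comparison.
Variables (K : numFieldType) (g : affineA11 K) (V : lieModule g) (lam : 'rV[K]_3).
Variables (F : lmodType K) (e f : 'I_2 -> {linear F -> F}) (h : 'cV[K]_3 -> {linear F -> F}).
Variables (sec : set F) (vac : F).
Hypothesis ef : forall i j v,
  e i (f j v) - f j (e i v) = if i == j then h (coroot K i) v else 0.
Hypothesis hf : forall x i v, h x (f i v) = f i (h x v) - pairing (alpha i) x *: f i v.
Hypothesis hvac : forall x, h x vac = pairing lam x *: vac.
Hypothesis evac : forall i, e i vac = 0.
Hypothesis vac0 : vac != 0.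
Hypothesis sec_sub : subspace sec.
Hypothesis sec_vac : sec vac.
Hypothesis sec_f : forall i v, sec v -> sec (f i v).
Hypothesis sec_irred : forall W : set F, subspace W ->
  (forall i v, W v -> W (e i v)) -> (forall i v, W v -> W (f i v)) ->
  (forall x v, W v -> W (h x v)) -> (forall v, W v -> sec v) ->
  (exists2 v, W v & v != 0) -> forall v, sec v -> W v.

Variable v0 : V.
Hypothesis V_irr : irreducible_module V.
Hypothesis v0_neq0 : v0 <> 0.
Hypothesis v0_wt : weight_space lam v0.
Hypothesis ev0 : forall i, act (gen_e g i) v0 = 0.

Notation eV i := (act (gen_e g i) : V -> V).
Notation fV i := (act (gen_f g i) : V -> V).
Notation hV x := (act (gen_h g x) : V -> V).

Lemma efV i j (v : V) :
  eV i (fV j v) - fV j (eV i v) = if i == j then hV (coroot K i) v else 0.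
Proof.
rewrite -act_bracket gen_ef; case: ifP => // _.
exact: act0.
Qed.

Lemma hfV x i (v : V) : hV x (fV i v) = fV i (hV x v) - pairing (alpha i) x *: fV i v.
Proof.
by rewrite -scaleNr -act_scale scaleNr -gen_hf act_bracket addrC subrK.
Qed.

Definition linear_rel (P : V -> F -> Prop) : Prop :=
  P 0 0 /\ forall a u w u' w', P u w -> P u' w' -> P (a *: u + u') (a *: w + w').

(* Graph of the map sending a word in the [f i] applied to [v0] to the same word
   applied to [vac]. *)
Definition word_graph (u : V) (w : F) : Prop := forall P : V -> F -> Prop,
  linear_rel P -> P v0 vac -> (forall i u w, P u w -> P (fV i u) (f i w)) -> P u w.

Lemma graph_lin : linear_rel word_graph.
Proof.
split=> [P [] //|a u w u' w' h1 h2 P hP P0 Pf].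
by case: (hP) => _; apply; [apply: h1|apply: h2].
Qed.

Lemma graph0 : word_graph v0 vac. Proof. by move=> P. Qed.

Lemma graph_f i u w : word_graph u w -> word_graph (fV i u) (f i w).
Proof. by move=> huw P hP P0 Pf; apply: (Pf); apply: huw. Qed.

Lemma graphD u w u' w' : word_graph u w -> word_graph u' w' -> word_graph (u + u') (w + w').
Proof.
by move=> h1 h2; have := graph_lin.2 1 _ _ _ _ h1 h2; rewrite !scale1r.
Qed.

Lemma graphZ a u w : word_graph u w -> word_graph (a *: u) (a *: w).
Proof.
by move=> h1; have := graph_lin.2 a _ _ _ _ h1 graph_lin.1; rewrite !addr0.
Qed.

(** The graph is an intersection of relations, so eliminating it forgets that the pair belongs to
    it; the conjunction keeps this fact available when passing to [f i]. *)
Lemma graph_h x u w : word_graph u w -> word_graph (hV x u) (h x w).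
Proof.
move=> huw; suff [] : word_graph u w /\ word_graph (hV x u) (h x w) by [].
apply: huw (fun u w => word_graph u w /\ word_graph (hV x u) (h x w)) _ _ _.
- split=> [|a u1 w1 u2 w2 [h1 h1'] [h2 h2']].
    by rewrite !linear0; split; exact: graph_lin.1.
  by split; rewrite ?linearP; exact: graph_lin.2.
- split; first exact: graph0.
  by rewrite v0_wt hvac; apply: graphZ; exact: graph0.
move=> i u1 w1 [h1 h2]; split; first exact: graph_f.
rewrite hfV hf -!scaleNr; apply: graphD; first exact: graph_f.
by apply: graphZ; exact: graph_f.
Qed.

Lemma graph_e i u w : word_graph u w -> word_graph (eV i u) (e i w).
Proof.
move=> huw; suff [] : word_graph u w /\ forall i, word_graph (eV i u) (e i w) by [].
apply: huw (fun u w => word_graph u w /\ forall i, word_graph (eV i u) (e i w)) _ _ _.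
- split=> [|a u1 w1 u2 w2 [h1 h1'] [h2 h2']].
    by split=> [|j]; rewrite ?linear0; exact: graph_lin.1.
  split=> [|j]; first exact: graph_lin.2.
  by rewrite [eV j _]linearP [e j _]linearP /=; apply: graph_lin.2.
- split=> [|j]; first exact: graph0.
  by rewrite ev0 evac; exact: graph_lin.1.
move=> j u1 w1 [h1 h2]; split=> [|k]; first exact: graph_f.
have -> : eV k (fV j u1) = (if k == j then hV (coroot K k) u1 else 0) + fV j (eV k u1).
  by rewrite -efV subrK.
have -> : e k (f j w1) = (if k == j then h (coroot K k) w1 else 0) + f j (e k w1).
  by rewrite -ef subrK.
apply: graphD; last exact: graph_f.
by case: ifP => _; [exact: graph_h|exact: graph_lin.1].
Qed.

Lemma graph_sec u w : word_graph u w -> sec w.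
Proof.
move=> huw; apply: (huw (fun _ w => sec w)) => //; last by move=> i _ w' /sec_f.
split=> [|a _ w1 _ w2 h1 h2]; first exact: subspace0.
by apply: subspaceD => //; exact: subspaceZ.
Qed.

(** In coordinates alpha_0 = (2, -2, 1) and alpha_1 = (-2, 2, 0), both equal to 1 at (0, 1/2, 2).
    Its eigenvalues grade the words by their length. *)
Lemma principal_cochar : exists x : 'cV[K]_3, forall i : 'I_2, pairing (alpha i) x = 1.
Proof.
exists (\col_j (if j == 0 then 0 else if j == 1 then 2^-1 else 2)) => i.
rewrite pairingE !big_ord_recl big_ord0 /alpha /cartanA11 !mxE.
by case: i => -[|[|//]] hi; rewrite -!val_eqE /= !inordK //=; field.
Qed.

(* The words of positive length have lower weight, so some [shifts] kills them
   while rescaling [v0] and [vac] by the same nonzero scalar. *)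
Lemma graph_top c c' : word_graph (c *: v0) (c' *: vac) -> c = c'.
Proof.
have [x hx] := principal_cochar; pose a := pairing lam x.
have lowV i (u : V) : hV x (fV i u) = fV i (hV x u) - fV i u by rewrite hfV hx scale1r.
have lowF i w : h x (f i w) = f i (h x w) - f i w by rewrite hf hx scale1r.
(* [b] is the coefficient of the empty word, common to both sides, and [s] kills the remainder on
   both sides. *)
pose P (u : V) (w : F) := exists b s, shifts (hV x) a s (u - b *: v0) = 0 /\
                              shifts (h x) a s (w - b *: vac) = 0.
move=> huw; have [] : P (c *: v0) (c' *: vac).
  apply: huw.
  - split=> [|b u w u' w' [b1 [s1 [h1 h1']]] [b2 [s2 [h2 h2']]]].
      by exists 0, [::]; rewrite /shifts /= !scale0r !subr0.
    exists (b * b1 + b2), (s1 ++ s2).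
    have E (U : lmodType K) (y y' y0 : U) :
        b *: y + y' - (b * b1 + b2) *: y0 = b *: (y - b1 *: y0) + (y' - b2 *: y0).
      by rewrite scalerBr scalerA scalerDl opprD addrACA.
    rewrite !E !shifts_cat; split.
      by rewrite [shifts _ _ s2 _]linearP /= h2 addr0 [shifts _ _ s1 _]linearZ /= shiftsC h1 linear0 scaler0.
    by rewrite [shifts _ _ s2 _]linearP /= h2' addr0 [shifts _ _ s1 _]linearZ /= shiftsC h1' linear0 scaler0.
  - by exists 1, [::]; rewrite /shifts /= !scale1r !subrr.
  (* A word of positive length has no top component. Incrementing [s] follows the eigenvalue lowered
     by [f i], and the new entry 0 kills [f i] of the top component. *)
  move=> i u w [b [s [h1 h2]]]; exists 0, ([:: 0%N] ++ map succn s); rewrite !scale0r !subr0.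
  have E (U : lmodType K) (D f' : {linear U -> U}) (y y0 : U) :
      (forall y, D (f' y) = f' (D y) - f' y) -> D y0 = a *: y0 ->
      shifts D a s (y - b *: y0) = 0 -> shifts D a ([:: 0%N] ++ map succn s) (f' y) = 0.
    move=> low ey0 hs; rewrite shifts_cat -[y](subrK (b *: y0)) [f' _]linearD /= [shifts _ _ (map _ _) _]linearD /=.
    rewrite (shifts_lower _ _ _ low) hs linear0 add0r.
    by rewrite shiftsC (shifts_step low) ?linear0 // linearZ /= ey0 !scalerA mulrC.
  split.
    by apply: E h1 => [w'|]; [exact: lowV|exact: v0_wt].
  by apply: E h2 => [w'|]; [exact: lowF|exact: hvac].
move=> b [s []]; rewrite -!scalerBl !linearZ /=.
have prod0 : \prod_(n <- s) n.+1%:R != 0 :> K.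
  by rewrite prodf_seq_neq0; apply/allP => n _; rewrite pnatr_eq0.
rewrite (shifts_eigen s (v0_wt x)) (shifts_eigen s (hvac x)) !scalerA => /eqP; rewrite scaler_eq0.
rewrite mulf_eq0 (negPf prod0) orbF (introF eqP v0_neq0) orbF subr_eq0 => /eqP ->.
move/eqP; rewrite scaler_eq0 mulf_eq0 (negPf prod0) (negPf vac0) !orbF subr_eq0 => /eqP ->.
by [].
Qed.

Lemma V_generated (W : set V) : subspace W ->
  (forall i u, W u -> W (eV i u)) -> (forall i u, W u -> W (fV i u)) ->
  (forall x u, W u -> W (hV x u)) -> forall u, W u -> u <> 0 -> forall v, W v.
Proof.
move=> sW We Wf Wh u0 Wu0 u0_neq0 v.
(* The stabiliser of [W] is a subalgebra containing the generators, hence everything. *)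
pose S : set g := (fun y => forall u, W u -> W (act y u)).
have ST : S = setT.
  apply: (@gen_generate _ g) => //; split=> [|y y' Sy Sy' u Wu]; last first.
    by rewrite act_bracket; apply: subspaceB => //; [apply/Sy/Sy'|apply/Sy'/Sy].
  split=> [u _|a y y' Sy Sy' u Wu]; first by rewrite act0; exact: subspace0.
  by rewrite actDl; apply: subspaceD => //; [apply: subspaceZ => //; exact: Sy|exact: Sy'].
have subW : submodule W.
  by split=> // x w Ww; have Sx : S x by [rewrite ST]; exact: Sx.
case: (V_irr.2 W subW) => E; last by rewrite E.
by case: u0_neq0; move: Wu0; rewrite E.
Qed.

(** The vectors related to 0 form a submodule. A nonzero one would put [v0] among them, against
    [graph_top] with coefficients 1 and 0. *)
Lemma graph_kerV u : word_graph u 0 -> u = 0.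
Proof.
move=> hu; apply: contrapT => u0.
have : word_graph v0 0.
  apply: (V_generated (W := fun u => word_graph u 0)) hu u0 _.
  - split=> [|a w w' h1 h2]; first exact: graph_lin.1.
    by have := graph_lin.2 a _ _ _ _ h1 h2; rewrite scaler0 addr0.
  - by move=> i w hw; rewrite -(linear0 (e i)); exact: graph_e.
  - by move=> i w hw; rewrite -(linear0 (f i)); exact: graph_f.
  - by move=> x w hw; rewrite -(linear0 (h x)); exact: graph_h.
rewrite -{1}[v0]scale1r -(scale0r vac) => /graph_top /eqP.
by rewrite oner_eq0.
Qed.

Lemma graph_kerF w : word_graph 0 w -> w = 0.
Proof.
move=> hw; apply/eqP; apply: contrapT => /negP w0.
have : word_graph 0 vac.
  apply: (sec_irred (W := fun w => word_graph 0 w)) => //.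
  - split=> [|a y y' h1 h2]; first exact: graph_lin.1.
    by have := graph_lin.2 a _ _ _ _ h1 h2; rewrite scaler0 addr0.
  - by move=> i y hy; rewrite -(linear0 (act (gen_e g i))); exact: graph_e.
  - by move=> i y hy; rewrite -(linear0 (act (gen_f g i))); exact: graph_f.
  - by move=> x y hy; rewrite -(linear0 (act (gen_h g x))); exact: graph_h.
  - by move=> y; exact: graph_sec.
  - by exists w.
rewrite -{1}[vac]scale1r -(scale0r v0) => /graph_top /eqP.
by rewrite eq_sym oner_eq0.
Qed.

Lemma graph_totalV u : exists w, word_graph u w.
Proof.
apply: (V_generated (W := fun u => exists w, word_graph u w)) v0_neq0 u.
- split=> [|a y y' [w h1] [w' h2]]; first by exists 0; exact: graph_lin.1.
  by exists (a *: w + w'); exact: (graph_lin.2 a).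
- by move=> i y [w hw]; exists (e i w); exact: graph_e.
- by move=> i y [w hw]; exists (f i w); exact: graph_f.
- by move=> x y [w hw]; exists (h x w); exact: graph_h.
- by exists vac; exact: graph0.
Qed.

Lemma graph_totalF w : sec w -> exists u, word_graph u w.
Proof.
apply: (sec_irred (W := fun w => exists u, word_graph u w)).
- split=> [|a y y' [u h1] [u' h2]]; first by exists 0; exact: graph_lin.1.
  by exists (a *: u + u'); exact: (graph_lin.2 a).
- by move=> i y [u hu]; exists (eV i u); exact: graph_e.
- by move=> i y [u hu]; exists (fV i u); exact: graph_f.
- by move=> x y [u hu]; exists (hV x u); exact: graph_h.
- by move=> y [u hu]; exact: graph_sec hu.
- by exists vac; [exists v0; exact: graph0|].
Qed.

Lemma graph_sum d (c : 'I_d -> K) (u : 'I_d -> V) (w : 'I_d -> F) :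
  (forall i, word_graph (u i) (w i)) ->
  word_graph (\sum_i c i *: u i) (\sum_i c i *: w i).
Proof.
move=> huw; apply: (big_ind2 word_graph).
- exact: graph_lin.1.
- by move=> *; apply: graphD.
- by move=> i _; exact: graphZ.
Qed.

Lemma graphB u w u' w' : word_graph u w -> word_graph u' w' -> word_graph (u - u') (w - w').
Proof. by move=> h1 h2; rewrite -!scaleN1r; apply: graphD => //; exact: graphZ. Qed.

Lemma graph_wt mu u w : word_graph u w ->
  weight_space mu u <-> forall x, h x w = pairing mu x *: w.
Proof.
move=> huw; have hx x := graphB (graph_h x huw) (graphZ (pairing mu x) huw).
split=> wt x; have := hx x; rewrite wt subrr => E; apply/eqP; rewrite -subr_eq0; apply/eqP.
  exact: graph_kerF.
exact: graph_kerV.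
Qed.

Lemma weight_space_dim mu d :
  has_dim (fun w : F => sec w /\ forall x, h x w = pairing mu x *: w) d ->
  has_dim (@weight_space K g V mu) d.
Proof.
move=> [b [b_free b_span]].
have hb i : sec (b i) /\ forall x, h x (b i) = pairing mu x *: b i.
  apply/b_span; exists (fun j => (j == i)%:R).
  rewrite (bigD1 i) //= eqxx scale1r big1 ?addr0 // => j /negPf ->.
  by rewrite scale0r.
have [b' hb'] : {b' : 'I_d -> V & forall i, word_graph (b' i) (b i)}.
  by apply: (choice (P := fun i y => word_graph y (b i))) => i; apply: graph_totalF; case: (hb i).
exists b'; split=> [c c0|u].
  apply: b_free; apply: graph_kerF; rewrite -c0; exact: graph_sum.
split=> [hu|[c ->]].
  have [w huw] := graph_totalV u.
  have [c wE] : exists c : 'I_d -> K, w = \sum_i c i *: b i.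
    by apply/b_span; split; [exact: graph_sec huw|exact/(graph_wt mu huw)].
  exists c; apply/eqP; rewrite -subr_eq0; apply/eqP/graph_kerV.
  by rewrite -(subrr w) {2}wE; apply: graphB => //; exact: graph_sum.
apply/(graph_wt mu (graph_sum c hb')) => x.
rewrite linear_sum scaler_sumr; apply: eq_bigr => i _.
by rewrite linearZ /= (hb i).2 !scalerA mulrC.
Qed.

End Comparison.

(** * Generating functions *)

Section GeneratingFunctions.
Local Open Scope classical_set_scope.

(** Fubini along the fibres of [f]. Finiteness of the preimage keeps all these sums away from the
    default value 0 of sums with infinite support. *)
Lemma fsbig_fibers (X Y : choiceType) (D : set X) (f : X -> Y) (A : set Y) (c : X -> rat) :
  finite_set (D `&` f @^-1` A) ->
  \sum_(y \in A) \sum_(x \in D `&` [set x | f x = y]) c x = \sum_(x \in D `&` f @^-1` A) c x.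
Proof.
move=> fin; set S := fset_set (D `&` f @^-1` A).
have SE x : (x \in S) = (x \in D `&` f @^-1` A) by rewrite in_fset_set.
have inner y : A y ->
    \sum_(x \in D `&` [set x | f x = y]) c x = \sum_(x <- S | f x == y) c x.
  move=> Ay; rewrite -[RHS]big_filter; apply: fsbig_fwiden.
  - by move=> x [Dx fx] /=; rewrite mem_filter SE fx eqxx; apply/mem_set; split=> //; rewrite /preimage /= fx.
  - exact/filter_uniq/fset_uniq.
  - move=> x [/=]; rewrite mem_filter SE => /andP[/eqP fx /set_mem[Dx _]] h.
    by case: h.
rewrite [RHS]fsbig_finite // -/S [RHS](partition_big_imfset _ f) /=.
have AP (y : Y) : y \in [fset f x | x in S]%fset -> A y.
  by move=> /imfsetP[x /=]; rewrite SE => /set_mem[_ Afx] ->.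
rewrite (fsbigE [fset f x | x in S]%fset) ?fset_uniq //.
- rewrite big_seq_cond [RHS]big_seq_cond; apply: eq_big => y.
    by rewrite andbT; apply: andb_idr => /AP/mem_set.
  by move=> /andP[_ /set_mem Ay]; exact: inner.
- move=> y Ay yS; rewrite inner // big1_seq // => x /andP[/eqP fx xS].
  by case/negP: yS; rewrite -fx; exact: in_imfset.
Qed.

Variable M : nmodType.

(* The series of the [c x e^(w x)], [x] in [D]. *)
Definition gf (X : choiceType) (D : set X) (w : X -> M) (c : X -> rat) : fser M :=
  fun m => \sum_(x \in D `&` [set x | w x = m]) c x.

Definition finite_fibers (X : Type) (D : set X) (w : X -> M) : Prop :=
  forall m, finite_set (D `&` [set x | w x = m]).

Lemma fmul_gf (X X' : choiceType) (D : set X) (D' : set X') w w' c c' :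
  finite_fibers (D `*` D') (fun x => w x.1 + w' x.2) ->
  fmul (gf D w c) (gf D' w' c') =
  gf (D `*` D') (fun x => w x.1 + w' x.2) (fun x => c x.1 * c' x.2).
Proof.
move=> fin; apply/funext => m; rewrite /fmul.
pose f (x : X * X') := (w x.1, w' x.2).
rewrite [RHS](_ : _ = \sum_(x \in (D `*` D') `&` f @^-1` [set p | p.1 + p.2 = m]) c x.1 * c' x.2) //.
rewrite -fsbig_fibers; last exact: fin.
apply: eq_fsbigr => -[p q] /set_mem /= pqm; rewrite /gf.
have -> : (D `*` D') `&` [set x | f x = (p, q)] =
    (D `&` [set x | w x = p]) `*` (D' `&` [set x | w' x = q]).
  apply/seteqP; split=> [[x x'] [[/= Dx Dx'] [hx hx']] //|[x x'] [[/= Dx hx] [Dx' hx']]].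
  by split=> //; rewrite /f /= hx hx'.
have finX y : D' y -> w' y = q -> finite_set (D `&` [set x | w x = p]).
  move=> D'y wy; apply: sub_finite_set (finite_image fst (fin m)) => x [Dx hx].
  by exists (x, y) => //; split=> //=; rewrite hx wy.
have finX' x : D x -> w x = p -> finite_set (D' `&` [set y | w' y = q]).
  move=> Dx wx; apply: sub_finite_set (finite_image snd (fin m)) => y [Dy hy].
  by exists (x, y) => //; split=> //=; rewrite wx hy.
set P := D `&` _; set Q := D' `&` _.
(* A fibre of one factor embeds in a fibre of the product only through a point of the other factor,
   so empty fibres are treated apart. *)
have [->|/set0P[x0 [Dx0 wx0]]] := eqVneq P set0; first by rewrite set0X !fsbig_set0 mul0r.
have [->|/set0P[y0 [Dy0 wy0]]] := eqVneq Q set0; first by rewrite setX0 !fsbig_set0 mulr0.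
rewrite mulr_fsuml -(pair_fsbig _ (fun x y => c x * c' y)); [|exact: finX Dy0 wy0|exact: finX' Dx0 wx0].
by apply: eq_fsbigr => x _; rewrite mulr_fsumr.
Qed.

Lemma gf_reindex (X Y : choiceType) (D : set X) (D' : set Y) (phi : X -> Y) w c w' c' :
  set_bij D D' phi -> (forall x, D x -> w' (phi x) = w x) ->
  (forall x, D x -> c' (phi x) = c x) -> gf D' w' c' = gf D w c.
Proof.
move=> bij hw hc; apply/funext => m; rewrite /gf.
rewrite (reindex_fsbig phi (D `&` [set x | w x = m])); last first.
  case: bij => fun_phi inj_phi surj_phi; split.
  - by move=> x [Dx wx]; split; [exact: fun_phi|rewrite /= hw].
  - move=> x y /set_mem[Dx _] /set_mem[Dy _]; apply: inj_phi; exact/mem_set.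
  - move=> y [Dy wy]; have [x Dx xy] := surj_phi y Dy; exists x => //.
    by split=> //=; rewrite -hw // xy.
by apply: eq_fsbigr => x /set_mem[Dx _]; exact: hc.
Qed.

Lemma gf_scale (X : choiceType) (D : set X) w c (a : rat) :
  fscale a (gf D w c) = gf D w (fun x => a * c x).
Proof. by apply/funext => m; rewrite /fscale mulr_fsumr. Qed.

Lemma gf_add (X : choiceType) (D : set X) w c c' : finite_fibers D w ->
  fadd (gf D w c) (gf D w c') = gf D w (fun x => c x + c' x).
Proof. by move=> fin; apply/funext => m; rewrite /fadd /gf fsbig_split. Qed.

Lemma gf_restrict (X : choiceType) (D D' : set X) w (c : X -> rat) :
  D' `<=` D -> (forall x, D x -> ~ D' x -> c x = 0) -> gf D w c = gf D' w c.
Proof.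
move=> sD c0; apply/funext => m; apply/esym/fsbig_widen => [x [/sD]//|x [[Dx wx] nD]].
by apply: c0 => // D'x; apply: nD.
Qed.

Lemma fexp_gf (m : M) : fexp m = gf [set: unit] (fun=> m) (fun=> 1).
Proof.
apply/funext => m'; rewrite /fexp /gf; have [->|mm'] := eqVneq m' m.
  rewrite (_ : _ `&` _ = [set tt]) ?fsbig_set1 //.
  by apply/seteqP; split=> [[] //|[] _]; split.
rewrite (_ : _ `&` _ = set0) ?fsbig_set0 //.
by apply/seteqP; split=> [[] [_ /= e]|//]; rewrite e eqxx in mm'.
Qed.

Lemma gf_nonneg (X : choiceType) (D : set X) w (c : X -> rat) :
  (forall x, D x -> 0 <= c x) -> fnonneg (gf D w c).
Proof. by move=> c0 m; apply: fsumr_ge0 => x [Dx _]; exact: c0. Qed.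

End GeneratingFunctions.

(** * q-Pochhammer symbols as sums over finite sets *)

Section Pochhammer.
Local Open Scope classical_set_scope.
Variable M : nmodType.

Lemma eq_gf (X : choiceType) (D : set X) (w w' : X -> M) c c' :
  (forall x, D x -> w x = w' x) -> (forall x, D x -> c x = c' x) -> gf D w c = gf D w' c'.
Proof.
move=> hw hc; apply: (gf_reindex (phi := id)) => [|x Dx|x Dx]; rewrite ?hw ?hc //.
by split=> // x Dx; exists x.
Qed.

Variables (sg : bool) (a q : M).

(* [- e^a] when [sg], so that the factors [1 - fterm q^k] are [1 + e^(a + kq)]. *)
Definition fterm : fser M := if sg then fopp (fexp a) else fexp a.

Definition sgn : rat := if sg then 1 else -1.

Lemma fmul_fexp (m m' : M) : fmul (fexp m) (fexp m') = fexp (m + m').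
Proof.
rewrite !fexp_gf fmul_gf => [|n]; last exact: finite_finset.
apply: (gf_reindex (phi := fun=> (tt, tt))) => //.
split=> //; first by move=> [] [].
by move=> [[] []] _; exists tt.
Qed.

Lemma fpow_fexp (m : M) n : fpow (fexp m) n = fexp (m *+ n).
Proof.
elim: n => [|n IH]; first by rewrite mulr0n.
by rewrite /fpow iterS -/(fpow _ n) IH fmul_fexp mulrS.
Qed.

Lemma fmul_fopp (G H : fser M) : fmul (fopp G) H = fopp (fmul G H).
Proof.
apply/funext => m; rewrite /fmul /fopp -mulN1r mulr_fsumr.
by apply: eq_fsbigr => p _; rewrite mulN1r mulNr.
Qed.

Definition factor k : fser M := fadd fone (fopp (fmul fterm (fpow (fexp q) k))).

Definition bit_wt k (b : bool) : M := if b then a + q *+ k else 0.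
Definition bit_sg (b : bool) : rat := if b then sgn else 1.

Lemma factor_gf k : factor k = gf [set: bool] (bit_wt k) bit_sg.
Proof.
have -> : factor k = fadd fone (fscale sgn (fexp (a + q *+ k))).
  rewrite /factor /fterm /sgn; apply/funext => m; rewrite /fadd /fscale; congr (_ + _).
  by case: {+}sg; rewrite fpow_fexp ?fmul_fopp fmul_fexp /fopp ?opprK ?mul1r ?mulN1r.
apply/funext => m; rewrite /gf setTI fsbig_mkcond (fsbigTE [fset true; false]%fset) => [|[]]; rewrite ?inE //.
rewrite big_fsetU1 ?inE //= big_seq_fset1 /patch /fadd /fscale /fone /fexp /bit_wt [LHS]addrC.
by congr (_ + _); [case: eqVneq => [->|h]; [rewrite mem_set ?mulr1|rewrite memNset ?mulr0 //= => e; rewrite e eqxx in h]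
   |case: eqVneq => [->|h]; [rewrite mem_set|rewrite memNset //= => e; rewrite e eqxx in h]].
Qed.

Definition set_wt (S : {fset nat}) : M := \sum_(k <- S) (a + q *+ k).
Definition set_sg (S : {fset nat}) : rat := \prod_(k <- S) sgn.

Lemma finite_fsubset (T : choiceType) (A : {fset T}) : finite_set [set S : {fset T} | (S `<=` A)%fset].
Proof.
rewrite (_ : [set _ | _] = [set` fpowerset A]); first exact: finite_fset.
by apply/seteqP; split=> S /=; rewrite fpowersetE.
Qed.

(** Expanding the product picks from each factor either 1 or the other term; the indices where the
    latter is picked form the set [S]. *)
Lemma prod_factor (s : seq nat) : uniq s ->
  \big[@fmul M/fone]_(k <- s) factor k = gf [set S | (S `<=` [fset k in s])%fset] set_wt set_sg.
Proof.
elim: s => [_|k s IH /= /andP[ks us]].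
  rewrite big_nil /fone fexp_gf; symmetry; apply: (gf_reindex (phi := fun=> fset0)).
  - split=> [x _|[] [] //|S /= hS]; first exact: fsub0set.
    exists tt => //; apply/eqP; rewrite eq_sym -fsubset0; apply: fsubset_trans hS _.
    by apply/fsubsetP => x; rewrite !inE.
  - by move=> _ _; rewrite /set_wt big_seq_fset0.
  - by move=> _ _; rewrite /set_sg big_seq_fset0.
rewrite big_cons IH // factor_gf fmul_gf => [|m]; last first.
  by apply: finite_setIl; apply: finite_setX; [exact: finite_finset|exact: finite_fsubset].
have kS (S : {fset nat}) : (S `<=` [fset k in s])%fset -> k \notin S.
  by move=> /fsubsetP hS; apply/negP => /hS; rewrite inE; exact/negP.
symmetry; apply: (gf_reindex (phi := fun x => if x.1 then (k |` x.2)%fset else x.2)).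
- split=> [[b S] [_ /= hS]|[b S] [b' S'] /set_mem[_ /= hS] /set_mem[_ /= hS'] /= e|S /= hS].
  + apply/fsubsetP => x; case: b => /=; rewrite !inE; last by move=> /(fsubsetP hS); rewrite inE => ->; rewrite orbT.
    by case/orP => [->//|/(fsubsetP hS)]; rewrite inE => ->; rewrite orbT.
  + have eb : b = b'.
      move/fsetP/(_ k): e; case: b b' => -[]; rewrite //= !inE eqxx /= ?(negPf (kS _ hS)) ?(negPf (kS _ hS')) //.
    rewrite -eb in e *; case: b {eb} e => [e|-> //]; congr (_, _).
    apply/fsetP => x; move/fsetP/(_ x): e; rewrite !inE.
    by have [->|//] := eqVneq x k; rewrite (negPf (kS _ hS)) (negPf (kS _ hS')).
  + exists (k \in S, S `\ k)%fset; last by case: ifPn => kS' /=; [exact: fsetD1K|exact: mem_fsetD1].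
    split=> //=; apply/fsubsetP => x; rewrite !inE => /andP[xk /(fsubsetP hS)].
    by rewrite !inE (negPf xk).
- move=> [b S] [_ /= /kS hS]; case: b => /=; last by rewrite add0r.
  by rewrite /set_wt big_fsetU1.
- move=> [b S] [_ /= /kS hS]; case: b => /=; last by rewrite mul1r.
  by rewrite /set_sg big_fsetU1.
Qed.

(** Finitely many sets have weight [m], so the coefficient of a partial product is constant once all
    their elements are below [N]; the stable value is unique, which determines [xget]. *)
Lemma qpoch1_gf : finite_fibers setT set_wt -> qpoch1 fterm (fexp q) = gf setT set_wt set_sg.
Proof.
move=> fin; apply/funext => m; rewrite /qpoch1.
pose T := fset_set (setT `&` [set S | set_wt S = m]).
pose N0 := (\max_(S <- T) \max_(k <- S) k).+1.
have partial N : (N0 <= N)%N -> qpoch_partial fterm (fexp q) N m = gf setT set_wt set_sg m.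
  move=> hN; rewrite /qpoch_partial -/(\big[@fmul M/fone]_(0 <= k < N) factor k).
  rewrite prod_factor ?iota_uniq //; apply: fsbig_widen => [S [_ wS] //|S [[_ wS] nS]].
  case: nS; split=> //=; apply/fsubsetP => k kS; rewrite !inE mem_index_iota.
  apply: leq_trans hN; rewrite ltnS.
  have ST : S \in T by rewrite in_fset_set //; apply/mem_set.
  have h1 : (k <= \max_(k0 <- S) k0)%N by apply: (leq_bigmax_seq (F := fun k : nat => k)).
  have h2 : (\max_(k0 <- S) k0 <= \max_(S0 <- T) \max_(k0 <- S0) k0)%N.
    exact: (leq_bigmax_seq (F := fun S : {fset nat} => \max_(k <- S) k)).
  exact: leq_trans h1 h2.
set A := [set c | _]; apply: xget_subset1.
- by exists N0.
- move=> c c' [N1 h1] [N2 h2].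
  by rewrite -(h1 (maxn N1 N2)) ?leq_maxl // h2 ?leq_maxr.
Qed.

End Pochhammer.

(** * Finiteness of fibres from an integer grading *)

Section Graded.
Local Open Scope classical_set_scope.
Variables (M : nmodType) (K : numFieldType) (L : M -> K).
Hypothesis L0 : L 0 = 0.
Hypothesis LD : forall x y, L (x + y) = L x + L y.

(** Finite fibres alone are not inherited by sums of weights; a degree bounded below with finite
    sublevel sets is, by [graded_prod]. *)
Definition graded (X : Type) (w : X -> M) : Prop :=
  exists (dg : X -> int) (C : int), [/\ forall x, L (w x) = (dg x)%:~R,
    forall x, C <= dg x & forall n, finite_set [set x | dg x <= n]].

Lemma graded_fibers (X : Type) (w : X -> M) : graded w -> finite_fibers setT w.
Proof.
move=> [dg [C [Lw _ fin]]] m; rewrite setTI.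
have [[x0 wx0]|h] := pselect (exists x, w x = m); last first.
  by apply: sub_finite_set (finite_set0 X) => x /= wx; apply: h; exists x.
apply: sub_finite_set (fin (dg x0)) => x /= wx.
have := Lw x; rewrite wx -wx0 Lw => /intr_inj ->.
exact: lexx.
Qed.

Lemma graded_prod (X Y : Type) (w : X -> M) (w' : Y -> M) :
  graded w -> graded w' -> graded (fun x : X * Y => w x.1 + w' x.2).
Proof.
move=> [dg [C [Lw dgC fin]]] [dg' [C' [Lw' dgC' fin']]].
exists (fun x => dg x.1 + dg' x.2), (C + C'); split=> [x|x|n].
- by rewrite LD Lw Lw' rmorphD.
- exact: lerD.
apply: sub_finite_set (finite_setX (fin (n - C')) (fin' (n - C))) => -[x y] /= h.
by split => /=; have := dgC x; have := dgC' y; lia.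
Qed.

Lemma graded_unit : graded (fun _ : unit => 0).
Proof.
exists (fun=> 0), 0; split=> [_|//|n]; first by rewrite L0.
exact: finite_finset.
Qed.

(** Only [k = 0] can contribute negatively. The value [c = -1] does occur: it is the depth of
    delta/2 - alpha_1 in the case of 2 Lambda_1. *)
Lemma sum_ge (c : int) (S : {fset nat}) : -1 <= c -> -1 <= \sum_(k <- S) (2 * k%:Z + c).
Proof.
move=> c1; have [S0|S0] := boolP (0%N \in S).
  rewrite (big_fsetD1 0%N) //=; apply: (@le_trans _ _ (c + 0)); first by lia.
  rewrite mulr0 add0r lerD2l big_seq; apply: sumr_ge0 => k; rewrite !inE => /andP[k0 _]; lia.
apply: (@le_trans _ _ 0) => //; rewrite big_seq; apply: sumr_ge0 => k kS.
have : k != 0%N by apply: contraNneq S0 => <-.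
by lia.
Qed.

Lemma sum_elt (c : int) (S : {fset nat}) k : -1 <= c -> k \in S ->
  2 * k%:Z - 2 <= \sum_(k <- S) (2 * k%:Z + c).
Proof.
move=> c1 kS; rewrite (big_fsetD1 k) //=.
apply: (@le_trans _ _ (2 * k%:Z + c + -1)); first by lia.
by rewrite lerD2l; exact: sum_ge.
Qed.

Lemma L_sum (s : seq nat) (f : nat -> M) : L (\sum_(k <- s) f k) = \sum_(k <- s) L (f k).
Proof. by apply: (big_morph L LD L0). Qed.

Lemma graded_set_wt (a q : M) (c : int) : -1 <= c -> L a = c%:~R -> L q = 2 ->
  graded (set_wt a q).
Proof.
move=> c1 La Lq; exists (fun S : {fset nat} => \sum_(k <- S) (2 * k%:Z + c)), (-1).
have Lqk k : L (q *+ k) = 2 * k%:R.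
  by elim: k => [|k IH]; rewrite ?mulr0n ?mulr0 // mulrS LD IH Lq [k.+1%:R]mulrS mulrDr mulr1.
split=> [S|S|n].
- rewrite /set_wt L_sum rmorph_sum; apply: eq_bigr => k _ /=.
  by rewrite LD La Lqk rmorphD rmorphM /= addrC.
- exact: sum_ge.
have [N hN] : exists N : nat, n < N%:Z by exists (absz n).+1; lia.
apply: sub_finite_set (finite_fsubset [fset k in iota 0 (N + 2)]%fset) => S /= hS.
by apply/fsubsetP => k kS; rewrite inE mem_iota; have := le_trans (sum_elt c1 kS) hS; lia.
Qed.

(** The trailing [unit] indexes the empty product that ends the big operator in [qpoch]. *)
Definition triple : choiceType := ({fset nat} * ({fset nat} * ({fset nat} * unit)))%type.

Definition triple_wt (a0 a1 a2 q : M) (x : triple) : M :=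
  set_wt a0 q x.1 + (set_wt a1 q x.2.1 + (set_wt a2 q x.2.2.1 + 0)).

Definition triple_sg (sg : bool) (x : triple) : rat :=
  set_sg sg x.1 * (set_sg sg x.2.1 * (set_sg sg x.2.2.1 * 1)).

Variables (a0 a1 a2 q : M) (c0 c1 c2 : int).
Hypotheses (La0 : L a0 = c0%:~R) (La1 : L a1 = c1%:~R) (La2 : L a2 = c2%:~R) (Lq : L q = 2).
Hypotheses (hc0 : -1 <= c0) (hc1 : -1 <= c1) (hc2 : -1 <= c2).

Lemma graded_triple : graded (triple_wt a0 a1 a2 q).
Proof.
exact (graded_prod (graded_set_wt hc0 La0 Lq) (graded_prod (graded_set_wt hc1 La1 Lq)
  (graded_prod (graded_set_wt hc2 La2 Lq) graded_unit))).
Qed.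

Lemma qpoch_triple (sg : bool) :
  qpoch [:: fterm sg a0; fterm sg a1; fterm sg a2] (fexp q) =
  gf [set: triple] (triple_wt a0 a1 a2 q) (triple_sg sg).
Proof.
have g2 := graded_prod (graded_set_wt hc2 La2 Lq) graded_unit.
have g1 := graded_prod (graded_set_wt hc1 La1 Lq) g2.
rewrite /qpoch !big_cons big_nil.
rewrite (qpoch1_gf _ (graded_fibers (graded_set_wt hc0 La0 Lq))).
rewrite (qpoch1_gf _ (graded_fibers (graded_set_wt hc1 La1 Lq))).
rewrite (qpoch1_gf _ (graded_fibers (graded_set_wt hc2 La2 Lq))).
rewrite /fone fexp_gf fmul_gf setXTT; last exact: (graded_fibers g2).
rewrite fmul_gf setXTT; last exact: (graded_fibers g1).
by rewrite fmul_gf setXTT //; exact: (graded_fibers graded_triple).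
Qed.

Lemma triple_sgT x : triple_sg true x = 1.
Proof. by rewrite /triple_sg /set_sg !big1_eq !mulr1. Qed.

Lemma triple_sgF x : triple_sg false x =
  (-1) ^+ odd (#|` x.1| + #|` x.2.1| + #|` x.2.2.1|).
Proof.
have h (S : {fset nat}) : set_sg false S = (-1) ^+ #|` S|.
  by rewrite /set_sg big_const_seq count_predT iter_mulr_1.
by rewrite /triple_sg !h mulr1 -!exprD addnA signr_odd.
Qed.

(** The average of 1 and (-1)^n is the indicator of even n, with n the total number of elements of
    the triple. *)
Lemma half_sum_gf :
  fscale 2^-1 (fadd (gf [set: triple] (triple_wt a0 a1 a2 q) (triple_sg true))
                    (gf [set: triple] (triple_wt a0 a1 a2 q) (triple_sg false))) =
  gf [set x : triple | ~~ odd (#|` x.1| + #|` x.2.1| + #|` x.2.2.1|)]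
     (triple_wt a0 a1 a2 q) (fun=> 1).
Proof.
rewrite gf_add; last exact: graded_fibers graded_triple.
rewrite gf_scale (gf_restrict (D' := [set x : triple | ~~ odd (#|` x.1| + #|` x.2.1| + #|` x.2.2.1|)])) //.
  apply: eq_gf => // x /= /negPf h.
  by rewrite triple_sgT triple_sgF h expr0.
by move=> x _ /= /negP; rewrite negbK triple_sgT triple_sgF => ->; rewrite expr1 subrr mulr0.
Qed.

End Graded.

(** * Substitution of signed exponentials into power series *)

Section Substitution.
Local Open Scope classical_set_scope.
Variables (M : nmodType) (n : nat) (b : 'I_n -> M) (s : 'I_n -> rat).
Notation E := {ffun 'I_n -> nat}.

Definition subst_wt (m : E) : M := \sum_i b i *+ m i.
Definition subst_sg (m : E) : rat := \prod_i s i ^+ m i.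

Lemma fmul_scale (c c' : rat) (F G : fser M) :
  fmul (fscale c F) (fscale c' G) = fscale (c * c') (fmul F G).
Proof.
apply/funext => m; rewrite /fmul /fscale mulr_fsumr.
by apply: eq_fsbigr => p _; rewrite mulrACA.
Qed.

Lemma fscale1 (F : fser M) : fscale 1 F = F.
Proof. by apply/funext => m; rewrite /fscale mul1r. Qed.

Lemma fpow_scale (c : rat) (m : M) k :
  fpow (fscale c (fexp m)) k = fscale (c ^+ k) (fexp (m *+ k)).
Proof.
elim: k => [|k IH]; first by rewrite fscale1 mulr0n.
by rewrite /fpow iterS -/(fpow _ k) IH fmul_scale fmul_fexp mulrS exprS.
Qed.

Lemma fmonom_exp (m : E) :
  fmonom (fun i => fscale (s i) (fexp (b i))) m = fscale (subst_sg m) (fexp (subst_wt m)).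
Proof.
rewrite /fmonom /subst_sg /subst_wt.
elim/big_rec3: _ => [|i e x F _ ->]; first by rewrite fscale1.
by rewrite fpow_scale fmul_scale fmul_fexp.
Qed.

Lemma psubst_gf (X : choiceType) (D : set X) (w : X -> E) (c : X -> rat) :
  finite_fibers D (fun x => subst_wt (w x)) ->
  psubst (gf D w c) (fun i => fscale (s i) (fexp (b i))) =
  gf D (fun x => subst_wt (w x)) (fun x => c x * subst_sg (w x)).
Proof.
move=> fin; apply/funext => mu; rewrite /psubst.
transitivity (\sum_(m \in [set m : E | subst_wt m = mu])
   \sum_(x \in D `&` [set x | w x = m]) c x * subst_sg (w x)).
  rewrite [RHS]fsbig_mkcond; apply: eq_fsbigr => m _.
  rewrite fmonom_exp /fscale /fexp /patch; case: ifPn => [/set_mem /= <-|/negP h].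
    rewrite eqxx mulr1 /gf mulr_fsuml; apply: eq_fsbigr => x /set_mem[_ /= ->]; exact: erefl.
  by rewrite (_ : _ == _ = false) ?mulr0 //; apply/negP => /eqP e; apply: h; apply/mem_set.
by rewrite fsbig_fibers //; exact: fin.
Qed.

Lemma subst_wtD (m m' : E) : subst_wt (m + m') = subst_wt m + subst_wt m'.
Proof. by rewrite -big_split; apply: eq_bigr => i _; rewrite ffunE mulrnDr. Qed.

Lemma subst_wt0 : subst_wt 0 = 0.
Proof. by rewrite /subst_wt big1 // => i _; rewrite ffunE. Qed.

Lemma subst_sgD (m m' : E) : subst_sg (m + m') = subst_sg m * subst_sg m'.
Proof. by rewrite -big_split; apply: eq_bigr => i _; rewrite ffunE exprD. Qed.

Lemma subst_sg0 : subst_sg 0 = 1.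
Proof. by rewrite /subst_sg big1 // => i _; rewrite ffunE. Qed.

Lemma subst_set_wt (a q : E) S :
  subst_wt (set_wt a q S) = set_wt (subst_wt a) (subst_wt q) S.
Proof.
rewrite /set_wt (big_morph subst_wt subst_wtD subst_wt0); apply: eq_bigr => k _.
rewrite subst_wtD; congr (_ + _).
by elim: k => [|k IH]; rewrite ?mulr0n ?subst_wt0 // !mulrS subst_wtD IH.
Qed.

Lemma subst_set_sg (sg : bool) (a q : E) S : subst_sg a = sgn sg -> subst_sg q = 1 ->
  subst_sg (set_wt a q S) = set_sg sg S.
Proof.
move=> sa sq; rewrite /set_wt /set_sg (big_morph subst_sg subst_sgD subst_sg0).
apply: eq_bigr => k _; rewrite subst_sgD sa.
suff -> : subst_sg (q *+ k) = 1 by rewrite mulr1.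
by elim: k => [|k IH]; rewrite ?mulr0n ?subst_sg0 // mulrS subst_sgD sq IH mulr1.
Qed.

Lemma subst_triple_wt (a0 a1 a2 q : E) x : subst_wt (triple_wt a0 a1 a2 q x) =
  triple_wt (subst_wt a0) (subst_wt a1) (subst_wt a2) (subst_wt q) x.
Proof. by rewrite /triple_wt !subst_wtD !subst_set_wt subst_wt0. Qed.

Lemma subst_triple_sg (sg : bool) (a0 a1 a2 q : E) x :
  subst_sg a0 = sgn sg -> subst_sg a1 = sgn sg -> subst_sg a2 = sgn sg -> subst_sg q = 1 ->
  subst_sg (triple_wt a0 a1 a2 q x) = triple_sg sg x.
Proof.
move=> s0 s1 s2 sq; rewrite /triple_wt !subst_sgD subst_sg0.
by rewrite (subst_set_sg _ s0 sq) (subst_set_sg _ s1 sq) (subst_set_sg _ s2 sq).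
Qed.

End Substitution.

(** * Characters *)

Section StatesAsTriples.

Definition pslot (t : slot) : option nat := if t is inl (inl k) then Some k else None.
Definition mslot (t : slot) : option nat := if t is inl (inr k) then Some k else None.
Definition zslot (t : slot) : option nat := if t is inr k then Some k else None.

Definition split_state (S : state) : triple :=
  ([fset k in pmap pslot S]%fset, ([fset k in pmap mslot S]%fset, ([fset k in pmap zslot S]%fset, tt))).

Definition merge_triple (x : triple) : state :=
  [fset t in [seq inl (inl k) | k <- x.1] ++ [seq inl (inr k) | k <- x.2.1]
             ++ [seq inr k | k <- x.2.2.1]]%fset.

Lemma mem_pslot k (s : seq slot) : (k \in pmap pslot s) = (inl (inl k) \in s).
Proof. by elim: s => // -[[j|j]|j] s IH; rewrite /= !inE IH. Qed.

Lemma mem_mslot k (s : seq slot) : (k \in pmap mslot s) = (inl (inr k) \in s).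
Proof. by elim: s => // -[[j|j]|j] s IH; rewrite /= !inE IH. Qed.

Lemma mem_zslot k (s : seq slot) : (k \in pmap zslot s) = (inr k \in s).
Proof. by elim: s => // -[[j|j]|j] s IH; rewrite /= !inE IH. Qed.

Lemma merge_tripleK x : split_state (merge_triple x) = x.
Proof.
case: x => s0 [s1 [s2 []]].
have no (f g : nat -> slot) k (s : seq nat) : (forall i j, f i <> g j) -> (f k \in map g s) = false.
  by move=> fg; apply/negP => /mapP[j _ /fg].
congr (_, (_, (_, _))); apply/fsetP => k; rewrite !inE ?mem_pslot ?mem_mslot ?mem_zslot /merge_triple !inE /=.
- rewrite (mem_map (f := fun k => inl (inl k))) => [|i j []//].
  by rewrite (no (fun k => inl (inl k))) // (no (fun k => inl (inl k))) // !orbF.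
- rewrite (mem_map (f := fun k => inl (inr k))) => [|i j []//].
  by rewrite (no (fun k => inl (inr k))) // (no (fun k => inl (inr k))) // orbF.
- rewrite (mem_map (f := fun k => inr k)) => [|i j []//].
  by rewrite (no (fun k => inr k)) // (no (fun k => inr k)).
Qed.

Lemma split_state_inj : injective split_state.
Proof.
move=> S S' [/fsetP e0 /fsetP e1 /fsetP e2]; apply/fsetP => -[[k|k]|k].
- by have := e0 k; rewrite !inE !mem_pslot.
- by have := e1 k; rewrite !inE !mem_mslot.
- by have := e2 k; rewrite !inE !mem_zslot.
Qed.

Lemma uniq_pmap_slot (f : slot -> option nat) (S : state) :
  (forall t t' k, f t = Some k -> f t' = Some k -> t = t') -> uniq (pmap f S).
Proof.
move=> finj; have := fset_uniq S; elim: (S : seq slot) => //= t s IH /andP[ts us].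
case E: (f t) => [k|] /=; last exact: IH.
rewrite IH // andbT mem_pmap; apply: contra ts => /mapP[t' t's e].
by rewrite (finj t t' k).
Qed.

Lemma uniq_slots (S : state) :
  [/\ uniq (pmap pslot S), uniq (pmap mslot S) & uniq (pmap zslot S)].
Proof. by split; apply: uniq_pmap_slot => -[[i|i]|i] [[j|j]|j] k //= [->] [->]. Qed.

Lemma sum_fset_seq (V : nmodType) (s : seq nat) (f : nat -> V) : uniq s ->
  \sum_(k <- [fset k in s]%fset) f k = \sum_(k <- s) f k.
Proof. by move=> us; rewrite big_imfset //= undup_id. Qed.

Lemma card_fset_seq (s : seq nat) : uniq s -> #|` [fset k in s]%fset| = size s.
Proof. by move=> us; rewrite card_fseq undup_id. Qed.

Lemma sum_split (V : nmodType) (f : slot -> V) (S : state) :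
  \sum_(t <- S) f t = \sum_(k <- (split_state S).1) f (inl (inl k))
    + (\sum_(k <- (split_state S).2.1) f (inl (inr k))
    + (\sum_(k <- (split_state S).2.2.1) f (inr k) + 0)).
Proof.
have [u0 u1 u2] := uniq_slots S; rewrite !sum_fset_seq //.
elim: (S : seq slot) => [|[[k|k]|k] s IH] /=; rewrite ?big_nil ?big_cons ?addr0 // IH addr0 //.
- by rewrite addrA.
- by rewrite addrCA -!addrA.
- by rewrite [in LHS]addrC -!addrA; congr (_ + (_ + _)); rewrite addrC.
Qed.

Lemma card_split (S : state) : #|` S| =
  (#|` (split_state S).1| + #|` (split_state S).2.1| + #|` (split_state S).2.2.1|)%N.
Proof.
have [u0 u1 u2] := uniq_slots S; rewrite !card_fset_seq //.
by elim: (S : seq slot) => [|[[k|k]|k] s IH] //=; rewrite IH; lia.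
Qed.

End StatesAsTriples.

Section LevelTwoCharacter.
Local Open Scope classical_set_scope.
Variables (K : numFieldType) (rho : bool) (A : int).
Hypothesis hA : (A == 0) || ~~ rho && (A == -1).
Notation r := (nat_of_bool rho)%:Z.
Notation q := (zshift K rho).
Notation wt := (slot_wt K rho A).
Notation d := (delta (K := K)).
Notation lam := (lam K rho A).

(** These are the weights of the slots of index 0; the index [k] adds -k delta ([slot_wtE]), which
    gives the three product arguments with base e^(-delta). *)
Definition wt_p := alpha 1 - ((A + 1)%:~R + q) *: d.
Definition wt_m := - alpha 1 + (A%:~R + q) *: d.
Definition wt_z := (-1 + q) *: d.

Lemma alpha_third (i : 'I_2) : alpha i 0 (inord 2) = (i == 0)%:R :> K.
Proof. by rewrite /alpha mxE inordK. Qed.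

(* Twice minus the coefficient of [delta], so that all depths below are integers. *)
Definition depth (mu : 'rV[K]_3) : K := -2 * mu 0 (inord 2).

Lemma depthD mu nu : depth (mu + nu) = depth mu + depth nu.
Proof. by rewrite /depth mxE mulrDr. Qed.

Lemma depth0 : depth 0 = 0.
Proof. by rewrite /depth mxE mulr0. Qed.

Lemma depthZ a mu : depth (a *: mu) = a * depth mu.
Proof. by rewrite /depth mxE mulrCA. Qed.

Lemma depth_delta : depth d = -2.
Proof. by rewrite /depth /delta mxE !alpha_third -!val_eqE /= addr0 mulr1. Qed.

Lemma depth_alpha1 : depth (alpha 1) = 0.
Proof. by rewrite /depth alpha_third mulr0. Qed.

Lemma depthN mu : depth (- mu) = - depth mu.
Proof. by rewrite -scaleN1r depthZ mulN1r. Qed.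

Lemma two_zshift : 2 * q = (1 - r)%:~R.
Proof. by rewrite /zshift mulrC divfK ?pnatr_eq0. Qed.

Lemma depth_p : depth wt_p = (2 * (A + 1) + (1 - r))%:~R.
Proof.
rewrite /wt_p depthD depthN depthZ depth_delta depth_alpha1 [in RHS]rmorphD /= -two_zshift.
by ring.
Qed.

Lemma depth_m : depth wt_m = (- 2 * A - (1 - r))%:~R.
Proof.
rewrite /wt_m depthD depthN depthZ depth_delta depth_alpha1 [in RHS]rmorphB /= -two_zshift.
by ring.
Qed.

Lemma depth_z : depth wt_z = (1 + r)%:~R.
Proof.
clear hA; rewrite /wt_z depthZ depth_delta.
have -> : (1 + r)%:~R = 2 - (1 - r)%:~R :> K.
  have -> : 1 + r = 2 - (1 - r) by lia.
  by rewrite rmorphB.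
by rewrite -two_zshift; ring.
Qed.

Lemma depth_Ndelta : depth (- d) = 2.
Proof. by rewrite depthN depth_delta opprK. Qed.

Lemma depth_p_ge : -1 <= 2 * (A + 1) + (1 - r).
Proof. by move: hA; case: {+}rho; lia. Qed.

Lemma depth_m_ge : -1 <= - 2 * A - (1 - r).
Proof. by move: hA; case: {+}rho; lia. Qed.

Lemma depth_z_ge : -1 <= 1 + r.
Proof. by []. Qed.

Notation tw := (triple_wt wt_p wt_m wt_z (- d)).

Lemma graded_tw : graded depth tw.
Proof.
exact: (graded_triple depth0 depthD depth_p depth_m depth_z depth_Ndelta
  depth_p_ge depth_m_ge depth_z_ge).
Qed.

Lemma slot_wtE k : [/\ wt (inl (inl k)) = wt_p + (- d) *+ k,
  wt (inl (inr k)) = wt_m + (- d) *+ k & wt (inr k) = wt_z + (- d) *+ k].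
Proof.
have E : (- d) *+ k = - (k%:~R *: d) by rewrite mulNrn -scaler_nat.
rewrite /slot_wt /wt_p /wt_m /wt_z E.
split; rewrite !rmorphD ?rmorphN /= ?rmorph1 -?addrA.
- rewrite -opprD -scalerDl.
  by have -> : A%:~R + (1 + (k%:~R + q)) = A%:~R + (1 + q) + k%:~R :> K by ring.
- rewrite -scalerBl.
  by have -> : A%:~R + (- k%:~R + q) = A%:~R + q - k%:~R :> K by ring.
- rewrite -scalerBl.
  by have -> : -1 + (- k%:~R + q) = -1 + q - k%:~R :> K by ring.
Qed.

Lemma state_wt_split S : state_wt K rho A S = lam + tw (split_state S).
Proof.
rewrite /state_wt sum_split /triple_wt /set_wt; congr (_ + (_ + (_ + (_ + _)))).
- by apply: eq_bigr => k _; case: (slot_wtE k).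
- by apply: eq_bigr => k _; case: (slot_wtE k).
- by apply: eq_bigr => k _; case: (slot_wtE k).
Qed.

Lemma state_wt_fibers (D : set state) : finite_fibers D (state_wt K rho A).
Proof.
move=> mu; apply: finite_setIr.
have h := graded_fibers graded_tw (mu - lam).
apply: sub_finite_set (finite_image merge_triple h) => S /= <-.
exists (split_state S); last exact/split_state_inj/merge_tripleK.
by rewrite state_wt_split addrC addKr.
Qed.

Lemma lattice0 : @weight_lattice K 0.
Proof. by exists 0; apply/rowP => j; rewrite !mxE. Qed.

Lemma latticeD mu nu : @weight_lattice K mu -> weight_lattice nu -> weight_lattice (mu + nu).
Proof. by move=> [x ->] [y ->]; exists (x + y); apply/rowP => j; rewrite !mxE rmorphD. Qed.

Lemma latticeZ (n : int) mu : @weight_lattice K mu -> weight_lattice (n%:~R *: mu).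
Proof. by move=> [x ->]; exists (n *: x); apply/rowP => j; rewrite !mxE rmorphM. Qed.

Lemma latticeN mu : @weight_lattice K mu -> weight_lattice (- mu).
Proof. by move=> h; rewrite -scaleN1r (_ : -1 = (-1)%:~R) //; exact: latticeZ. Qed.

Lemma lattice_Lambda i : @weight_lattice K (Lambda i).
Proof. by exists (\row_j (j == i :> nat)%:R); apply/rowP => j; rewrite !mxE rmorph_nat. Qed.

Lemma lattice_alpha i : @weight_lattice K (alpha i).
Proof.
exists (\row_(j < 3) (if (j < 2)%N then cartanA11 (inord j) i else (i == 0)%:R)).
by apply/rowP => j; rewrite !mxE; case: ifP => _; rewrite ?rmorph_nat.
Qed.

Lemma lattice_delta : @weight_lattice K d.
Proof. by apply: latticeD; exact: lattice_alpha. Qed.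

(** Outside the Ramond case each slot has a half-integral delta-part, and adding [q *: d] brings it
    into P. *)
Lemma lattice_slot t : weight_lattice (wt t + q *: d).
Proof.
have q2 : q *: d + q *: d = (1 - r)%:~R *: d by rewrite -scalerDl -two_zshift mulr_natl mulr2n.
have hd := lattice_delta; have ha := lattice_alpha 1.
case: t => [[k|k]|k] /=.
- rewrite scalerDl opprD -!addrA addNr addr0.
  by apply: latticeD => //; apply/latticeN/latticeZ.
- rewrite scalerDl -!addrA q2.
  by apply: latticeD; [exact: latticeN|apply: latticeD; exact: latticeZ].
- rewrite scalerDl -!addrA q2.
  by apply: latticeD; exact: latticeZ.
Qed.

(** The corrections of the slots total #|S| q delta, which lies in P because [q] is 0 or the number
    of particles is even. *)
Lemma state_wt_lattice S : sector_state rho S -> weight_lattice (state_wt K rho A S).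
Proof.
move=> hS.
have hl : weight_lattice lam by apply: latticeD; apply/latticeZ/lattice_Lambda.
have -> : state_wt K rho A S =
    lam + \sum_(t <- S) (wt t + q *: d) - (#|` S|%:R * q) *: d.
  rewrite big_split /= -addrA; congr (_ + _).
  rewrite [X in _ + X - _](_ : _ = (#|` S|%:R * q) *: d) ?addrK //.
  by rewrite big_const_seq count_predT iter_addr_0 -scaler_nat scalerA.
apply: latticeD; first apply: latticeD => //.
  by apply: big_ind => [||t _]; [exact: lattice0|exact: latticeD|exact: lattice_slot].
apply: latticeN.
have [hr|hr] := boolP (~~ rho); last first.
  by rewrite q_rho ?mulr0 ?scale0r; [exact: lattice0|exact/negPn].
have /negPf hodd := implyP hS hr.
rewrite -[#|` S|]odd_double_half hodd add0n -muln2 natrM -mulrA two_zshift -(rmorph_nat intr) -rmorphM.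
exact/latticeZ/lattice_delta.
Qed.

Lemma level_two_character (g : affineA11 K) (V : lieModule g) : is_L V lam ->
  exists2 ch, is_ch V ch & fmul (fexp (- lam)) ch =
    gf [set x : triple | ~~ rho ==> ~~ odd (#|` x.1| + #|` x.2.1| + #|` x.2.2.1|)] tw (fun=> 1).
Proof.
move=> [irr [v [v0 v_wt ev]]].
pose D : set state := [set S | sector_state rho S].
exists (gf D (state_wt K rho A) (fun=> 1)).
  split=> mu hmu.
    have fin := state_wt_fibers D mu.
    pose T := fset_set (D `&` [set S | state_wt K rho A S = mu]).
    exists #|` T|; last by rewrite /gf fsbig_finite // big_const_seq count_predT iter_addr_0.
    have dimV := weight_space_dim (e := eop K rho A) (f := fop K rho A)
      (h := fun x => hop rho A x : {linear fock K -> fock K})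
      (eop_fop hA) (hop_fop hA) (hop_vac rho A) (eop_vac K hA) (vac_neq0 K)
      (sector_subspace K rho) (@sector_vac K rho) (@sector_fop K rho A)
      (@sector_irred K rho A) irr v0 v_wt ev.
    apply: dimV; apply: has_dim_state_wt => S; rewrite in_fset_set //.
    by apply/idP/andP => [/set_mem[hS /= /eqP]|[hS /eqP e]] //; apply/mem_set.
  rewrite /gf (_ : _ `&` _ = set0) ?fsbig_set0 //; apply/seteqP; split=> // S [hS /= e].
  by apply: hmu; rewrite -e; exact: state_wt_lattice.
rewrite fexp_gf fmul_gf => [|mu]; last first.
  have h := finite_setX (@finite_finset unit setT) (state_wt_fibers D (mu + lam)).
  apply: sub_finite_set h => -[[] S] [[_ /= DS] e]; split=> //; split=> //=.
  by rewrite -e addrAC addNr add0r.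
symmetry; apply: (gf_reindex (phi := fun x => split_state x.2)).
- split.
  + by move=> [[] S] [_ hS]; move: hS; rewrite /D /sector_state /= card_split.
  + by move=> [[] S] [[] S'] _ _ /= /split_state_inj ->.
  + move=> x hx; exists (tt, merge_triple x); last exact: merge_tripleK.
    by split=> //=; rewrite /D /sector_state /= card_split merge_tripleK.
- by move=> [[] S] _ /=; rewrite state_wt_split addKr.
- by move=> *; rewrite mulr1.
Qed.

End LevelTwoCharacter.

(** * The universal product G and its specialisations *)

Section UniversalProduct.
Local Open Scope classical_set_scope.

Definition unit_exp (i : 'I_4) : {ffun 'I_4 -> nat} := [ffun j => (j == i : nat)].

Definition univ_prod : pser 4 :=
  qpoch [:: fopp (pvar 0); fopp (pvar 1); fopp (pvar 2)] (pvar 3).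

Lemma univ_prod_gf : univ_prod =
  gf [set: triple] (triple_wt (unit_exp 0) (unit_exp 1) (unit_exp 2) (unit_exp 3)) (triple_sg true).
Proof.
(* Graded by twice the exponent of y, the normalisation [L q = 2] required by [graded_set_wt]. *)
pose L (m : {ffun 'I_4 -> nat}) : rat := 2 * (m 3)%:R.
have LD x y : L (x + y) = L x + L y by rewrite /L ffunE natrD mulrDr.
have L0 : L 0 = 0 by rewrite /L ffunE mulr0.
have Le i : i != 3 -> L (unit_exp i) = 0%:~R.
  by move=> i3; rewrite /L ffunE eq_sym (negPf i3) mulr0.
have L3 : L (unit_exp 3) = 2 by rewrite /L ffunE eqxx mulr1.
exact: (qpoch_triple L0 LD (Le 0 isT) (Le 1 isT) (Le 2 isT) L3 _ _ _ true).
Qed.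

Lemma univ_prod_nonneg : fnonneg univ_prod.
Proof. by rewrite univ_prod_gf; apply: gf_nonneg => x _; rewrite triple_sgT. Qed.

Variables (M : nmodType) (K : numFieldType) (L : M -> K).
Hypothesis L0 : L 0 = 0.
Hypothesis LD : forall x y, L (x + y) = L x + L y.
Variables (a0 a1 a2 q : M) (c0 c1 c2 : int).
Hypotheses (La0 : L a0 = c0%:~R) (La1 : L a1 = c1%:~R) (La2 : L a2 = c2%:~R) (Lq : L q = 2).
Hypotheses (hc0 : -1 <= c0) (hc1 : -1 <= c1) (hc2 : -1 <= c2).

(** The factors of G are 1 + x_i y^k, so substituting x_i = e^a gives the symbol of -e^a: the signs
    on the two sides are opposite, whence [~~ sg]. *)
Lemma psubst_univ_prod (sg : bool) :
  psubst univ_prod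
    (args4 (fterm (~~ sg) a0) (fterm (~~ sg) a1) (fterm (~~ sg) a2) (fexp q)) =
  qpoch [:: fterm sg a0; fterm sg a1; fterm sg a2] (fexp q).
Proof.
pose b := tnth [tuple a0; a1; a2; q].
pose s := tnth [tuple sgn sg; sgn sg; sgn sg; 1].
have fE a : fterm (~~ sg) a = fscale (sgn sg) (fexp a).
  by apply/funext => m; rewrite /fterm /sgn /fscale /fopp; case: {+}sg => /=; rewrite ?mul1r ?mulN1r.
have -> : args4 (fterm (~~ sg) a0) (fterm (~~ sg) a1) (fterm (~~ sg) a2) (fexp q) =
    (fun i => fscale (s i) (fexp (b i))).
  apply/funext => -[[|[|[|[|i]]]] hi] //; rewrite /args4 /s /b !(tnth_nth 0) ?(tnth_nth (fexp 0)) /= ?fE //.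
  by rewrite fscale1.
have bE i : subst_wt b (unit_exp i) = b i.
  rewrite /subst_wt (bigD1 i) //= big1 => [|j ji]; last by rewrite ffunE (negPf ji).
  by rewrite ffunE eqxx addr0.
have sE i : subst_sg s (unit_exp i) = s i.
  rewrite /subst_sg (bigD1 i) //= big1 => [|j ji]; last by rewrite ffunE (negPf ji).
  by rewrite ffunE eqxx mulr1.
have wE x : subst_wt b (triple_wt (unit_exp 0) (unit_exp 1) (unit_exp 2) (unit_exp 3) x) =
    triple_wt a0 a1 a2 q x.
  by rewrite subst_triple_wt !bE.
rewrite univ_prod_gf psubst_gf; last first.
  have -> : (fun x => subst_wt b (triple_wt (unit_exp 0) (unit_exp 1) (unit_exp 2) (unit_exp 3) x)) =
     triple_wt a0 a1 a2 q by apply/funext.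
  exact: graded_fibers (graded_triple L0 LD La0 La1 La2 Lq hc0 hc1 hc2).
rewrite (qpoch_triple L0 LD La0 La1 La2 Lq hc0 hc1 hc2).
apply: eq_gf => // x _.
by rewrite triple_sgT mul1r (@subst_triple_sg _ s sg) ?sE.
Qed.

End UniversalProduct.

(** * Characters as products and half sums *)

Section LevelTwoProducts.
Local Open Scope classical_set_scope.
Variables (K : numFieldType) (rho : bool) (A : int).
Hypothesis hA : (A == 0) || ~~ rho && (A == -1).
Notation a := (wt_p K rho A).
Notation b := (wt_m K rho A).
Notation c := (wt_z K rho).
Notation y := (fexp (- delta) : fser 'rV[K]_3).
Notation evens := [set x : triple | ~~ odd (#|` x.1| + #|` x.2.1| + #|` x.2.2.1|)].

Lemma level_two_qpoch (sg : bool) : qpoch [:: fterm sg a; fterm sg b; fterm sg c] y =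
  gf [set: triple] (triple_wt a b c (- delta)) (triple_sg sg).
Proof.
exact: (qpoch_triple (@depth0 K) (@depthD K) (depth_p K rho A) (depth_m K rho A) (depth_z K rho)
  (depth_Ndelta K) (depth_p_ge hA) (depth_m_ge hA) (depth_z_ge rho) sg).
Qed.

Definition half_product : fser 'rV[K]_3 :=
  fscale 2^-1 (fadd (qpoch [:: fopp (fexp a); fopp (fexp b); fopp (fexp c)] y)
                    (qpoch [:: fexp a; fexp b; fexp c] y)).

Lemma half_product_gf : half_product = gf evens (triple_wt a b c (- delta)) (fun=> 1).
Proof.
rewrite /half_product (level_two_qpoch true) (level_two_qpoch false).
exact: (half_sum_gf (@depth0 K) (@depthD K) (depth_p K rho A) (depth_m K rho A) (depth_z K rho)
  (depth_Ndelta K) (depth_p_ge hA) (depth_m_ge hA) (depth_z_ge rho)).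
Qed.

Lemma half_product_nonneg : fnonneg half_product.
Proof. by rewrite half_product_gf; apply: gf_nonneg. Qed.

Lemma half_product_psubst : half_product =
  fscale 2^-1 (fadd (psubst univ_prod (args4 (fexp a) (fexp b) (fexp c) y))
    (psubst univ_prod (args4 (fopp (fexp a)) (fopp (fexp b)) (fopp (fexp c)) y))).
Proof.
have E := psubst_univ_prod (@depth0 K) (@depthD K) (depth_p K rho A) (depth_m K rho A) (depth_z K rho)
  (depth_Ndelta K) (depth_p_ge hA) (depth_m_ge hA) (depth_z_ge rho).
by rewrite (E true) (E false).
Qed.

Lemma level_two_half (g : affineA11 K) (V : lieModule g) : ~~ rho -> is_L V (lam K rho A) ->
  exists2 ch, is_ch V ch & fmul (fexp (- lam K rho A)) ch = half_product.
Proof.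
move=> hr hV; have [ch hch e] := level_two_character hA hV; exists ch => //.
by rewrite e half_product_gf hr.
Qed.

Lemma level_two_full (g : affineA11 K) (V : lieModule g) : rho -> is_L V (lam K rho A) ->
  exists2 ch, is_ch V ch & fmul (fexp (- lam K rho A)) ch =
    qpoch [:: fopp (fexp a); fopp (fexp b); fopp (fexp c)] y.
Proof.
move=> hr hV; have [ch hch e] := level_two_character hA hV; exists ch => //.
rewrite e (level_two_qpoch true) hr /=.
have -> : [set x : triple | true] = setT by apply/seteqP; split.
by apply: eq_gf => // x _; rewrite triple_sgT.
Qed.

End LevelTwoProducts.

(** * Specialisation to the three level-two weights *)

Section Weights.
Variable K : numFieldType.
Notation hd := (2^-1 *: delta : 'rV[K]_3).

Lemma zshiftT : zshift K true = 0.
Proof. by rewrite /zshift subrr mul0r. Qed.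

Lemma zshiftF : zshift K false = 2^-1.
Proof. by rewrite /zshift subr0 mul1r. Qed.

Lemma lam_10 : lam K true 0 = Lambda 0 + Lambda 1.
Proof. by rewrite /lam !scale1r. Qed.

Lemma lam_20 : lam K false (-1) = 2 *: Lambda 0.
Proof. by rewrite /lam [X in _ + X]scale0r addr0. Qed.

Lemma lam_02 : lam K false 0 = 2 *: Lambda 1.
Proof. by rewrite /lam [X in X + _]scale0r add0r. Qed.

Lemma weights_10 : [/\ wt_p K true 0 = - alpha 0, wt_m K true 0 = - alpha 1 & wt_z K true = - delta].
Proof.
rewrite /wt_p /wt_m /wt_z zshiftT !addr0 add0r scale1r scale0r addr0 scaleN1r.
by split=> //; rewrite /delta opprD addrCA subrr addr0.
Qed.

Lemma weights_20 : [/\ wt_p K false (-1) = - hd + alpha 1, wt_m K false (-1) = - hd - alpha 1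
  & wt_z K false = - hd].
Proof.
have E : -1 + 2^-1 = - 2^-1 :> K by field.
rewrite /wt_p /wt_m /wt_z zshiftF addNr add0r rmorphN rmorph1 E scaleNr.
by split=> //; rewrite addrC.
Qed.

Lemma weights_02 : [/\ wt_p K false 0 = - (3 *: hd) + alpha 1, wt_m K false 0 = hd - alpha 1
  & wt_z K false = - hd].
Proof.
have [_ _ ->] := weights_20.
have E : (0 + 1)%:~R + 2^-1 = 3 * 2^-1 :> K by rewrite add0r; field.
rewrite /wt_p /wt_m zshiftF E add0r scalerA.
by split=> //; rewrite addrC.
Qed.

End Weights.

Theorem proposition1p7 (R : realType) :
  let C : fieldType := R[i] in
  let L0 : 'rV[C]_3 := Lambda 0 in
  let L1 : 'rV[C]_3 := Lambda 1 in
  let a0 : 'rV[C]_3 := alpha 0 in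
  let a1 : 'rV[C]_3 := alpha 1 in
  let d : 'rV[C]_3 := delta in
  let hd : 'rV[C]_3 := 2^-1 *: d in
  let y : fser 'rV[C]_3 := fexp (- d) in
  let rhs2 : fser 'rV[C]_3 :=
    (2^-1 *: (qpoch [:: - e^(- hd + a1); - e^(- hd - a1); - e^(- hd)] y
              + qpoch [:: e^(- hd + a1); e^(- hd - a1); e^(- hd)] y))%fser in
  let rhs3 : fser 'rV[C]_3 :=
    (2^-1 *: (qpoch [:: - e^(- (3 *: hd) + a1); - e^(hd - a1); - e^(- hd)] y
              + qpoch [:: e^(- (3 *: hd) + a1); e^(hd - a1); e^(- hd)] y))%fser in
  let G : pser 4 :=
    qpoch [:: - pvar 0; - pvar 1; - pvar 2]%fser (pvar 3) in
  let half_sum (x1 x2 x3 : fser 'rV[C]_3) : fser 'rV[C]_3 :=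
    (2^-1 *: (psubst G (args4 x1 x2 x3 y)
              + psubst G (args4 (- x1) (- x2) (- x3) y)))%fser in
  (forall (g : affineA11 C) (V : lieModule g), is_L V (L0 + L1) ->
     exists2 ch, is_ch V ch &
       (e^(- (L0 + L1)) * ch = qpoch [:: - e^(- a0); - e^(- a1); - e^(- d)] y)%fser) /\
  (forall (g : affineA11 C) (V : lieModule g), is_L V (2 *: L0) ->
     exists2 ch, is_ch V ch & (e^(- (2 *: L0)) * ch)%fser = rhs2) /\
  (forall (g : affineA11 C) (V : lieModule g), is_L V (2 *: L1) ->
     exists2 ch, is_ch V ch & (e^(- (2 *: L1)) * ch)%fser = rhs3) /\
  fnonneg G /\
  rhs2 = half_sum (fexp (- hd + a1)) (fexp (- hd - a1)) (fexp (- hd)) /\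
  rhs3 = half_sum (fexp (- (3 *: hd) + a1)) (fexp (hd - a1)) (fexp (- hd)) /\
  fnonneg rhs2 /\
  fnonneg rhs3.
Proof.
move=> C L0 L1 a0 a1 d hd y rhs2 rhs3 G half_sum.
pose K : numFieldType := R[i].
have [p10 m10 z10] := weights_10 K.
have [p20 m20 z20] := weights_20 K.
have [p02 m02 z02] := weights_02 K.
have rhs2E : rhs2 = @half_product K false (-1) by rewrite /half_product p20 m20 z20.
have rhs3E : rhs3 = @half_product K false 0 by rewrite /half_product p02 m02 z02.
split; [|split; [|split; [|split; [|split; [|split; [|split]]]]]].
- move=> g V; rewrite /L0 /L1 -(lam_10 K) => /(@level_two_full K true 0 isT _ _ isT).
  by rewrite p10 m10 z10.
- move=> g V; rewrite /L0 -(lam_20 K) rhs2E.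
  exact: (@level_two_half K false (-1) isT g V isT).
- move=> g V; rewrite /L1 -(lam_02 K) rhs3E.
  exact: (@level_two_half K false 0 isT g V isT).
- exact: univ_prod_nonneg.
- rewrite rhs2E (@half_product_psubst K false (-1) isT) p20 m20 z20; exact: erefl.
- rewrite rhs3E (@half_product_psubst K false 0 isT) p02 m02 z02; exact: erefl.
- by rewrite rhs2E; exact: (@half_product_nonneg K false (-1) isT).
- by rewrite rhs3E; exact: (@half_product_nonneg K false 0 isT).
Qed.
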